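(* For all $\lambda>0$ there exists $\sigma_0=\sigma_0(\lambda)$ such that if $\sigma\ge\sigma_0\ge1$ and $\psi(\sigma)$ is a function of $y\in\mathbb R$ satisfying $$\sum_{m=0}^2|\psi_m(\sigma)|+\left\|\frac{\psi_-(y,\sigma)}{1+|y|^3}\right\|_{L^\infty}+\|\psi_e(\sigma)\|_{L^\infty}<+\infty,$$ then $\theta(s)=\mathcal K(s,\sigma)\psi(\sigma)$ satisfies, for all $s\in[\sigma,\sigma+\lambda]$, $$|\theta_2(s)|\le\left(\frac\sigma s\right)^2|\psi_2(\sigma)|+\frac{C(s-\sigma)}{s}\left(\sum_{l=0}^2|\psi_l(\sigma)|+\left\|\frac{\psi_-(y,\sigma)}{1+|y|^3}\right\|_{L^\infty}\right)+C(s-\sigma)e^{-s/2}\|\psi_e(\sigma)\|_{L^\infty},$$ $$\left\|\frac{\theta_-(y,s)}{1+|y|^3}\right\|_{L^\infty}\le\frac{Ce^{s-\sigma}\left((s-\sigma)^2+1\right)}{s}\left(|\psi_0(\sigma)|+|\psi_1(\sigma)|+\sqrt s\,|\psi_2(\sigma)|\right)+Ce^{-\frac{s-\sigma}2}\left\|\frac{\psi_-(y,\sigma)}{1+|y|^3}\right\|_{L^\infty}+\frac{Ce^{-(s-\sigma)^2}}{s^{3/2}}\|\psi_e(\sigma)\|_{L^\infty},$$ $$\|\theta_e(s)\|_{L^\infty}\le Ce^{s-\sigma}\left(\sum_{l=0}^2s^{l/2}|\psi_l(\sigma)|+s^{3/2}\left\|\frac{\psi_-(y,\sigma)}{1+|y|^3}\right\|_{L^\infty}\right)+Ce^{-\frac{s-\sigma}p}\|\psi_e(\sigma)\|_{L^\infty},$$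 where $C=C(\lambda,K)>0$.
   Context: Setting. The space dimension is $n=1$ and $p>1$. The function $h\in\mathcal C^1(\mathbb R,\mathbb R)$ satisfies either (H): $|h^{(j)}(z)|\le M\left(\frac{|z|^{p-j}}{\log^a(2+z^2)}+1\right)$ for $j=0,1$, with $a>1$, $M>0$; or (H'): $h(z)=\mu\frac{|z|^{p-1}z}{\log^a(2+z^2)}$ with $a>0$, $\mu\in\mathbb R$. Put $\imath=0$ in case (H), $\imath=1$ in case (H'). Put $\kappa=(p-1)^{-1/(p-1)}$, $f(z)=\kappa\left(1+\frac{p-1}{4p}z^2\right)^{-\frac1{p-1}}$. Let $\phi$ be a positive solution (defined for large $s$) of $\phi_s=-\frac{\phi}{p-1}+\phi^p+e^{-\frac{ps}{p-1}}h(e^{\frac s{p-1}}\phi)$ with $\phi(s)\to\kappa$ as $s\to+\infty$, and set $\varphi(y,s)=\frac{\phi(s)}{\kappa}\left(f\left(\frac y{\sqrt s}\right)+\frac{\kappa}{2ps}\right)$. Let $\mathcal L=\partial_y^2-\frac y2\partial_y+1$ and $V(y,s)=p\left(\varphi(y,s)^{p-1}-\frac1{p-1}\right)+\imath e^{-s}h'(e^{\frac s{p-1}}\varphi(y,s))$. $\mathcal K(s,\sigma)$, $s\ge\sigma$, denotes the fundamental solution of the linear operator $\mathcal L+V$: $\partial_s\mathcal K(s,\sigma)=(\mathcal L+V)\mathcal K(s,\sigma)$, $\mathcal K(\sigma,\sigma)=\mathrm{Identity}$. Decomposition. Let $\rho(y)=(4\pi)^{-1/2}e^{-y^2/4}$,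 $h_m(y)=\sum_{k=0}^{[m/2]}\frac{m!}{k!(m-2k)!}(-1)^ky^{m-2k}$ (not to be confused with $h$), $k_m=h_m/\|h_m\|^2_{L^2_\rho}$. Let $\chi_0\in\mathcal C_0^\infty([0,+\infty))$, $\mathrm{supp}\,\chi_0\subset[0,2]$, $\chi_0\equiv1$ on $[0,1]$, $\chi(y,s)=\chi_0\left(\frac{|y|}{K\sqrt s}\right)$ with $K>0$ a fixed, sufficiently large constant. For a function $g(\cdot,s)$ at time $s$: $g_b=\chi g$, $g_e=(1-\chi)g$, $g_m(s)=\int g_bk_m\rho\,dy$ ($m=0,1,2$), $g_-=g_b-\sum_{m=0}^2g_mh_m$. Components of $\psi(\sigma)$ are taken with the cut-off $\chi(\cdot,\sigma)$, those of $\theta(s)$ with $\chi(\cdot,s)$. Constants $C$ may also depend on the fixed data of the problem ($a,p,M,\mu$). *)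

(* Defs.v *)
From HB Require Import structures.
From mathcomp Require Import all_boot all_order all_algebra.
From mathcomp Require Import all_classical all_reals all_analysis.
Set Implicit Arguments.
Unset Strict Implicit.
Unset Printing Implicit Defensive.
Import Order.TTheory GRing.Theory Num.Theory.
Import numFieldNormedType.Exports.
Local Open Scope classical_set_scope.
Local Open Scope ring_scope.

Section Problem.
Context {R : realType}.
Implicit Types (p a M mu s sigma y z Kc : R) (h phi g : R -> R).

Definition logpow a z : R := ln (2 + z ^+ 2) `^ a.

Definition C1 h : Prop := (forall z, derivable h z 1) /\ continuous (derive1 h).

Definition perturb_bound p a M h : Prop :=
  [/\ 1 < a, 0 < M & forall (j : nat) z, (j <= 1)%N ->
    `|derive1n j h z| <= M * (`|z| `^ (p - j%:R) / logpow a z + 1)].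

Definition perturb_explicit p a mu h : Prop :=
  0 < a /\ forall z, h z = mu * (`|z| `^ (p - 1) * z / logpow a z).

(* [iota] is also the factor of h' in [potential]; each case ignores one of
   [M] and [mu]. *)
Definition perturbation (iota : bool) p a M mu h : Prop :=
  C1 h /\ (if iota then perturb_explicit p a mu h else perturb_bound p a M h).

Definition kappa p : R := (p - 1) `^ (- (p - 1)^-1).

Definition profile p z : R :=
  kappa p * (1 + (p - 1) / (4 * p) * z ^+ 2) `^ (- (p - 1)^-1).

Definition ode_solution p h phi : Prop :=
  (exists s0 : R, forall s, s0 < s -> 0 < phi s /\
     is_derive s 1 phi
       (- phi s / (p - 1) + phi s `^ p
        + expR (- (p * s / (p - 1))) * h (expR (s / (p - 1)) * phi s)))
  /\ phi s @[s --> +oo] --> kappa p.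

Definition varphi p phi y s : R :=
  phi s / kappa p * (profile p (y / Num.sqrt s) + kappa p / (2 * p * s)).

Definition potential (iota : bool) p h phi y s : R :=
  p * (varphi p phi y s `^ (p - 1) - (p - 1)^-1)
  + iota%:R * (expR (- s) * derive1 h (expR (s / (p - 1)) * varphi p phi y s)).

Definition opL g y : R := derive1n 2 g y - y / 2 * derive1 g y + g y.

Definition rho y : R := (Num.sqrt (4 * pi))^-1 * expR (- (y ^+ 2 / 4)).

Definition in_L2rho g : Prop :=
  measurable_fun setT g /\
  (\int[lebesgue_measure]_y (g y ^+ 2 * rho y)%:E < +oo)%E.

(* C^{2,1} solutions theta(s, y) of  theta_s = (L + V) theta  for s > sigma *)
Definition classical_solution (V : R -> R -> R) sigma (theta : R -> R -> R) :
    Prop :=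
  forall s y, sigma < s ->
  [/\ derivable (theta^~ y) s 1,
      derivable (theta s) y 1,
      derivable (derive1 (theta s)) y 1,
      [/\ {for (s, y), continuous (fun q : R * R => theta q.1 q.2)},
          {for (s, y), continuous (fun q : R * R => derive1 (theta^~ q.2) q.1)},
          {for (s, y), continuous (fun q : R * R => derive1 (theta q.1) q.2)} &
          {for (s, y), continuous (fun q : R * R => derive1n 2 (theta q.1) q.2)}] &
      derive1 (theta^~ y) s = opL (theta s) y + V y s * theta s y].

(* [K s sigma] is the solution operator on L^2_rho, the natural space for L:
   d/ds K(s, sigma) = (L + V) K(s, sigma) classically for s > sigma,
   K(sigma, sigma) = Identity, and s |-> K(s, sigma) f is continuous on
   [sigma, +oo[ with values in L^2_rho.  The last clause gives the initial
   condition its meaning and excludes the non-unique (Tychonoff) solutions. *)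
Definition fundamental_solution (V : R -> R -> R) sigma
    (K : R -> R -> (R -> R) -> (R -> R)) : Prop :=
  forall g, in_L2rho g ->
  [/\ K sigma sigma g = g,
      forall s, sigma <= s -> in_L2rho (K s sigma g),
      forall s, sigma <= s ->
        (\int[lebesgue_measure]_y
           ((K t sigma g y - K s sigma g y) ^+ 2 * rho y)%:E)%E
        @[t --> within [set t | sigma <= t] (nbhs s)] --> 0%E &
      classical_solution V sigma (fun s => K s sigma g)].

(* Hermite polynomials h_m, and k_m = h_m / ||h_m||^2 in L^2_rho *)
Definition hermite (m : nat) y : R :=
  \sum_(0 <= k < (m./2).+1)
    (m`!)%:R / ((k`!)%:R * ((m - k.*2)`!)%:R) * (-1) ^+ k * y ^+ (m - k.*2).

Definition hermite_dual (m : nat) y : R :=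
  hermite m y / \int[lebesgue_measure]_x (hermite m x ^+ 2 * rho x).

(* chi0 in C_0^oo([0, +oo[), supp chi0 in [0, 2], chi0 = 1 on [0, 1].
   Only the values of [chi0] on [0, +oo[ matter; smoothness at 0 follows from
   constancy on [0, 1]. *)
Definition cutoff_profile (chi0 : R -> R) : Prop :=
  [/\ forall (n : nat) x, 0 < x -> derivable (derive1n n chi0) x 1,
      forall x, 2 < x -> chi0 x = 0 &
      forall x, 0 <= x <= 1 -> chi0 x = 1].

Definition cutoff (chi0 : R -> R) Kc s y : R := chi0 (`|y| / (Kc * Num.sqrt s)).

Definition part_b (chi0 : R -> R) Kc s g y : R := cutoff chi0 Kc s y * g y.

Definition part_e (chi0 : R -> R) Kc s g y : R := (1 - cutoff chi0 Kc s y) * g y.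

Definition part_mode (chi0 : R -> R) Kc s g (m : nat) : R :=
  \int[lebesgue_measure]_y (part_b chi0 Kc s g y * hermite_dual m y * rho y).

Definition part_minus (chi0 : R -> R) Kc s g y : R :=
  part_b chi0 Kc s g y - \sum_(m < 3) part_mode chi0 Kc s g m * hermite m y.

Definition norm_oo g : \bar R := Lnorm lebesgue_measure +oo%E (EFin \o g).

Definition norm_minus (chi0 : R -> R) Kc s g : \bar R :=
  norm_oo (fun y => part_minus chi0 Kc s g y / (1 + `|y| ^+ 3)).

Definition norm_ext (chi0 : R -> R) Kc s g : \bar R := norm_oo (part_e chi0 Kc s g).

End Problem.

(* Main.v *)
Require Import Defs.
From HB Require Import structures.
From mathcomp Require Import all_boot all_order all_algebra.
From mathcomp Require Import all_classical all_reals all_analysis.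
From mathcomp Require Import measurable_realfun ess_sup_inf.
From mathcomp Require Import ring lra.
Import Order.TTheory GRing.Theory Num.Theory.
Import numFieldNormedType.Exports.
Local Open Scope classical_set_scope.
Local Open Scope ring_scope.

(** Since the constants may depend on [lambda], every factor such as
    [exp (s - sigma)] stays between two positive constants, and so does
    [s / sigma].  What has to be proved is how the components of the solution
    depend on the powers of [s], over a bounded time.  A comparison principle
    is enough for this; no kernel of [L] is needed.

    The potential is first shown to satisfy [|V| <= C] and
    [|V| <= C (1 + y^2) / s] for large times ([potential_bound]).  Up to an
    explicit slowly varying factor [1 + m], the function [phi^(p-1)] is trapped
    near the unstable rest point [1/(p-1)] of a scalar equation, and
    [unstable_bound] shows that it stays at distance [O(1/s)] from it
    ([phase_bound]); the profile [f] and the corrections in [varphi] are then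
    compared with a constant.

    The comparison principle ([comparison]) says that a subsolution of a
    bounded perturbation of [L] whose positive part is bounded in [L^2_rho],
    and tends to [0] there at the initial time, is nonpositive.  It is proved by
    an energy method.  It gives [flow_barrier]: if the data differ from a
    combination [c_0 + c_1 y + c_2 (y^2 - 2)] by at most [D G], where
    [L G <= cG G], and if [V] acting on the free evolution [H] of this
    combination under [L] is at most [E G], then the solution differs from [H]
    by at most [C (D + E) G].  Three choices of [G] give the three estimates.

    For the exterior part ([exterior_estimate]) take [G = 1] and no mode: on
    [|y| <= 2 Kc sqrt sigma] the inner part of the data is bounded by the
    right-hand side.

    For the negative part ([minus_estimate]) take the cubic weight and the three
    modes of the data.  The source is small, because [V] gains a power of [s]
    against the cubic weight, and the exterior part of the data counts for
    [sigma^(-3/2)] because it lives far away.  The free evolution itself is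
    removed by the projection, except for its part beyond the cut-off, which is
    small for the same reason.

    For the second mode ([mode_estimate]) take [G = A (1 + |y|^3) + B exp (y^2 / 16)]
    and no mode, where [B] carries the exterior part and is smaller than its norm
    by the factor [exp (- sigma / 2)] as soon as [Kc >= 3]; the weight [rho]
    still absorbs [exp (y^2 / 16)].  Moving the operator onto the test function
    [chi k_2], which is almost in the kernel of the adjoint of [L], shows that
    the mode moves at speed [O(1/s)].  The factor [(sigma / s)^2] of the statement
    is [1 - O((s - sigma) / s)] and is absorbed in the second term. *)

(** * Differentiation, continuity and integration of real functions *)

Section Calculus.
Set Implicit Arguments. Unset Strict Implicit.
Context {R : realType}.
Local Notation mu := (@lebesgue_measure R).

Lemma deriv_ext (x : R) (f g : R -> R) (df dg : R) :
  f =1 g -> df = dg -> is_derive x 1 f df -> is_derive x 1 g dg.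
Proof. by move=> /funext -> ->. Qed.

Lemma derive_cont (f : R -> R) (x df : R) :
  is_derive x 1 f df -> {for x, continuous f}.
Proof.
by move=> [df' _]; apply: differentiable_continuous; exact/derivable1_diffP.
Qed.

Lemma derives_continuous (f f' : R -> R) :
  (forall x : R, is_derive x 1 f (f' x)) -> continuous f.
Proof. by move=> df x; exact: derive_cont (df x). Qed.

Lemma deriv1_is (f : R -> R) (x : R) : derivable f x 1 -> is_derive x 1 f (derive1 f x).
Proof. by move=> df; apply: DeriveDef => //; rewrite derive1E. Qed.

Lemma is_derive1E (f : R -> R) (x df : R) : is_derive x 1 f df -> derive1 f x = df.
Proof. by move=> [? <-]; rewrite derive1E. Qed.

(** The rules below produce derivatives in the syntactic form of the function,
    so that a derivative is computed by one term ([d] for derivative, followed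
    by the operation) and normalised afterwards by [deriv_ext]; [cM], [cD] and
    the others do the same for continuity. *)
Section Rules.
Context (f g : R -> R) (x df dg : R).
Hypotheses (Df : is_derive x 1 f df) (Dg : is_derive x 1 g dg).

Lemma dD : is_derive x 1 (fun t => f t + g t) (df + dg).
Proof. exact: is_deriveD. Qed.

Lemma dN : is_derive x 1 (fun t => - f t) (- df).
Proof. exact: is_deriveN. Qed.

Lemma dB : is_derive x 1 (fun t => f t - g t) (df - dg).
Proof. exact: is_deriveB. Qed.

Lemma dM : is_derive x 1 (fun t => f t * g t) (df * g x + f x * dg).
Proof.
have := is_deriveM Df Dg; apply: deriv_ext => [//|].
by rewrite /GRing.scale /= addrC mulrC.
Qed.

Lemma dZ (k : R) : is_derive x 1 (fun t => k * f t) (k * df).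
Proof. exact: (@is_deriveZ _ _ _ f k). Qed.

Lemma dX n : is_derive x 1 (fun t => f t ^+ n) (n%:R * f x ^+ n.-1 * df).
Proof. by have := is_deriveX n Df; apply: deriv_ext => [t|//]; rewrite fctE. Qed.

Lemma dV : f x != 0 -> is_derive x 1 (fun t => (f t)^-1) (- df / f x ^+ 2).
Proof.
move=> fx; have := is_deriveV fx Df; apply: deriv_ext => [//|].
by rewrite /GRing.scale /= mulrC !mulrN mulNr.
Qed.

Lemma dchain (h : R -> R) (dh : R) : is_derive (f x) 1 h dh ->
  is_derive x 1 (fun t => h (f t)) (dh * df).
Proof. by move=> Dh; exact: is_derive1_comp Dh Df. Qed.

Lemma dexp : is_derive x 1 (fun t => expR (f t)) (expR (f x) * df).
Proof. by apply: dchain; exact: is_derive_expR. Qed.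

Lemma dpow r : 0 < f x ->
  is_derive x 1 (fun t => f t `^ r) (r * f x `^ (r - 1) * df).
Proof. by move=> fx; apply: (dchain (h := fun u => u `^ r)); exact: is_derive1_powR. Qed.

Lemma dln : 0 < f x -> is_derive x 1 (fun t => ln (f t)) ((f x)^-1 * df).
Proof. by move=> fx; apply: dchain; exact: is_derive1_ln. Qed.

Lemma dsqrt : 0 < f x ->
  is_derive x 1 (fun t => Num.sqrt (f t)) ((2 * Num.sqrt (f x))^-1 * df).
Proof. by move=> fx; apply: dchain; exact: is_derive1_sqrt. Qed.

End Rules.

Lemma dconst (k x : R) : is_derive x 1 (fun=> k) 0.
Proof. exact: is_derive_cst. Qed.

Lemma did (x : R) : is_derive x 1 (fun t : R => t) 1.
Proof. exact: is_derive_id. Qed.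

Lemma cM (f g : R -> R) : continuous f -> continuous g ->
  continuous (fun y => f y * g y).
Proof. by move=> cf cg y; apply: continuousM; [exact: cf|exact: cg]. Qed.

Lemma cD (f g : R -> R) : continuous f -> continuous g ->
  continuous (fun y => f y + g y).
Proof. by move=> cf cg y; apply: continuousD; [exact: cf|exact: cg]. Qed.

Lemma cN (f : R -> R) : continuous f -> continuous (fun y => - f y).
Proof. by move=> cf y; apply: continuousN; exact: cf. Qed.

Lemma cC (k : R) : continuous (fun _ : R => k).
Proof. by move=> y; exact: cst_continuous. Qed.

Lemma cI : continuous (fun y : R => y).
Proof. by move=> y; exact: cvg_id. Qed.

Lemma cX (f : R -> R) n : continuous f -> continuous (fun y => f y ^+ n).
Proof.
move=> cf y; apply: (@continuous_comp _ _ _ f (fun z => z ^+ n)); first exact: cf.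
exact: exprn_continuous.
Qed.

Lemma cE (f : R -> R) : continuous f -> continuous (fun y => expR (f y)).
Proof. by move=> cf y; apply: continuous_comp; [exact: cf|exact: continuous_expR]. Qed.

Lemma near_id (P : R -> Prop) (x a b : R) : a < x < b ->
  (forall t, a < t < b -> P t) -> \forall t \near x, P t.
Proof.
move=> xab h; have := @near_in_itvoo R a b x; rewrite in_itv /= => /(_ xab).
by apply: filterS => t; rewrite in_itv /=; exact: h.
Qed.

Lemma integrable_segment (f : R -> R) a b : continuous f ->
  mu.-integrable `[a, b] (EFin \o f).
Proof.
move=> cf; apply: continuous_compact_integrable; first exact: segment_compact.
by apply: continuous_subspaceT => x; exact: cf.
Qed.

Lemma FTC_segment (F f : R -> R) a b : a < b ->
  (forall x : R, is_derive x 1 F (f x)) -> continuous f ->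
  \int[mu]_(x in `[a, b]) f x = F b - F a.
Proof.
move=> ab dF cf; rewrite /Rintegral (@continuous_FTC2 R f F)//.
- by apply: continuous_subspaceT => x; exact: cf.
- have cF := derives_continuous dF; split=> [x _||].
  + by have [] := dF x.
  + by apply: cvg_at_right_filter; exact: cF.
  + by apply: cvg_at_left_filter; exact: cF.
- by move=> x _; rewrite derive1E; have [] := dF x.
Qed.

Lemma compact_bound (T : topologicalType) (f : T -> R) (A : set T) :
  compact A -> (forall x, A x -> {for x, continuous f}) ->
  exists2 M : R, 0 <= M & forall x, A x -> `|f x| <= M.
Proof.
move=> cA cf; have [->|/set0P A0] := eqVneq A set0; first by exists 0.
have cnf : {within A, continuous (fun x => `|f x|)}.
  apply: continuous_in_subspaceT => x; rewrite inE => Ax.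
  by apply: continuous_comp; [exact: cf|exact: norm_continuous].
have [c _ h] := compact_EVT_max A0 cA cnf.
by exists `|f c| => // x Ax; apply: h; rewrite inE.
Qed.

(** Joint continuity of the derivative, on a compact neighbourhood of
    [{s} * [a, b]], provides the constant that dominates it. *)
Lemma derive_integral_segment (u v s a b : R) (F f : R -> R -> R) :
  u < s < v ->
  (forall t y : R, u < t < v -> is_derive t 1 (F^~ y) (f t y)) ->
  (forall t, u < t < v -> continuous (F t)) ->
  (forall t y, u < t < v -> {for (t, y), continuous (fun q : R * R => f q.1 q.2)}) ->
  is_derive s 1 (fun t => \int[mu]_(y in `[a, b]) F t y)
    (\int[mu]_(y in `[a, b]) f s y).
Proof.
move=> /andP[us sv] dF cF cf.
pose u' := (u + s) / 2; pose v' := (s + v) / 2.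
have I' t : u' <= t <= v' -> u < t < v.
  by rewrite /u' /v' => /andP[? ?]; apply/andP; split; lra.
have [M M0 HM] : exists2 M, 0 <= M &
    forall q : R * R, (`[u', v'] `*` `[a, b]) q -> `|f q.1 q.2| <= M.
  apply: (@compact_bound _ (fun q : R * R => f q.1 q.2)).
    by apply: compact_setX; exact: segment_compact.
  move=> -[t y] [/=]; rewrite !in_itv /= => tI _; apply: cf; exact: I'.
have Is : `]u', v'[%classic s by rewrite /= in_itv /= /u' /v'; apply/andP; split; lra.
have dfE t y : u < t < v -> partial1of2 F t y = f t y.
  by move=> tI; rewrite partial1of2E; have [] := dF t y tI.
have intF t : `]u', v'[%classic t -> mu.-integrable `[a, b] (EFin \o F t).
  by rewrite /= in_itv /= => /andP[? ?]; apply/integrable_segment/cF/I'; lra.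
have dF' t y : `]u', v'[%classic t -> `[a, b]%classic y -> derivable (F^~ y) t 1.
  rewrite /= !in_itv /= => /andP[? ?] _; have [//|//] := dF t y _.
  by apply: I'; lra.
have iM : mu.-integrable `[a, b] (EFin \o (cst M : R -> R)).
  by apply: integrable_segment => x; exact: cst_continuous.
have fM t y : `]u', v'[%classic t -> `[a, b]%classic y -> `|partial1of2 F t y| <= cst M y.
  rewrite /= !in_itv /= => /andP[? ?] yab; rewrite dfE; last by apply: I'; lra.
  by apply: (HM (t, y)); split => /=; rewrite in_itv /=; lra.
have mab : measurable (`[a, b]%classic : set R) by exact: measurable_itv.
apply: DeriveDef.
  exact: (@derivable_under_integral R _ _ mu F _ mab _ _ _ Is intF dF' _ (fun=> M0) iM fM).
rewrite -derive1E.
rewrite (@differentiation_under_integral R _ _ mu F _ mab _ _ _ Is intF dF' _ (fun=> M0) iM fM).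
by apply: eq_Rintegral => y _; rewrite dfE// us sv.
Qed.

End Calculus.

(** The tactic [cont] proves continuity by following the syntax of a function;
    [syn_continuous] only shields the goal from unification meanwhile. *)
Definition syn_continuous {R : realType} (f : R -> R) : Prop := continuous f.

Ltac syn_cont := lazymatch goal with
  | |- @syn_continuous ?R (fun _ => ?k) => exact (@cC R k)
  | |- @syn_continuous ?R (fun y => y) => exact (@cI R)
  | |- @syn_continuous ?R (fun y => @GRing.mul _ (@?f y) (@?g y)) =>
      refine (@cM R f g _ _);
      [change (@syn_continuous R f)|change (@syn_continuous R g)]; syn_cont
  | |- @syn_continuous ?R (fun y => @Algebra.add _ (@?f y) (@?g y)) =>
      refine (@cD R f g _ _);
      [change (@syn_continuous R f)|change (@syn_continuous R g)]; syn_cont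
  | |- @syn_continuous ?R (fun y => @Algebra.opp _ (@?f y)) =>
      refine (@cN R f _); change (@syn_continuous R f); syn_cont
  | |- @syn_continuous ?R (fun y => @GRing.exp _ (@?f y) ?n) =>
      refine (@cX R f n _); change (@syn_continuous R f); syn_cont
  | |- @syn_continuous ?R (fun y => expR (@?f y)) =>
      refine (@cE R f _); change (@syn_continuous R f); syn_cont
  | |- @syn_continuous ?R ?f =>
      first [unfold syn_continuous; assumption | unfold f; syn_cont]
  end.

Ltac cont := lazymatch goal with
  |- forall x, @continuous_at _ _ x ?f => change (syn_continuous f); syn_cont end.

(** * The Gaussian weight and the Hermite polynomials *)

Section Gaussian.
Set Implicit Arguments. Unset Strict Implicit.
Context {R : realType}.
Implicit Types (f g F : R -> R) (y c : R).
Local Notation mu := (@lebesgue_measure R).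

Definition gauss8 (y : R) : R := expR (- (y ^+ 2 / 8)).

Lemma gauss8_gt0 y : 0 < gauss8 y.
Proof. exact: expR_gt0. Qed.

Lemma integrable_gauss8 : mu.-integrable setT (EFin \o gauss8).
Proof.
have i2 := @integrable_normal_pdf R 0 2.
rewrite (_ : EFin \o gauss8 =
    (fun x => ((@normal_peak R 2)^-1)%:E * (normal_pdf 0 2 x)%:E)%E).
  by apply: integrableZl.
have p0 : (2 : R) != 0 by rewrite pnatr_eq0.
apply/funext => x /=; rewrite /normal_pdf (negbTE p0) -EFinM mulrA.
rewrite mulVf ?gt_eqF ?normal_peak_gt0// mul1r /normal_fun /gauss8.
by congr (expR _)%:E; rewrite subr0; field.
Qed.

Lemma integrable_le_gauss8 f c : measurable_fun setT f ->
  (forall y, `|f y| <= c * gauss8 y) ->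
  mu.-integrable setT (EFin \o f) /\
  `|\int[mu]_y f y| <= c * \int[mu]_y gauss8 y.
Proof.
move=> mf fc.
have ig : mu.-integrable setT (EFin \o (fun y => c * gauss8 y)).
  rewrite (_ : EFin \o _ = (fun x => c%:E * (EFin \o gauss8) x)%E); last first.
    by apply/funext => x /=; rewrite EFinM.
  by apply: integrableZl => //; exact: integrable_gauss8.
have if_ : mu.-integrable setT (EFin \o f).
  apply: le_integrable ig => //; first exact/measurable_EFinP.
  by move=> y _ /=; rewrite lee_fin; apply: le_trans (fc y) (ler_norm _).
split=> //; rewrite -RintegralZl//; last exact: integrable_gauss8.
apply: le_trans (le_normr_Rintegral measurableT if_) _.
by apply: le_Rintegral => //; exact: (integrable_norm if_).
Qed.

Lemma integral_gauss8_gt0 : 0 < \int[mu]_y gauss8 y.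
Proof.
have sub : (`[0, 1]%classic : set R) `<=` setT by [].
have i1 : \int[mu]_(y in `[0, 1]) gauss8 1 = gauss8 1.
  by rewrite Rintegral_cst//= lebesgue_measure_itv /= lte_fin ltr01 /= subr0 mulr1.
apply: lt_le_trans (gauss8_gt0 1) _; rewrite -i1.
rewrite Rintegral_mkcond; apply: le_Rintegral => //; last 2 first.
- exact: integrable_gauss8.
- move=> y _; rewrite patchE; case: ifPn => [|_]; last exact/ltW/gauss8_gt0.
  rewrite inE /= in_itv /= => /andP[y0 y1]; rewrite /gauss8 ler_expR.
  by nra.
rewrite -restrict_EFin; apply/integrable_restrict => //=; rewrite setTI.
by apply: integrable_segment => x; exact: cst_continuous.
Qed.

Lemma rho_gt0 y : 0 < rho y.
Proof. by rewrite /rho mulr_gt0 ?expR_gt0// invr_gt0 sqrtr_gt0 mulr_gt0// pi_gt0. Qed.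

Lemma is_derive_rho y : is_derive y 1 rho (- (y / 2) * rho y).
Proof.
have h : is_derive y 1 (fun x : R => - (x ^+ 2 / 4)) (- (y / 2)).
  by apply: is_derive_eq; rewrite /GRing.scale /=; field.
have := dZ (dexp h) ((Num.sqrt (4 * pi))^-1).
by apply: deriv_ext => [x //|]; rewrite /rho /=; ring.
Qed.

Lemma continuous_rho : continuous (@rho R).
Proof. exact: derives_continuous is_derive_rho. Qed.

Lemma measurable_rho : measurable_fun setT (@rho R).
Proof. exact: continuous_measurable_fun continuous_rho. Qed.

(** Since [rho] decays like [exp (- y^2 / 4)], the factor [exp (- y^2 / 8)]
    that is kept leaves room both for [exp (y^2 / 16)] and for the polynomial,
    which is at most a multiple of [exp (y^2 / 16)]. *)
Lemma poly_rho_le k : exists2 C : R, 0 < C &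
  forall y, (1 + y ^+ 2) ^+ k * expR (y ^+ 2 / 16) * rho y <= C * gauss8 y.
Proof.
pose K : R := 16 * k.+1%:R.
have K1 : 1 <= K by rewrite /K; have : (1 : R) <= k.+1%:R; [rewrite ler1n|lra].
have K0 : 0 < K by lra.
exists (K ^+ k * (Num.sqrt (4 * pi))^-1).
  by rewrite mulr_gt0 ?exprn_gt0// invr_gt0 sqrtr_gt0 mulr_gt0// pi_gt0.
move=> y; have y2 : 0 <= y ^+ 2 by rewrite sqr_ge0.
have h1 : 1 + y ^+ 2 <= K * expR (y ^+ 2 / K).
  apply: (@le_trans _ _ (K * (1 + y ^+ 2 / K))); last first.
    by rewrite ler_wpM2l ?(ltW K0)// expR_ge1Dx.
  by rewrite mulrDr mulr1 mulrCA divff ?gt_eqF// mulr1 lerD2r.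
have h2 : (1 + y ^+ 2) ^+ k <= K ^+ k * expR (y ^+ 2 / 16).
  apply: (@le_trans _ _ ((K * expR (y ^+ 2 / K)) ^+ k)).
    by rewrite lerXn2r ?nnegrE ?mulr_ge0 ?expR_ge0//; lra.
  rewrite exprMn ler_wpM2l ?exprn_ge0//; first lra.
  rewrite -expRM_natr ler_expR -mulrA ler_wpM2l//.
  by rewrite mulrC ler_pdivrMr// /K mulrA mulVf// mul1r ler_nat.
rewrite /rho /gauss8.
have -> : - (y ^+ 2 / 8) = y ^+ 2 / 16 + (y ^+ 2 / 16 + - (y ^+ 2 / 4)) by field.
rewrite !expRD; set s := (Num.sqrt _)^-1; set e := expR (y ^+ 2 / 16).
set r := expR (- _).
have e0 : 0 < e by exact: expR_gt0.
have r0 : 0 < r by exact: expR_gt0.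
have s0 : 0 <= s by rewrite invr_ge0 sqrtr_ge0.
rewrite (_ : _ * e * (s * r) = (1 + y ^+ 2) ^+ k * (e * s * r)); last by ring.
rewrite (_ : K ^+ k * s * _ = (K ^+ k * e) * (e * s * r)); last by ring.
by rewrite ler_wpM2r// !mulr_ge0// ltW.
Qed.

(** All the integrals against [rho] are estimated through this: an integrand is
    only ever known up to a polynomial times [exp (y^2 / 16)]. *)
Lemma gauss_moment k : exists2 C : R, 0 < C &
  forall f c, measurable_fun setT f -> 0 <= c ->
  (forall y, `|f y| <= c * ((1 + y ^+ 2) ^+ k * expR (y ^+ 2 / 16))) ->
  mu.-integrable setT (EFin \o (fun y => f y * rho y)) /\
  `|\int[mu]_y (f y * rho y)| <= C * c.
Proof.
have [C C0 HC] := poly_rho_le k.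
exists (C * \int[mu]_y gauss8 y); first by rewrite mulr_gt0// integral_gauss8_gt0.
move=> f c mf c0 fc.
rewrite (mulrC (C * _)) mulrA.
apply: integrable_le_gauss8; first exact: measurable_funM mf measurable_rho.
move=> y; rewrite normrM (gtr0_norm (rho_gt0 y)).
apply: le_trans (ler_wpM2r (ltW (rho_gt0 y)) (fc y)) _.
rewrite -mulrA -[leRHS]mulrA ler_wpM2l//; exact: HC.
Qed.

Lemma weight_ge1 y : 1 <= expR (y ^+ 2 / 16).
Proof. by rewrite -expR0 ler_expR divr_ge0// sqr_ge0. Qed.

Lemma gauss_moment_poly k : exists2 C : R, 0 < C &
  forall f c, measurable_fun setT f -> 0 <= c ->
  (forall y, `|f y| <= c * (1 + y ^+ 2) ^+ k) ->
  mu.-integrable setT (EFin \o (fun y => f y * rho y)) /\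
  `|\int[mu]_y (f y * rho y)| <= C * c.
Proof.
have [C C0 HC] := gauss_moment k; exists C => // f c mf c0 fc; apply: HC => // y.
apply: le_trans (fc y) _; rewrite ler_wpM2l// -[leLHS]mulr1 ler_wpM2l ?weight_ge1//.
by rewrite exprn_ge0// addr_ge0// sqr_ge0.
Qed.

Lemma gauss8_le y : gauss8 y * (1 + y ^+ 2 / 8) <= 1.
Proof.
rewrite /gauss8 expRN mulrC ler_pdivrMr ?expR_gt0// mul1r; exact: expR_ge1Dx.
Qed.

(** A derivative that is dominated, together with its primitive, by a
    polynomial times [rho] has integral zero: cutting at [n] costs
    [O(1/n^2)]. *)
Lemma integral_derive_rho F f k c : continuous f -> 0 <= c ->
  (forall y, is_derive y 1 (fun x => F x * rho x) (f y * rho y)) ->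
  (forall y, `|f y| <= c * (1 + y ^+ 2) ^+ k) ->
  (forall y, `|F y| <= c * (1 + y ^+ 2) ^+ k) ->
  \int[mu]_y (f y * rho y) = 0.
Proof.
move=> cf c0 dF fb Fb; apply/eqP; rewrite -normr_le0; apply/ler_addgt0Pl => e e0.
rewrite addr0.
have [C1 C10 H1] := poly_rho_le k.
have [C2 C20 H2] := gauss_moment_poly k.+1.
have poly_e y : (1 + y ^+ 2) ^+ k <= (1 + y ^+ 2) ^+ k * expR (y ^+ 2 / 16).
  rewrite -[leLHS]mulr1 ler_wpM2l ?weight_ge1//.
  by rewrite exprn_ge0// addr_ge0// sqr_ge0.
pose A := 16 * c * C1 + C2 * c.
have A0 : 0 <= A by rewrite /A addr_ge0// !mulr_ge0// ltW.
suff H N : 1 <= N -> `|\int[mu]_y (f y * rho y)| <= A / N.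
  have N1 : 1 <= A / e + 1 by rewrite lerDr divr_ge0// ltW.
  apply: le_trans (H _ N1) _; rewrite ler_pdivrMr; last lra.
  by rewrite mulrDr mulr1 mulrCA divff ?gt_eqF// mulr1 lerDl ltW.
move=> N1; have N0 : 0 < N by lra.
have mf : measurable_fun setT f by exact: continuous_measurable_fun.
have mI : measurable (`[- N, N]%classic : set R) by exact: measurable_itv.
pose h := f \_ (`[- N, N]%classic : set R).
have mh : measurable_fun setT h by apply/(measurable_restrictT f mI); exact: measurable_funTS.
have y0 y : 0 <= 1 + y ^+ 2 by rewrite addr_ge0// sqr_ge0.
have hb y : `|h y| <= c * (1 + y ^+ 2) ^+ k.
  rewrite /h patchE; case: ifPn => _; first exact: fb.
  by rewrite normr0 mulr_ge0// exprn_ge0.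
have le_k y : (1 + y ^+ 2) ^+ k <= (1 + y ^+ 2) ^+ k.+1.
  by rewrite ler_weXn2l// lerDl sqr_ge0.
have gb y : `|f y - h y| <= c / N * (1 + y ^+ 2) ^+ k.+1.
  rewrite /h patchE; case: ifPn => yN.
    by rewrite subrr normr0 mulr_ge0 ?exprn_ge0// divr_ge0// ltW.
  rewrite subr0; apply: le_trans (fb y) _; rewrite -mulrA ler_wpM2l//.
  rewrite mulrC ler_pdivlMr// (exprSr _ k) ler_wpM2l ?exprn_ge0//.
  move: yN; rewrite notin_setE /= in_itv /= => /negP; rewrite negb_and -!ltNge.
  by move=> /orP[?|?]; nra.
have [_ Hg] := H2 (fun y => f y - h y) (c / N) (measurable_funB mf mh)
  (divr_ge0 c0 (ltW N0)) gb.
have [ih _] := H2 h c mh c0 (fun y => le_trans (hb y) (ler_wpM2l c0 (le_k y))).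
have [if_ _] := H2 f c mf c0 (fun y => le_trans (fb y) (ler_wpM2l c0 (le_k y))).
have -> : \int[mu]_y (f y * rho y) =
    \int[mu]_y ((f y - h y) * rho y) + \int[mu]_y (h y * rho y).
  under [X in _ = X + _]eq_Rintegral do rewrite mulrBl.
  by rewrite RintegralB// subrK.
have Hh : `|\int[mu]_y (h y * rho y)| <= 16 * c * C1 / N.
  have -> : \int[mu]_y (h y * rho y) = \int[mu]_(y in `[- N, N]) (f y * rho y).
    rewrite [RHS]Rintegral_mkcond; apply: eq_Rintegral => y _.
    by rewrite /h !patchE; case: ifPn => // _; rewrite mul0r.
  rewrite (FTC_segment (F := fun x => F x * rho x))//; last first.
  - by move=> y; apply: continuousM; [exact: cf|exact: continuous_rho].
  - lra.
  have FN y : N <= `|y| -> `|F y * rho y| <= 8 * c * C1 / N.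
    move=> yN; rewrite normrM (gtr0_norm (rho_gt0 y)).
    apply: le_trans (ler_wpM2r (ltW (rho_gt0 y)) (Fb y)) _.
    rewrite (_ : 8 * c * C1 / N = c * (C1 * (8 / N))); last by ring.
    rewrite -mulrA ler_wpM2l//.
    apply: le_trans (ler_wpM2r (ltW (rho_gt0 y)) (poly_e y)) _.
    apply: le_trans (H1 y) _; rewrite ler_wpM2l ?(ltW C10)//.
    rewrite ler_pdivlMr//; have := gauss8_le y; have := gauss8_gt0 y.
    have : N <= y ^+ 2 by rewrite -real_normK ?num_real//; nra.
    by nra.
  apply: le_trans (ler_normB _ _) _.
  rewrite (_ : 16 * c * C1 / N = 8 * c * C1 / N + 8 * c * C1 / N); last by ring.
  by rewrite lerD// FN// ?normrN ger0_norm// ltW.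
apply: le_trans (ler_normD _ _) _; rewrite /A mulrDl [leRHS]addrC.
by rewrite lerD// -mulrA.
Qed.

Lemma hermite0E y : hermite 0 y = 1.
Proof. by rewrite /hermite big_nat1 /= !fact0 !expr0 !mulr1 divr1. Qed.

Lemma hermite1E y : hermite 1 y = y.
Proof. by rewrite /hermite big_nat1 /= expr0 expr1 !mulr1 divr1 mul1r. Qed.

Lemma hermite2E y : hermite 2 y = y ^+ 2 - 2.
Proof.
rewrite /hermite big_nat_recr//= big_nat1 /= !factS !fact0 !expr0 expr1.
by rewrite -!(natrM, natrD) /=; field.
Qed.

Lemma lt3P (P : nat -> Prop) : P 0%N -> P 1%N -> P 2%N ->
  forall m, (m < 3)%N -> P m.
Proof. by move=> P0 P1 P2 [|[|[|m]]]. Qed.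

Lemma is_derive_hermite m (y : R) : (m < 3)%N ->
  is_derive y 1 (hermite m) (m%:R * hermite m.-1 y).
Proof.
move: m; apply: lt3P.
- by have := dconst (1 : R) y; apply: deriv_ext => [x|]; rewrite ?hermite0E ?mul0r.
- by have := did y; apply: deriv_ext => [x|]; rewrite ?hermite1E ?hermite0E ?mulr1.
- have := dB (dX (did y) 2) (dconst (2 : R) y).
  by apply: deriv_ext => [x|] /=; rewrite ?hermite1E ?hermite2E// subr0 mulr1.
Qed.

Lemma continuous_hermite m : (m < 3)%N -> continuous (@hermite R m).
Proof. by move=> m3 y; exact: (derive_cont (is_derive_hermite y m3)). Qed.

Lemma measurable_hermite m : (m < 3)%N -> measurable_fun setT (@hermite R m).
Proof. by move=> m3; exact: continuous_measurable_fun (continuous_hermite m3). Qed.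

Lemma hermite_le m y : (m < 3)%N -> `|hermite m y| <= 2 * (1 + y ^+ 2).
Proof.
move: m; apply: lt3P.
- by rewrite hermite0E normr1; have := sqr_ge0 y; lra.
- by rewrite hermite1E ler_norml; apply/andP; split; nra.
- by rewrite hermite2E ler_norml; have := sqr_ge0 y => ?; apply/andP; split; lra.
Qed.

Lemma integral_gt0 f k c : measurable_fun setT f -> 0 <= c ->
  (forall y, `|f y| <= c * (1 + y ^+ 2) ^+ k) -> (forall y, 0 <= f y) ->
  (forall y, 2 <= y <= 3 -> 1 <= f y) -> 0 < \int[mu]_y (f y * rho y).
Proof.
move=> mf c0 fc f0 f1; have [C C0 HC] := gauss_moment_poly k.
have [if_ _] := HC f c mf c0 fc.
pose r3 : R := rho 3.
have i1 : \int[mu]_(y in `[2, 3]) r3 = r3.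
  rewrite Rintegral_cst//= lebesgue_measure_itv /= lte_fin ltr_nat /=.
  by rewrite (_ : 3 - 2 = 1) ?mulr1//; lra.
apply: (@lt_le_trans _ _ r3); first exact: rho_gt0.
rewrite -i1 Rintegral_mkcond; apply: le_Rintegral => //.
- rewrite -restrict_EFin; apply/integrable_restrict => //=; rewrite setTI.
  by apply: integrable_segment => x; exact: cst_continuous.
- move=> y _; rewrite patchE; case: ifPn => [|_]; last first.
    by rewrite mulr_ge0// ltW// rho_gt0.
  rewrite inE /= in_itv /= => y23.
  apply: (@le_trans _ _ (1 * rho y)); last by rewrite ler_wpM2r ?f1// ltW// rho_gt0.
  rewrite mul1r /r3 /rho ler_wpM2l// ?invr_ge0 ?sqrtr_ge0// ler_expR.
  by case/andP: y23 => ? ?; nra.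
Qed.

Lemma hermite_norm_gt0 m : (m < 3)%N -> 0 < \int[mu]_y (hermite m y ^+ 2 * rho y).
Proof.
move=> m3; apply: (@integral_gt0 _ 2 4) => //.
- by apply: measurable_funX; exact: measurable_hermite.
- move=> y; rewrite normrX (_ : 4 = 2 ^+ 2 :> R); last by ring.
  rewrite -exprMn lerXn2r ?nnegrE//; first by rewrite mulr_ge0// addr_ge0// sqr_ge0.
  exact: hermite_le.
- by move=> y; exact: sqr_ge0.
- move=> y /andP[y2 _].
  have y4 : 4 <= y ^+ 2 by have := sqr_ge0 (y - 2); rewrite sqrrB; nra.
  move: m m3; apply: lt3P.
  + by rewrite hermite0E expr1n.
  + by rewrite hermite1E; lra.
  + rewrite hermite2E; have y1 : 2 <= y ^+ 2 - 2 by lra.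
    by rewrite -[leLHS](expr1n _ 2) ler_pXn2r ?nnegrE//; lra.
Qed.

(** Each product [h_m h_l rho] with [m < l < 3] is the derivative of an explicit
    polynomial times [rho]. *)
Lemma hermite_orthogonal m l : (m < 3)%N -> (l < 3)%N -> m != l ->
  \int[mu]_y (hermite m y * hermite l y * rho y) = 0.
Proof.
have o01 : \int[mu]_y (hermite 0 y * hermite 1 y * rho y) = 0.
  apply: (@integral_derive_rho (fun=> -2) _ 1%N 2) => //.
  - by move=> y; apply: continuousM; apply: continuous_hermite.
  - move=> y; have := dM (dconst (-2) y) (is_derive_rho y).
    by apply: deriv_ext => [//|]; rewrite hermite0E hermite1E; field.
  - move=> y; rewrite hermite0E hermite1E mul1r expr1 ler_norml.
    by apply/andP; split; nra.
  - by move=> y; rewrite normrN ger0_norm// expr1; have := sqr_ge0 y; lra.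
have o02 : \int[mu]_y (hermite 0 y * hermite 2 y * rho y) = 0.
  apply: (@integral_derive_rho (fun y => -2 * y) _ 1%N 2) => //.
  - by move=> y; apply: continuousM; apply: continuous_hermite.
  - move=> y; have := dM (dZ (did y) (-2)) (is_derive_rho y).
    by apply: deriv_ext => [//|]; rewrite hermite0E hermite2E; field.
  - move=> y; rewrite hermite0E hermite2E mul1r expr1 ler_norml.
    by apply/andP; split; nra.
  - by move=> y; rewrite expr1 ler_norml; apply/andP; split; nra.
have o12 : \int[mu]_y (hermite 1 y * hermite 2 y * rho y) = 0.
  apply: (@integral_derive_rho (fun y => -2 * (y ^+ 2 + 2)) _ 2 4) => //.
  - by move=> y; apply: continuousM; apply: continuous_hermite.
  - move=> y.
    have := dM (dZ (dD (dX (did y) 2) (dconst 2 y)) (-2)) (is_derive_rho y).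
    by apply: deriv_ext => [//|]; rewrite hermite1E hermite2E /=; field.
  - move=> y; rewrite hermite1E hermite2E ler_norml.
    by have := sqr_ge0 y => ?; apply/andP; split; nra.
  - by move=> y; have := sqr_ge0 y => ?; rewrite ler_norml; apply/andP; split; nra.
have sym m' l' : \int[mu]_y (hermite m' y * hermite l' y * rho y) =
    \int[mu]_y (hermite l' y * hermite m' y * rho y).
  by apply: eq_Rintegral => y _; rewrite (mulrC (hermite m' y)).
move=> m3 l3; move: m m3; apply: lt3P; move: l l3; apply: lt3P => // _;
  by rewrite // sym.
Qed.

Lemma hermite_dual_le : exists2 C : R, 0 < C &
  forall m y, (m < 3)%N -> `|hermite_dual m y| <= C * (1 + y ^+ 2).
Proof.
pose N m := \int[mu]_x (hermite m x ^+ 2 * rho x).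
have N0 m : (m < 3)%N -> 0 < N m by exact: hermite_norm_gt0.
exists (2 * ((N 0%N)^-1 + (N 1%N)^-1 + (N 2%N)^-1)).
  by rewrite mulr_gt0// !addr_gt0// invr_gt0 N0.
move=> m y m3; rewrite /hermite_dual normrM -/(N m).
apply: (@le_trans _ _ (2 * (1 + y ^+ 2) * (N m)^-1)).
  have Nm : 0 <= (N m)^-1 by rewrite invr_ge0 ltW// N0.
  by rewrite (ger0_norm Nm) ler_wpM2r// hermite_le.
rewrite [leRHS]mulrAC; apply: ler_wpM2l.
  by rewrite mulr_ge0// addr_ge0// sqr_ge0.
have i k : (k < 3)%N -> 0 <= (N k)^-1 by move=> k3; rewrite invr_ge0 ltW// N0.
have i0 := i 0%N isT; have i1 := i 1%N isT; have i2 := i 2%N isT.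
by move: m m3; apply: lt3P; lra.
Qed.

Lemma continuous_hermite_dual m : (m < 3)%N -> continuous (@hermite_dual R m).
Proof.
move=> m3 y; apply: continuousM; first exact: continuous_hermite.
exact: cst_continuous.
Qed.

Lemma measurable_hermite_dual m : (m < 3)%N -> measurable_fun setT (@hermite_dual R m).
Proof.
by move=> m3; apply: continuous_measurable_fun; exact: continuous_hermite_dual.
Qed.

Lemma hermite_biorthogonal m l : (m < 3)%N -> (l < 3)%N ->
  \int[mu]_y (hermite m y * hermite_dual l y * rho y) = (m == l)%:R.
Proof.
move=> m3 l3; set N := \int[mu]_x (hermite l x ^+ 2 * rho x).
have N0 : 0 < N by exact: hermite_norm_gt0.
have [C C0 HC] := gauss_moment_poly 2.
have [i _] := HC (fun y => hermite m y * hermite l y) 4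
  (measurable_funM (measurable_hermite m3) (measurable_hermite l3)) ltac:(by [])
  ltac:(by move=> y; rewrite normrM (_ : 4 = 2 ^+ 2 :> R); [rewrite -exprMn expr2 ler_pM// hermite_le|ring]).
transitivity (N^-1 * \int[mu]_y (hermite m y * hermite l y * rho y)).
  rewrite -RintegralZl//; apply: eq_Rintegral => y _.
  by rewrite /hermite_dual -/N; ring.
have [->|ml] := eqVneq m l; last by rewrite hermite_orthogonal// mulr0.
rewrite (_ : \int[mu]_y _ = N) ?mulVf ?gt_eqF//.
Qed.

End Gaussian.

(** * A smooth substitute for the squared positive part *)

Section Comparison.
Set Implicit Arguments. Unset Strict Implicit.
Context {R : realType}.
Implicit Types (f g : R -> R) (x y c : R).
Local Notation mu := (@lebesgue_measure R).

Definition pos x : R := Num.max x 0.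

Lemma pos_ge0 x : 0 <= pos x.
Proof. by rewrite /pos le_max lexx orbT. Qed.

Lemma pos_gtE x : 0 < x -> pos x = x.
Proof. by move=> x0; rewrite /pos max_l// ltW. Qed.

Lemma pos_le0 x : x <= 0 -> pos x = 0.
Proof. by move=> x0; rewrite /pos max_r. Qed.

Lemma continuous_pos : continuous pos.
Proof. by move=> x; apply: (@continuous_max _ _ id (cst 0)) => //; exact: cst_continuous. Qed.

(** Gluing at the origin: the quadratic bound makes the one-sided function
    differentiable there. *)
Lemma is_derive_pos f f' : (forall x, 0 < x -> is_derive x 1 f (f' x)) ->
  f 0 = 0 -> f' 0 = 0 -> (forall x, 0 < x -> `|f x| <= 3 * x ^+ 2) ->
  forall x, is_derive x 1 (fun t => f (pos t)) (f' (pos x)).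
Proof.
move=> df f0 f'0 fb x; have [x0|x0|->] := ltgtP x 0.
- rewrite pos_le0 1?ltW// f'0; apply: (near_eq_is_derive (f := cst 0)).
    apply: (@near_id _ _ _ (x - 1) 0); first by apply/andP; split; lra.
    by move=> t /andP[_ t0]; rewrite pos_le0 1?ltW// f0.
- rewrite pos_gtE//; apply: (near_eq_is_derive (f := f)); last exact: df.
  apply: (@near_id _ _ _ 0 (x + 1)); first by apply/andP; split; lra.
  by move=> t /andP[t0 _]; rewrite pos_gtE.
- have lim0 : h^-1 *: (f (pos (h *: 1 + 0)) - f (pos 0)) @[h --> 0^'] --> (0 : R).
    have p0 : pos 0 = 0 by rewrite pos_le0.
    apply/cvgr0Pnorm_le => e e0.
    near=> h.
    have h0 : h != 0 by near: h; exact: nbhs_dnbhs_neq.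
    have he : `|h| <= e / 3.
      near: h; apply: dnbhs0_le; lra.
    rewrite p0 f0 subr0 /GRing.scale /= mulr1 addr0 normrM normfV.
    have hp : 0 < `|h| by rewrite normr_gt0.
    rewrite mulrC ler_pdivrMr//.
    have [hn|hn] := ltP 0 h; last by rewrite pos_le0// f0 normr0 mulr_ge0// ltW.
    rewrite pos_gtE//; apply: le_trans (fb _ hn) _.
    by move: he; rewrite gtr0_norm//; nra.
  apply: DeriveDef; last by rewrite pos_le0// f'0; exact/cvg_lim.
  by apply/cvg_ex; exists 0.
Unshelve. all: by end_near. Qed.

(** [Phi w = w_+^3 / (1 + w_+)] is convex and of class C^2, and it lies below
    [w_+^2].  It measures the positive part of a solution in [L^2_rho], the
    square of the positive part itself being too rough to differentiate
    twice. *)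
Definition Phi x : R := pos x ^+ 3 * (1 + pos x)^-1.
Definition Phi' x : R := (2 * pos x ^+ 3 + 3 * pos x ^+ 2) * (1 + pos x)^-2.
Definition Phi'' x : R :=
  2 * (pos x ^+ 3 + 3 * pos x ^+ 2 + 3 * pos x) * (1 + pos x)^-3.

Lemma pos1_gt0 x : 0 < 1 + pos x.
Proof. by have := pos_ge0 x; lra. Qed.

Lemma Phi_ge0 x : 0 <= Phi x.
Proof. by rewrite mulr_ge0 ?exprn_ge0 ?pos_ge0// invr_ge0 ltW// pos1_gt0. Qed.

Lemma Phi'_ge0 x : 0 <= Phi' x.
Proof.
have p0 := pos_ge0 x.
by rewrite mulr_ge0 ?addr_ge0 ?mulr_ge0 ?exprn_ge0// invr_ge0 exprn_ge0// ltW// pos1_gt0.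
Qed.

Lemma Phi''_ge0 x : 0 <= Phi'' x.
Proof.
have p0 := pos_ge0 x.
by rewrite !mulr_ge0 ?addr_ge0 ?mulr_ge0 ?exprn_ge0// invr_ge0 exprn_ge0// ltW// pos1_gt0.
Qed.

Lemma Phi_le x : Phi x <= pos x ^+ 2.
Proof.
have p0 := pos_ge0 x; have p1 := pos1_gt0 x.
rewrite /Phi ler_pdivrMr//; have := sqr_ge0 (pos x).
by rewrite (exprS _ 2) => ?; nra.
Qed.

Lemma Phi'_le x : Phi' x <= 3 * pos x ^+ 2.
Proof.
have p0 := pos_ge0 x; have p1 := pos1_gt0 x.
rewrite /Phi' ler_pdivrMr ?exprn_gt0//.
rewrite (_ : _ + _ = pos x ^+ 2 * (2 * pos x + 3)); last by ring.
rewrite (_ : 3 * _ * _ = pos x ^+ 2 * (3 * (1 + pos x) ^+ 2)); last by ring.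
by rewrite ler_wpM2l ?sqr_ge0//; nra.
Qed.

Lemma Phi'_id_le x : Phi' x * x <= 3 * Phi x.
Proof.
have [x0|x0] := ltP 0 x; last first.
  by rewrite /Phi' /Phi pos_le0// !expr0n /= !(mulr0, mul0r, addr0).
have p1 := pos1_gt0 x; move: p1.
rewrite /Phi' /Phi pos_gtE// => p1.
rewrite mulrAC ler_pdivrMr ?exprn_gt0//.
rewrite (_ : 3 * _ * _ = 3 * x ^+ 3 * (1 + x)); last first.
  by field; rewrite gt_eqF.
have -> : (2 * x ^+ 3 + 3 * x ^+ 2) * x = x ^+ 3 * (2 * x + 3) by ring.
rewrite (_ : 3 * _ * _ = x ^+ 3 * (3 * (1 + x))); last by ring.
by rewrite ler_wpM2l ?exprn_ge0 ?ltW//; lra.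
Qed.

(** The discriminant condition that lets the convexity term
    [Phi'' w_y^2] absorb the cross term [Phi' w_y] created by the space
    cut-off, at the price of [w_+^2] only. *)
Lemma Phi'_sqr_le x : Phi' x ^+ 2 <= Phi'' x * (4 * pos x ^+ 2).
Proof.
have p0 := pos_ge0 x; have p1 := pos1_gt0 x; rewrite /Phi' /Phi''.
set m := pos x in p0 p1 *.
have -> : ((2 * m ^+ 3 + 3 * m ^+ 2) * (1 + m)^-2) ^+ 2 =
    m ^+ 3 * (m * (2 * m + 3) ^+ 2) * (1 + m) ^- 4.
  by field; rewrite gt_eqF.
have -> : 2 * (m ^+ 3 + 3 * m ^+ 2 + 3 * m) * (1 + m) ^- 3 * (4 * m ^+ 2) =
    m ^+ 3 * (8 * (1 + m) * (m ^+ 2 + 3 * m + 3)) * (1 + m) ^- 4.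
  by field; rewrite gt_eqF.
rewrite ler_wpM2r ?invr_ge0 ?exprn_ge0//; first lra.
rewrite ler_wpM2l ?exprn_ge0// -subr_ge0.
have -> : 8 * (1 + m) * (m ^+ 2 + 3 * m + 3) - m * (2 * m + 3) ^+ 2 =
   4 * m ^+ 3 + 20 * m ^+ 2 + 39 * m + 24 by ring.
by rewrite !addr_ge0// mulr_ge0// exprn_ge0.
Qed.

Lemma is_derive_Phi x : is_derive x 1 Phi (Phi' x).
Proof.
apply: (@is_derive_pos (fun t => t ^+ 3 * (1 + t)^-1)
  (fun m => (2 * m ^+ 3 + 3 * m ^+ 2) * (1 + m)^-2)).
- move=> t t0.
  have t1 : 1 + t != 0 by rewrite gt_eqF//; lra.
  have := dM (dX (did t) 3) (dV (dD (dconst 1 t) (did t)) t1).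
  by apply: deriv_ext => [//|] /=; field.
- by rewrite expr0n mul0r.
- by rewrite !expr0n /= !mulr0 addr0 mul0r.
- move=> t t0; have := Phi_le t; have := Phi_ge0 t; rewrite /Phi pos_gtE// => h1 h2.
  by rewrite ger0_norm//; have := sqr_ge0 t; lra.
Qed.

Lemma is_derive_Phi' x : is_derive x 1 Phi' (Phi'' x).
Proof.
apply: (@is_derive_pos (fun m => (2 * m ^+ 3 + 3 * m ^+ 2) * (1 + m)^-2)
  (fun m => 2 * (m ^+ 3 + 3 * m ^+ 2 + 3 * m) * (1 + m)^-3)).
- move=> t t0.
  have t1 : 1 + t != 0 by rewrite gt_eqF//; lra.
  have t2 : (1 + t) ^+ 2 != 0 by rewrite expf_neq0.
  have := dM (dD (dZ (dX (did t) 3) 2) (dZ (dX (did t) 2) 3))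
    (dV (dX (dD (dconst 1 t) (did t)) 2) t2).
  by apply: deriv_ext => [//|] /=; field.
- by rewrite !expr0n /= !mulr0 addr0 mul0r.
- by rewrite !expr0n /= !(mulr0, addr0, mul0r).
- move=> t t0; have := Phi'_le t; have := Phi'_ge0 t; rewrite /Phi' pos_gtE// => h1 h2.
  by rewrite ger0_norm.
Qed.

Lemma continuous_Phi : continuous Phi.
Proof. exact: derives_continuous is_derive_Phi. Qed.

Lemma continuous_Phi' : continuous Phi'.
Proof. exact: derives_continuous is_derive_Phi'. Qed.

Lemma continuous_Phi'' : continuous Phi''.
Proof.
move=> x; apply: (@continuous_comp _ _ _ pos
  (fun m => 2 * (m ^+ 3 + 3 * m ^+ 2 + 3 * m) * (1 + m)^-3)).
  exact: continuous_pos.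
set m := pos x; have m1 : (1 + m) ^+ 3 != 0 by rewrite expf_neq0// gt_eqF// pos1_gt0.
have := dM (dZ (dD (dD (dX (did m) 3) (dZ (dX (did m) 2) 3)) (dZ (did m) 3)) 2)
  (dV (dX (dD (dconst 1 m) (did m)) 3) m1).
exact: derive_cont.
Qed.

Lemma quadratic_ge0 (a b d X Y : R) : 0 <= a -> 0 <= d -> b ^+ 2 <= a * d ->
  0 <= a * X ^+ 2 + 2 * b * X * Y + d * Y ^+ 2.
Proof.
move=> a0 d0 h; have [a0'|a0'] := ltP 0 a.
  rewrite -(pmulr_rge0 _ a0').
  have -> : a * (a * X ^+ 2 + 2 * b * X * Y + d * Y ^+ 2) =
    (a * X + b * Y) ^+ 2 + (a * d - b ^+ 2) * Y ^+ 2 by ring.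
  by rewrite addr_ge0 ?sqr_ge0// mulr_ge0 ?sqr_ge0// subr_ge0.
have a_0 : a = 0 by apply/eqP; rewrite eq_le a0' a0.
have b_0 : b = 0.
  apply/eqP; rewrite -sqrf_eq0 eq_le sqr_ge0 andbT.
  by apply: le_trans h _; rewrite a_0 mul0r.
by rewrite a_0 b_0 mul0r mulr0 !mul0r !add0r mulr_ge0// sqr_ge0.
Qed.

Lemma slice_continuous (T : topologicalType) (f : R * R -> T) (s y : R) :
  {for (s, y), continuous f} -> {for y, continuous (fun x => f (s, x))}.
Proof.
move=> cf; apply: (@continuous_comp _ _ _ (fun x : R => (s, x)) f) => //.
exact: (@cvg_pair _ _ _ (nbhs y) (nbhs s) (nbhs y) _ _ _ (cst s) id (cvg_cst s) cvg_id).
Qed.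

Lemma continuous_of_snd f (q : R * R) : continuous f ->
  {for q, continuous (fun q : R * R => f q.2)}.
Proof. by move=> cf; apply: (@continuous_comp _ _ _ snd f); [exact: cvg_snd|exact: cf]. Qed.

Lemma continuous_of_joint (F : R * R -> R) f (q : R * R) :
  {for q, continuous F} -> continuous f -> {for q, continuous (fun q => f (F q))}.
Proof. by move=> cF cf; apply: (@continuous_comp _ _ _ F f) => //; exact: cf. Qed.

End Comparison.

(** * The comparison principle in [L^2_rho] *)

Section ComparisonPrinciple.
Set Implicit Arguments. Unset Strict Implicit.
Context {R : realType}.
Implicit Types (f g : R -> R) (x y : R).
Local Notation mu := (@lebesgue_measure R).

Lemma le_integral_segment f g a b : continuous f -> continuous g ->
  (forall y, a <= y <= b -> f y <= g y) ->
  \int[mu]_(y in `[a, b]) f y <= \int[mu]_(y in `[a, b]) g y.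
Proof.
move=> cf cg fg; apply: le_Rintegral => //; try exact: integrable_segment.
Qed.

Lemma integral_segmentD f g a b : continuous f -> continuous g ->
  \int[mu]_(y in `[a, b]) (f y + g y) =
  \int[mu]_(y in `[a, b]) f y + \int[mu]_(y in `[a, b]) g y.
Proof. by move=> cf cg; rewrite RintegralD//; exact: integrable_segment. Qed.

Lemma integral_segmentZ f c a b : continuous f ->
  \int[mu]_(y in `[a, b]) (c * f y) = c * \int[mu]_(y in `[a, b]) f y.
Proof. by move=> cf; rewrite RintegralZl//; exact: integrable_segment. Qed.

Lemma integral_segment_le f a b (N : R) : continuous f -> (forall y, 0 <= f y) ->
  (\int[mu]_y (f y)%:E <= N%:E)%E -> \int[mu]_(y in `[a, b]) f y <= N.
Proof.
move=> cf f0 h; rewrite /Rintegral -lee_fin fineK; last first.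
  by apply: (@integrable_fin_num _ _ _ mu) => //; exact: integrable_segment.
apply: le_trans h; apply: ge0_subset_integral => //.
- by apply/measurable_EFinP; exact: continuous_measurable_fun.
- by move=> y _; rewrite lee_fin.
Qed.

(** The space cut-off.  Vanishing to second order at [|y| = r] kills the
    boundary terms, and [bump = (1 - y^2/r^2)^2] with
    [bump' = 2 (1 - y^2/r^2) O(1/r)] keeps [bump'^2 / bump] of order
    [1/r^2]. *)
Definition bump (r y : R) : R := (1 - y ^+ 2 / r ^+ 2) ^+ 2.

Lemma bump_ge0 r y : 0 <= bump r y.
Proof. exact: sqr_ge0. Qed.

Lemma bump_le1 r y : 0 < r -> - r <= y <= r -> bump r y <= 1.
Proof.
move=> r0 /andP[y1 y2]; rewrite /bump expr_le1//; last first.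
  rewrite subr_ge0 ler_pdivrMr ?exprn_gt0// mul1r; nra.
by rewrite gerBl divr_ge0 ?sqr_ge0.
Qed.

Lemma is_derive_bump r y : r != 0 ->
  is_derive y 1 (bump r) (2 * (1 - y ^+ 2 / r ^+ 2) * (- 2 * y / r ^+ 2)).
Proof.
move=> r0; have := dX (dB (dconst 1 y) (dZ (dX (did y) 2) (r ^+ 2)^-1)) 2.
apply: deriv_ext => [t|] /=; last by ring.
by rewrite /bump; congr ((_ - _) ^+ 2); rewrite mulrC.
Qed.

Lemma continuous_bump r : r != 0 -> continuous (bump r).
Proof. by move=> r0 y; exact: (derive_cont (is_derive_bump y r0)). Qed.

(** The classes of functions compared: [C^{1,2}] on a time slab, the
    derivatives being given by name. *)
Record smooth_slab (a b : R) (w ws wy wyy : R -> R -> R) : Prop := SmoothSlab {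
  slab_ds : forall s y : R, a < s < b -> is_derive s 1 (w^~ y) (ws s y);
  slab_dy : forall s y : R, a < s < b -> is_derive y 1 (w s) (wy s y);
  slab_dyy : forall s y : R, a < s < b -> is_derive y 1 (wy s) (wyy s y);
  slab_c : forall s y : R, a < s < b ->
    [/\ {for (s, y), continuous (fun q : R * R => w q.1 q.2)},
        {for (s, y), continuous (fun q : R * R => ws q.1 q.2)},
        {for (s, y), continuous (fun q : R * R => wy q.1 q.2)} &
        {for (s, y), continuous (fun q : R * R => wyy q.1 q.2)}] }.

Section Energy.
Variables (a b c : R) (w ws wy wyy : R -> R -> R).
Hypothesis sm : smooth_slab a b w ws wy wyy.
Hypothesis c0 : 0 <= c.
Hypothesis sub : forall s y, a < s < b -> 0 < w s y ->
  ws s y <= wyy s y - y / 2 * wy s y + c * w s y.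

Let cw s : a < s < b -> continuous (w s).
Proof. by move=> sab y; have [h _ _ _] := slab_c sm y sab; exact: slice_continuous h. Qed.
Let cws s : a < s < b -> continuous (ws s).
Proof. by move=> sab y; have [_ h _ _] := slab_c sm y sab; exact: slice_continuous h. Qed.
Let cwy s : a < s < b -> continuous (wy s).
Proof. by move=> sab y; have [_ _ h _] := slab_c sm y sab; exact: slice_continuous h. Qed.
Let cwyy s : a < s < b -> continuous (wyy s).
Proof. by move=> sab y; have [_ _ _ h] := slab_c sm y sab; exact: slice_continuous h. Qed.

(** Localising on [[- r, r]] makes every derivative under the integral and every
    integration by parts legitimate, whatever the growth of [w_y]; the radius
    goes to infinity at the end. *)
Definition energy (r s : R) : R :=
  \int[mu]_(y in `[- r, r]) (Phi (w s y) * (bump r y * rho y)).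

Let cPhi f : continuous f -> continuous (fun y => Phi (f y)).
Proof. by move=> cf y; apply: continuous_comp; [exact: cf|exact: continuous_Phi]. Qed.
Let cPhi' f : continuous f -> continuous (fun y => Phi' (f y)).
Proof. by move=> cf y; apply: continuous_comp; [exact: cf|exact: continuous_Phi']. Qed.
Let cPhi'' f : continuous f -> continuous (fun y => Phi'' (f y)).
Proof. by move=> cf y; apply: continuous_comp; [exact: cf|exact: continuous_Phi'']. Qed.

Lemma is_derive_energy r s : 0 < r -> a < s < b ->
  is_derive s 1 (energy r)
    (\int[mu]_(y in `[- r, r]) (Phi' (w s y) * ws s y * (bump r y * rho y))).
Proof.
move=> r0 sab; have rn0 : r != 0 by rewrite gt_eqF.
pose Z y := bump r y * rho y.
have cZ : continuous Z by apply: cM; [exact: continuous_bump|exact: continuous_rho].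
apply: (@derive_integral_segment _ a b s _ _ (fun s y => Phi (w s y) * Z y)
  (fun s y => Phi' (w s y) * ws s y * Z y) sab).
- move=> t y tab.
  have := dM (dchain (slab_ds sm y tab) (is_derive_Phi (w t y))) (dconst (Z y) t).
  by apply: deriv_ext => [//|]; rewrite mulr0 addr0.
- by move=> t tab; apply: cM cZ; apply: cPhi; exact: cw.
- move=> t y tab; have [h1 h2 _ _] := slab_c sm y tab.
  apply: continuousM; last exact: continuous_of_snd.
  by apply: continuousM => //; apply: (continuous_of_joint h1); exact: continuous_Phi'.
Qed.

(** The energy inequality.  The flux [Phi'(w) w_y rho bump] vanishes at the
    ends of the segment, so its derivative integrates to zero; the remaining
    cross term is absorbed by the convexity term [Phi''(w) w_y^2]. *)
Lemma energy_derive_le r s (N : R) : 0 < r -> a < s < b ->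
  (\int[mu]_y (pos (w s y) ^+ 2 * rho y)%:E <= N%:E)%E ->
  \int[mu]_(y in `[- r, r]) (Phi' (w s y) * ws s y * (bump r y * rho y)) <=
  3 * c * energy r s + 16 / r ^+ 2 * N.
Proof.
move=> r0 sab hN; have rn0 : r != 0 by rewrite gt_eqF.
pose W := w s; pose Wy := wy s; pose Wyy := wyy s.
have cW : continuous W := cw sab.
have cWy : continuous Wy := cwy sab.
have cWyy : continuous Wyy := cwyy sab.
have cr : continuous (@rho R) := @continuous_rho R.
have cb : continuous (bump r) := continuous_bump rn0.
pose b' y := 2 * (1 - y ^+ 2 / r ^+ 2) * (- 2 * y / r ^+ 2).
have cb' : continuous b'.
  by cont.
pose flux y := Phi' (W y) * Wy y * (bump r y * rho y).
pose flux' y := Phi'' (W y) * Wy y ^+ 2 * (bump r y * rho y)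
  + Phi' (W y) * (Wyy y - y / 2 * Wy y) * (bump r y * rho y)
  + Phi' (W y) * Wy y * (b' y * rho y).
have dflux y : is_derive y 1 flux (flux' y).
  have := dM (dM (dchain (slab_dy sm y sab) (is_derive_Phi' (w s y)))
    (slab_dyy sm y sab)) (dM (is_derive_bump y rn0) (is_derive_rho y)).
  by apply: deriv_ext => [//|]; rewrite /flux' /b' /W /Wy /Wyy; ring.
have cflux' : continuous flux'.
  have h2 := cPhi'' cW; have h1 := cPhi' cW.
  by cont.
have int0 : \int[mu]_(y in `[- r, r]) flux' y = 0.
  rewrite (FTC_segment (F := flux))//; last lra.
  have e y : y ^+ 2 = r ^+ 2 -> flux y = 0.
    move=> yr; rewrite /flux /bump yr divff ?expf_neq0// subrr expr0n /=.
    by rewrite mul0r mulr0.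
  by rewrite !e ?sqrrN// subr0.
have cPh := cPhi cW.
have cPW : continuous (fun y => Phi (W y) * (bump r y * rho y)) by cont.
have cpos : continuous (fun y => pos (W y)).
  by move=> y; apply: (@continuous_comp _ _ _ W pos); [exact: cW|exact: continuous_pos].
have cpW : continuous (fun y => pos (W y) ^+ 2 * rho y) by cont.
have main y : - r <= y <= r ->
    Phi' (W y) * ws s y * (bump r y * rho y) <=
    flux' y + (3 * c * (Phi (W y) * (bump r y * rho y))
     + 16 / r ^+ 2 * (pos (W y) ^+ 2 * rho y)).
  move=> yr; have rho0 := rho_gt0 y; have b0 := bump_ge0 r y.
  have P'0 := Phi'_ge0 (W y).
  have h1 : Phi' (W y) * ws s y <=
      Phi' (W y) * (Wyy y - y / 2 * Wy y) + 3 * c * Phi (W y).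
    have [w0|w0] := ltP 0 (W y); last first.
      by rewrite /Phi' /Phi pos_le0// !expr0n /= !(mulr0, mul0r, addr0).
    have := ler_wpM2l P'0 (sub sab w0); have := ler_wpM2l c0 (Phi'_id_le (W y)).
    by rewrite -/(W y) -/(Wy y) -/(Wyy y); nra.
  have h2 : 0 <= Phi'' (W y) * Wy y ^+ 2 * bump r y + Phi' (W y) * Wy y * b' y
      + 16 / r ^+ 2 * pos (W y) ^+ 2.
    pose X := Wy y * (1 - y ^+ 2 / r ^+ 2); pose Y := - 2 * y / r ^+ 2.
    have d0 : 0 <= 4 * pos (W y) ^+ 2 by rewrite mulr_ge0 ?sqr_ge0.
    have q := @quadratic_ge0 _ (Phi'' (W y)) (Phi' (W y)) (4 * pos (W y) ^+ 2) X Y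
      (Phi''_ge0 _) d0 (Phi'_sqr_le _).
    have Y2 : 4 * pos (W y) ^+ 2 * Y ^+ 2 <= 16 / r ^+ 2 * pos (W y) ^+ 2.
      rewrite /Y (_ : 4 * _ * _ = 16 / r ^+ 2 * pos (W y) ^+ 2 * (y ^+ 2 / r ^+ 2));
        last by field.
      rewrite -[leRHS]mulr1 ler_wpM2l//.
        by rewrite mulr_ge0 ?sqr_ge0// divr_ge0 ?sqr_ge0.
      rewrite ler_pdivrMr ?exprn_gt0// mul1r.
      by case/andP: yr => ? ?; nra.
    apply: le_trans q _.
    have -> : Phi'' (W y) * Wy y ^+ 2 * bump r y = Phi'' (W y) * X ^+ 2.
      by rewrite /X /bump; ring.
    have -> : Phi' (W y) * Wy y * b' y = 2 * Phi' (W y) * X * Y.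
      by rewrite /X /Y /b'; ring.
    by rewrite lerD2l.
  have k1 := ler_wpM2r (mulr_ge0 b0 (ltW rho0)) h1.
  have k2 := mulr_ge0 h2 (ltW rho0).
  apply: le_trans k1 _; rewrite -subr_ge0; apply: le_trans k2 _.
  by rewrite le_eqVlt; apply/orP; left; apply/eqP; rewrite /flux'; ring.
have cR : continuous (fun y => 3 * c * (Phi (W y) * (bump r y * rho y))
     + 16 / r ^+ 2 * (pos (W y) ^+ 2 * rho y)).
  by cont.
apply: le_trans (le_integral_segment _ _ main) _.
- by have h1 := cPhi' cW; have h2 := cws sab; cont.
- exact: cD.
rewrite integral_segmentD// int0 add0r integral_segmentD; try by cont.
rewrite !integral_segmentZ// lerD2l ler_wpM2l//.
  by rewrite divr_ge0// sqr_ge0.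
apply: integral_segment_le => // y.
by rewrite mulr_ge0 ?sqr_ge0// ltW// rho_gt0.
Qed.

Lemma energy_le r s (N : R) : 0 < r -> a < s < b ->
  (\int[mu]_y (pos (w s y) ^+ 2 * rho y)%:E <= N%:E)%E -> energy r s <= N.
Proof.
move=> r0 sab hN; have rn0 : r != 0 by rewrite gt_eqF.
have cb : continuous (bump r) := continuous_bump rn0.
have cr : continuous (@rho R) := @continuous_rho R.
have cPW := cPhi (cw sab).
have cpW : continuous (fun y => pos (w s y) ^+ 2 * rho y).
  have h : continuous (fun y => pos (w s y)).
    by move=> y; apply: (@continuous_comp _ _ _ (w s) pos);
      [exact: cw|exact: continuous_pos].
  by cont.
apply: le_trans (le_integral_segment _ cpW _) _.
- by cont.
- move=> y yr; rewrite mulrA ler_wpM2r ?(ltW (rho_gt0 _))//.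
  apply: le_trans (Phi_le _); rewrite -[leRHS]mulr1.
  by rewrite ler_wpM2l ?Phi_ge0// bump_le1.
apply: integral_segment_le => // y.
by rewrite mulr_ge0 ?sqr_ge0// ltW// rho_gt0.
Qed.

(** Gronwall's inequality on the slab, started from times close to [a]. *)
Lemma energy_bound r s (N : R) : 0 < r -> 0 <= N -> a < s < b ->
  (forall t, a < t < b -> (\int[mu]_y (pos (w t y) ^+ 2 * rho y)%:E <= N%:E)%E) ->
  (forall e, 0 < e -> exists2 d, 0 < d & forall t, a < t < a + d -> t < b ->
    (\int[mu]_y (pos (w t y) ^+ 2 * rho y)%:E <= e%:E)%E) ->
  energy r s * expR (- (3 * c * (s - a))) <= 16 / r ^+ 2 * N * (b - a).
Proof.
move=> r0 N0 /andP[as_ sb] hN h0; apply/ler_addgt0Pl => e e0.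
have [d d0 hd] := h0 e e0.
pose E := 16 / r ^+ 2 * N; have E0 : 0 <= E by rewrite mulr_ge0// divr_ge0// sqr_ge0.
pose t0 := Num.min (a + d / 2) ((a + s) / 2).
have t0a : a < t0 by rewrite lt_min; apply/andP; split; lra.
have t0s : t0 < s by rewrite gt_min; apply/orP; right; lra.
have t0d : t0 < a + d by rewrite gt_min; apply/orP; left; lra.
have t0b : t0 < b by lra.
pose g t := energy r t * expR (- (3 * c * (t - a))) - E * t.
pose J t := \int[mu]_(y in `[- r, r]) (Phi' (w t y) * ws t y * (bump r y * rho y)).
pose g' t := (J t - 3 * c * energy r t) * expR (- (3 * c * (t - a))) - E.
have dg (t : R) : a < t < b -> is_derive t 1 g (g' t).
  move=> tab; have := dB (dM (is_derive_energy r0 tab)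
    (dexp (dN (dZ (dB (did t) (dconst a t)) (3 * c))))) (dZ (did t) E).
  by apply: deriv_ext => [//|]; rewrite /g' /J; ring.
have g'0 t : a < t < b -> g' t <= 0.
  move=> tab; have h := energy_derive_le r0 tab (hN t tab).
  have x1 : expR (- (3 * c * (t - a))) <= 1.
    by rewrite expR_le1 oppr_le0 mulr_ge0//; [rewrite mulr_ge0|case/andP: tab; lra].
  have x0 := expR_ge0 (- (3 * c * (t - a))).
  rewrite /g' subr_le0; apply: (@le_trans _ _ (E * expR (- (3 * c * (t - a))))).
    by rewrite ler_wpM2r// lerBlDl.
  by rewrite -[leRHS]mulr1 ler_wpM2l.
have gle : g s <= g t0.
  have [t tI gE] : exists2 t, t \in `[t0, s] & g s - g t0 = g' t * (s - t0).
    apply: MVT_segment; first exact: ltW.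
      by move=> t; rewrite in_itv /= => /andP[? ?]; apply: dg; apply/andP; split; lra.
    apply: derivable_within_continuous => t; rewrite in_itv /= => /andP[? ?].
    by have [] := dg t ltac:(apply/andP; split; lra).
  rewrite -subr_le0 gE; apply: mulr_le0_ge0; last by lra.
  by move: tI; rewrite in_itv /= => /andP[? ?]; apply: g'0; apply/andP; split; lra.
have et0 : energy r t0 <= e.
  by apply: energy_le => //; [apply/andP; split; lra|apply: hd; lra].
have pt0 : energy r t0 * expR (- (3 * c * (t0 - a))) <= e.
  apply: le_trans et0; rewrite -[leRHS]mulr1 ler_wpM2l//.
    apply: Rintegral_ge0 => y _.
    by rewrite mulr_ge0 ?Phi_ge0// mulr_ge0 ?bump_ge0// ltW// rho_gt0.
  by rewrite expR_le1 oppr_le0 mulr_ge0//; [rewrite mulr_ge0|lra].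
move: gle; rewrite /g -/E; have : E * (s - t0) <= E * (b - a) by rewrite ler_wpM2l//; lra.
by lra.
Qed.

(** The localised energy at radius [r] is [O(1/r^2)], whereas a point where [w]
    is positive keeps it above a positive constant.  The bound in [L^2_rho],
    uniform in time, replaces a growth condition at infinity and excludes the
    solutions of Tychonoff type. *)
Theorem comparison (N : R) : 0 <= N ->
  (forall t, a < t < b -> (\int[mu]_y (pos (w t y) ^+ 2 * rho y)%:E <= N%:E)%E) ->
  (forall e, 0 < e -> exists2 d, 0 < d & forall t, a < t < a + d -> t < b ->
    (\int[mu]_y (pos (w t y) ^+ 2 * rho y)%:E <= e%:E)%E) ->
  forall s y, a < s < b -> w s y <= 0.
Proof.
move=> N0 hN h0 s y sab; rewrite leNgt; apply/negP => w0.
pose f x := Phi (w s x).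
have cf : continuous f by apply: cPhi; exact: cw.
have f0 : 0 < f y.
  by rewrite /f /Phi pos_gtE// mulr_gt0 ?exprn_gt0// invr_gt0; lra.
have [d d0 hd] : exists2 d, 0 < d <= 1 & forall x, y - d <= x <= y + d -> f y / 2 <= f x.
  have /cvgrPdist_lt/(_ (f y / 2))[|d /= d0 hd] := cf y; first lra.
  exists (Num.min (d / 2) 1).
    by rewrite lt_min ltr01 ge_min lexx orbT !andbT divr_gt0.
  move=> x /andP[x1 x2].
  have m1 : Num.min (d / 2) 1 <= d / 2 by rewrite ge_min lexx.
  have := hd x; rewrite /= => /(_ _) h.
  have : `|f y - f x| < f y / 2 by apply: h; rewrite /ball_ /= ltr_norml; apply/andP; split; lra.
  by rewrite ltr_norml => /andP[? ?]; lra.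
case/andP: d0 => d0 d1.
pose q := \int[mu]_(x in `[y - d, y + d]) rho x.
have q0 : 0 < q.
  have ne : exists2 m, 0 < m & forall x, y - d <= x <= y + d -> m <= rho x.
    have cr : {within `[y - d, y + d], continuous (@rho R)}.
      by apply: continuous_subspaceT => x; exact: continuous_rho.
    have [z zI hz] := @EVT_min R rho (y - d) (y + d) ltac:(lra) cr.
    by exists (rho z); [exact: rho_gt0|move=> x xI; apply: hz; rewrite in_itv].
  have [m m0 hm] := ne.
  have : \int[mu]_(x in `[y - d, y + d]) m <= q.
    by apply: le_integral_segment => //; [exact: cC|exact: continuous_rho].
  apply: lt_le_trans; rewrite Rintegral_cst//= lebesgue_measure_itv /= lte_fin.
  by rewrite ifT /=; [rewrite mulr_gt0//|]; lra.
(* a lower bound of the energy that does not depend on the cut-off radius *)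
have low r : 2 * (`|y| + 1) <= r -> f y / 4 * q <= energy r s.
  move=> hr; have := normr_ge0 y => y0.
  have r0 : 0 < r by lra.
  have rn0 : r != 0 by rewrite gt_eqF.
  have yr1 := ler_norm y; have yr2 := ler_norm (- y); rewrite normrN in yr2.
  have cr : continuous (@rho R) := @continuous_rho R.
  have cb : continuous (bump r) := continuous_bump rn0.
  rewrite -integral_segmentZ//.
  pose F x := f x * (bump r x * rho x).
  have cF : continuous F by cont.
  have F0 x : 0 <= F x by rewrite mulr_ge0 ?Phi_ge0// mulr_ge0 ?bump_ge0// ltW// rho_gt0.
  apply: (@le_trans _ _ (\int[mu]_(x in `[y - d, y + d]) F x)).
    apply: le_integral_segment => //; first by cont.
    move=> x xI; rewrite /F mulrA ler_wpM2r ?(ltW (rho_gt0 _))//.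
    have h1 := hd x xI.
    have h2 : 1 / 2 <= bump r x.
      rewrite /bump; have x2 : x ^+ 2 / r ^+ 2 <= 1 / 4.
        rewrite ler_pdivrMr ?exprn_gt0//.
        have xb : `|x| <= r / 2 by rewrite ler_norml; case/andP: xI => ? ?; apply/andP; split; lra.
        rewrite -(real_normK (num_real x)).
        by have := normr_ge0 x; nra.
      by have : 0 <= x ^+ 2 / r ^+ 2 by [rewrite divr_ge0 ?sqr_ge0|]; nra.
    by nra.
  apply: fine_le.
  - by apply: (@integrable_fin_num _ _ _ mu) => //; exact: integrable_segment.
  - by apply: (@integrable_fin_num _ _ _ mu) => //; exact: integrable_segment.
  apply: ge0_subset_integral => //.
  - by apply/measurable_EFinP/measurable_funTS; exact: continuous_measurable_fun.
  - by move=> x _; rewrite lee_fin; exact: F0.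
  - by move=> x /=; rewrite !in_itv /= => /andP[? ?]; apply/andP; split; lra.
have [s1 s2] := andP sab.
pose X := expR (- (3 * c * (s - a))).
have X0 : 0 < X by exact: expR_gt0.
pose A := f y / 4 * q * X; pose B := 16 * N * (b - a).
have A0 : 0 < A by apply: mulr_gt0 => //; apply: mulr_gt0 => //; lra.
have B0 : 0 <= B by rewrite /B !mulr_ge0//; lra.
(* large enough to contradict [A <= B / r^2] *)
pose r := 2 * (`|y| + 1) + B / A + 1.
have y0 := normr_ge0 y; have BA : 0 <= B / A by rewrite divr_ge0// ltW.
have r0 : 0 < r by rewrite /r; lra.
have r1 : 1 <= r by rewrite /r; lra.
have h1 := energy_bound r0 N0 sab hN h0.
have h2 : f y / 4 * q <= energy r s by apply: low; rewrite /r; lra.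
have h3 : A <= B / r ^+ 2.
  apply: le_trans (ler_wpM2r (ltW X0) h2) _; apply: le_trans h1 _.
  by rewrite /B le_eqVlt; apply/orP; left; apply/eqP; field; rewrite gt_eqF.
move: h3; rewrite ler_pdivlMr ?exprn_gt0// => h3.
have : A * r <= B by apply: le_trans h3; rewrite ler_wpM2l ?(ltW A0)// expr2; nra.
rewrite -ler_pdivlMl// mulrC; rewrite /r; lra.
Qed.

End Energy.
End ComparisonPrinciple.

(** * Real powers, and the trapped solutions of an unstable equation *)

Section Powers.
Set Implicit Arguments. Unset Strict Implicit.
Context {R : realType}.
Implicit Types (x y r lo hi : R).

Lemma powR_between x r lo hi : 0 < lo -> lo <= x <= hi ->
  x `^ r <= lo `^ r + hi `^ r.
Proof.
move=> lo0 /andP[lx xh]; have x0 : 0 < x by lra.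
have h0 : 0 < hi by lra.
have [r0|r0] := leP 0 r.
  apply: (@le_trans _ _ (hi `^ r)); last by rewrite lerDr powR_ge0.
  by rewrite ge0_ler_powR// ?nnegrE// ltW.
apply: (@le_trans _ _ (lo `^ r)); last by rewrite lerDl powR_ge0.
rewrite -(opprK r) powRN [leRHS]powRN lef_pV2 ?posrE ?powR_gt0//.
by rewrite ge0_ler_powR// ?nnegrE ?oppr_ge0// ltW.
Qed.

Lemma powR_lipschitz x y r lo hi : 0 < lo -> lo <= x <= hi -> lo <= y <= hi ->
  `|x `^ r - y `^ r| <= `|r| * (lo `^ (r - 1) + hi `^ (r - 1)) * `|x - y|.
Proof.
move=> lo0; wlog xy : x y / x <= y.
  move=> h hx hy; have [xy|yx] := leP x y; first exact: h.
  by rewrite distrC (distrC x); apply: h => //; exact: ltW.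
move=> /andP[x1 x2] /andP[y1 y2].
have [t tI E] : exists2 t, t \in `[x, y] &
    y `^ r - x `^ r = (r * t `^ (r - 1)) * (y - x).
  apply: (@MVT_segment _ (fun z => z `^ r) (fun t => r * t `^ (r - 1))) => //.
    by move=> t; rewrite in_itv /= => /andP[? ?]; apply: is_derive1_powR; lra.
  apply: derivable_within_continuous => t; rewrite in_itv /= => /andP[? ?].
  by have [] := @is_derive1_powR _ r t ltac:(lra).
rewrite distrC (distrC x) E !normrM ler_wpM2r// ler_wpM2l//.
rewrite ger0_norm ?powR_ge0//; apply: powR_between => //.
by move: tI; rewrite in_itv /= => /andP[? ?]; apply/andP; split; lra.
Qed.

Lemma powRN_antitone x y b : 0 < x -> x <= y -> 0 <= b -> y `^ (- b) <= x `^ (- b).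
Proof.
move=> x0 xy b0; have y0 : 0 < y by lra.
rewrite !powRN lef_pV2 ?posrE ?powR_gt0//.
by rewrite ge0_ler_powR ?nnegrE// ltW.
Qed.

Lemma powRN_le_inv x b k : 0 < k -> 1 <= x -> 1 <= b ->
  (k * x) `^ (- b) <= k `^ (- b) / x.
Proof.
move=> k0 x1 b1; rewrite powRM ?(ltW k0)//; last lra.
rewrite ler_wpM2l ?powR_ge0// powRN lef_pV2 ?posrE ?powR_gt0//; try lra.
by rewrite le1r_powR.
Qed.

Lemma powRN_cvg0 (a : R) : 0 < a -> s `^ (- a) @[s --> +oo] --> (0 : R).
Proof.
move=> a0; apply/cvgr0Pnorm_le => e e0; near=> s.
have s0 : 0 < s by near: s; exact: nbhs_pinfty_gt.
rewrite ger0_norm ?powR_ge0//.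
have es : e `^ (- a^-1) <= s by near: s; apply: nbhs_pinfty_ge; rewrite num_real.
rewrite powRN -[leRHS]invrK lef_pV2 ?posrE ?powR_gt0 ?invr_gt0//.
rewrite -(@powRr1 _ e^-1) ?invr_ge0 ?(ltW e0)//.
have -> : e^-1 `^ 1 = (e `^ (- a^-1)) `^ a.
  by rewrite -powRrM mulNr mulVf ?gt_eqF// powRr1 ?invr_ge0 ?(ltW e0)// powR_inv1// ltW.
by rewrite ge0_ler_powR// ?nnegrE ?powR_ge0// ltW.
Unshelve. all: by end_near. Qed.

Lemma expRN_le_inv x : 0 < x -> expR (- x) <= x^-1.
Proof.
move=> x0; rewrite expRN lef_pV2 ?posrE ?expR_gt0//.
by apply: le_trans (expR_ge1Dx x); lra.
Qed.

(** Around the unstable rest point of a scalar equation, the only solutions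
    that do not leave are those slaved to the forcing: at a maximum of [g^2]
    over a half line the growth rate must be balanced by the forcing. *)
Lemma unstable_bound (s0 : R) (g c e eps : R -> R) :
  (forall s : R, s0 < s -> is_derive s 1 g (c s * g s + e s)) ->
  (forall s, s0 < s -> 1 / 2 <= c s) ->
  (forall s, s0 < s -> `|e s| <= eps s) ->
  (forall s t, s0 < s -> s <= t -> eps t <= eps s) ->
  g s @[s --> +oo] --> 0 ->
  forall s, s0 < s -> `|g s| <= 2 * eps s.
Proof.
move=> dg c12 he eps_noninc g0 s1 s01; rewrite leNgt; apply/negP => big.
have e0 s : s0 < s -> 0 <= eps s by move=> h; apply: le_trans (he s h).
have E1 := e0 _ s01.
pose G s := g s ^+ 2.
have dG (s : R) : s0 < s -> is_derive s 1 G (2 * g s * (c s * g s + e s)).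
  by move=> h; have := dX (dg s h) 2; apply: deriv_ext => //=; rewrite expr1.
have G1 : 0 < G s1 by rewrite exprn_even_gt0//=; apply/eqP => z; move: big; rewrite z normr0; lra.
have [S s1S HS] : exists2 S, s1 < S & G S < G s1.
  have g1 : 0 < `|g s1| by lra.
  have /cvgr0Pnorm_lt/(_ _ g1) := g0 => hn.
  have [S [h h']] := @filter_ex _ (pinfty_nbhs R) _ _
    (filterI hn (nbhs_pinfty_gt (num_real s1))).
  exists S => //; rewrite /G -(real_normK (num_real (g S))).
  by rewrite -(real_normK (num_real (g s1))) ltrXn2r.
have cG : {within `[s1, S], continuous G}.
  apply: derivable_within_continuous => t; rewrite in_itv /= => /andP[? ?].
  by have [] := dG t ltac:(lra).
have [t tI ht] := EVT_max (ltW s1S) cG.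
move: tI; rewrite in_itv /= => /andP[t1 tS].
have s1I : s1 \in `[s1, S] by rewrite in_itv /=; apply/andP; split; lra.
have Gt := ht s1 s1I.
have tlt : t < S by rewrite lt_neqAle tS andbT; apply/eqP => tE; move: Gt; rewrite tE; lra.
have st : s0 < t by lra.
have gt1 : `|g s1| <= `|g t|.
  rewrite -(@ler_pXn2r _ 2) ?nnegrE//.
  by rewrite !real_normK ?num_real.
have et : eps t <= eps s1 by apply: eps_noninc.
have D0 : 0 < 2 * g t * (c t * g t + e t).
  rewrite (_ : _ * _ = 2 * (c t * `|g t| ^+ 2 + g t * e t)); last first.
    by rewrite real_normK ?num_real//; ring.
  have h1 : - (`|g t| * eps s1) <= g t * e t.
    rewrite lerNl; apply: le_trans (ler_norm _) _; rewrite normrN normrM ler_wpM2l//.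
    exact: le_trans (he t st) et.
  have h2 := c12 t st.
  have h3 : 1 / 2 * `|g t| ^+ 2 <= c t * `|g t| ^+ 2 by rewrite ler_wpM2r// exprn_ge0.
  have g0' : 0 < `|g t| by lra.
  by rewrite mulr_gt0//; nra.
have [dGt vG] := dG t st.
have [h /andP[h0 hS] hG] : exists2 h, 0 < h < S - t & G t < G (t + h).
  have lim : h^-1 *: (G (h *: (1 : R) + t) - G t) @[h --> 0^'] --> 2 * g t * (c t * g t + e t).
    by rewrite -vG; exact: dGt.
  have /cvgr_gt/(_ _ D0) hn := lim.
  have hr : \forall h \near (0 : R)^'+, 0 < h^-1 *: (G (h *: (1 : R) + t) - G t).
    move: hn; rewrite /dnbhs /at_right !near_withinE; apply: filterS => h Ph h0.
    by apply: Ph; rewrite gt_eqF.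
  near (0 : R)^'+ => h.
  exists h; first by apply/andP; split; near: h; [exact: nbhs_right_gt|apply: nbhs_right_lt; lra].
  have : 0 < h^-1 *: (G (h *: (1 : R) + t) - G t) by near: h.
  have h0 : 0 < h by near: h; exact: nbhs_right_gt.
  by rewrite /GRing.scale /= mulr1 pmulr_rgt0 ?invr_gt0// subr_gt0 addrC.
have := ht (t + h) ltac:(by rewrite in_itv /=; apply/andP; split; lra).
by lra.
Unshelve. all: by end_near. Qed.

End Powers.

(** * The perturbation in self-similar variables *)

Section Potential.
Set Implicit Arguments. Unset Strict Implicit.
Context {R : realType}.
Implicit Types (p a M m mu s x z : R) (h phi : R -> R).

(** On the scale [z = exp (s al) x] with [x] in a compact set, the logarithm
    that weakens [h] is [2 al s] up to a constant: it only sees the time. *)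
Lemma log_estimate (al c0 c1 s x : R) : 0 < al -> 0 < c0 -> c0 <= x <= c1 -> 0 <= s ->
  let z := expR (s * al) * x in
  `|ln (2 + z ^+ 2) - 2 * (s * al)| <= `|ln (c0 ^+ 2)| + `|ln (2 + c1 ^+ 2)|.
Proof.
move=> al0 c00 /andP[x0 x1] s0 /=.
have sa : 0 <= s * al by rewrite mulr_ge0// ltW.
have c2 : c0 ^+ 2 <= x ^+ 2 by rewrite ler_sqr ?nnegrE; lra.
have c3 : x ^+ 2 <= c1 ^+ 2 by rewrite ler_sqr ?nnegrE; lra.
have c02 : 0 < c0 ^+ 2 by rewrite exprn_gt0.
set E := expR (2 * (s * al)).
have E0 : 0 < E by exact: expR_gt0.
have E1 : 1 <= E by rewrite -expR0 ler_expR; lra.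
have -> : (expR (s * al) * x) ^+ 2 = E * x ^+ 2.
  by rewrite exprMn /E expRM_natl.
have lE : ln E = 2 * (s * al) by rewrite expRK.
have lo : ln E + ln (c0 ^+ 2) <= ln (2 + E * x ^+ 2).
  by rewrite -lnM ?posrE// ler_ln ?posrE; nra.
have hi : ln (2 + E * x ^+ 2) <= ln E + ln (2 + c1 ^+ 2).
  by rewrite -lnM ?posrE; [|nra..]; rewrite ler_ln ?posrE; nra.
have k1 := ler_norm (ln (2 + c1 ^+ 2)); have k2 := ler_norm (- ln (c0 ^+ 2)).
rewrite normrN in k2.
have k3 := normr_ge0 (ln (2 + c1 ^+ 2)); have k4 := normr_ge0 (ln (c0 ^+ 2)).
by rewrite -lE ler_norml; apply/andP; split; lra.
Qed.

(** What the equation for [phi] and the potential retain of the perturbation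
    [h]: up to errors [O(1/s)] it multiplies the nonlinearity [x^p] by
    [1 + m s], with a slowly varying [m] that vanishes at infinity ([m = 0]
    when the factor of [h'] is absent). *)
Record perturb_control (p c0 c1 C s1 : R) (m : R -> R) (iota : bool) h : Prop :=
  PerturbControl {
  pc_cvg : m s @[s --> +oo] --> 0;
  pc_deriv : forall s, s1 <= s -> exists2 dm, is_derive s 1 m dm & `|dm| <= C / s;
  pc_ode : forall s x, s1 <= s -> c0 <= x <= c1 ->
    `|expR (- (p * s / (p - 1))) * h (expR (s / (p - 1)) * x)
      - x * (m s * x `^ (p - 1))| <= C / s * x;
  pc_bounded : forall s x, s1 <= s -> 0 < x <= c1 ->
    `|iota%:R * (expR (- s) * derive1 h (expR (s / (p - 1)) * x))| <= C;
  pc_potential : forall s x, s1 <= s -> c0 <= x <= c1 ->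
    `|iota%:R * (expR (- s) * derive1 h (expR (s / (p - 1)) * x))
      - p * m s * x `^ (p - 1)| <= C / s }.

Lemma powRS x r : 0 < x -> x `^ r = x * x `^ (r - 1).
Proof.
move=> x0; rewrite -{2}(@powRr1 _ x) ?(ltW x0)// -powRD; last by apply/implyP => _; rewrite gt_eqF.
by congr (_ `^ _); ring.
Qed.

Section Scaling.
Local Notation al p := (p - 1)^-1.

Lemma p1_gt0 (p : R) (hp : 1 < p) : 0 < p - 1.
Proof. by rewrite subr_gt0. Qed.

Lemma al_gt0 (p : R) (hp : 1 < p) : 0 < (al p).
Proof. by rewrite invr_gt0 (p1_gt0 hp). Qed.

Lemma scaled_pow (p : R) (hp : 1 < p) s x : 0 < x ->
  expR (- s) * (expR (s / (p - 1)) * x) `^ (p - 1) = x `^ (p - 1).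
Proof.
move=> x0; rewrite powRM ?expR_ge0// ?(ltW x0)// -expRM divfK; last by rewrite gt_eqF// (p1_gt0 hp).
by rewrite mulrA -expRD addNr expR0 mul1r.
Qed.

Lemma scaled_powS (p : R) s x : 0 < x ->
  expR (- (p * s / (p - 1))) * (expR (s / (p - 1)) * x) `^ p = x `^ p.
Proof.
move=> x0; rewrite powRM ?expR_ge0// ?(ltW x0)// -expRM mulrA -expRD.
rewrite (_ : _ + _ = 0) ?expR0 ?mul1r//; ring.
Qed.

Lemma log_large (p : R) (hp : 1 < p) (c0 c1 s x : R) : 0 < c0 -> c0 <= x <= c1 -> 0 <= s ->
  `|ln (c0 ^+ 2)| + `|ln (2 + c1 ^+ 2)| <= s * (al p) ->
  (al p) * s <= ln (2 + (expR (s / (p - 1)) * x) ^+ 2).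
Proof.
move=> c00 xc s0 hs; have := log_estimate (al_gt0 hp) c00 xc s0.
by rewrite /= ler_norml => /andP[? ?]; rewrite mulrC; lra.
Qed.

(** The bound with [a > 1] makes the whole perturbation [O(s^(-a))], hence
    [O(1/s)]: it is an error, and [m = 0]. *)
Lemma perturb_control_bound (p : R) (hp : 1 < p) a M (c0 c1 : R) : 0 < c0 -> c0 <= c1 ->
  exists2 C, 0 < C & forall h, perturb_bound p a M h ->
  exists2 s1 : R, 1 <= s1 & perturb_control p c0 c1 C s1 (fun=> 0) false h.
Proof.
move=> c00 c01; have p1 := p1_gt0 hp; have al0 := al_gt0 hp.
have c10 : 0 < c1 by lra.
pose C := `|M| * (c1 `^ (p - 1)) * (al p) `^ (- a) + `|M| / c0 * (p * (al p))^-1 + 1.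
have pal : 0 < p * (al p) by rewrite mulr_gt0//; lra.
have C0 : 0 < C.
  by rewrite /C ltr_wpDl// addr_ge0// !mulr_ge0 ?powR_ge0// invr_ge0 ltW.
exists C => // h [a1 M0 hb].
pose B := `|ln (c0 ^+ 2)| + `|ln (2 + c1 ^+ 2)|.
have B0 : 0 <= B by rewrite addr_ge0.
exists (1 + B / (al p)); first by rewrite lerDl divr_ge0// ltW.
have sE s : 1 + B / (al p) <= s -> 1 <= s /\ B <= s * (al p).
  move=> hs; have : 0 <= B / (al p) by rewrite divr_ge0// ltW.
  by split; [lra|rewrite -ler_pdivrMr//; lra].
split.
- exact: cvg_cst.
- move=> s /sE[s1 _]; exists 0; first exact: dconst.
  by rewrite normr0 divr_ge0 ?(ltW C0)//; lra.
- move=> s x /sE[s1 sB] /andP[x0 x1].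
  have x00 : 0 < x by lra.
  rewrite mul0r mulr0 subr0 normrM ger0_norm ?expR_ge0//.
  set z := expR (s / (p - 1)) * x.
  have z0 : 0 < z by rewrite mulr_gt0// expR_gt0.
  have := hb 0%N z isT; rewrite derive1n0 subr0 (gtr0_norm z0) /logpow => hz.
  set l := ln (2 + z ^+ 2) in hz.
  have ll : (al p) * s <= l.
    by apply: (log_large hp (c0 := c0) (c1 := c1)) => //; [apply/andP|lra].
  have als : 0 < (al p) * s by rewrite mulr_gt0//; lra.
  have l0 : 0 < l by lra.
  have hl : (l `^ a)^-1 <= (al p) `^ (- a) / s.
    rewrite -powRN; apply: le_trans (_ : _ <= ((al p) * s) `^ (- a)) _.
      rewrite !powRN lef_pV2 ?posrE ?powR_gt0// ge0_ler_powR ?nnegrE// ?(ltW als) ?(ltW l0)//.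
      lra.
    by apply: powRN_le_inv => //; exact: ltW.
  apply: le_trans (ler_wpM2l (expR_ge0 _) hz) _.
  have -> : expR (- (p * s / (p - 1))) * (M * (z `^ p / l `^ a + 1)) =
      M * (x * x `^ (p - 1)) * (l `^ a)^-1 + M * expR (- (p * s / (p - 1))).
    rewrite -powRS// -(scaled_powS p s x00) -/z; ring.
  have e1 : expR (- (p * s / (p - 1))) <= (p * (al p))^-1 / s * (x / c0).
    have e2 : expR (- (p * s / (p - 1))) <= (p * s / (p - 1))^-1.
      by apply: expRN_le_inv; rewrite divr_gt0 ?mulr_gt0//; lra.
    apply: le_trans e2 _; rewrite -[leLHS]mulr1.
    have -> : (p * s / (p - 1))^-1 = (p * (al p))^-1 / s.
      by rewrite /(al p); field; apply/and3P; split; rewrite gt_eqF//; lra.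
    apply: ler_wpM2l; last by rewrite ler_pdivlMr// mul1r.
    by apply: divr_ge0; [rewrite invr_ge0 ltW|lra].
  have xp : x `^ (p - 1) <= c1 `^ (p - 1).
    by rewrite ge0_ler_powR ?nnegrE//; clear -x00 x1 p1; lra.
  have -> : C / s * x = `|M| * (x * c1 `^ (p - 1)) * ((al p) `^ (- a) / s) +
      `|M| * ((p * (al p))^-1 / s * (x / c0)) + x / s.
    by rewrite /C; field; apply/and3P; split; rewrite gt_eqF//; lra.
  rewrite (gtr0_norm M0); apply: ler_wpDr; first by rewrite divr_ge0//; lra.
  apply: lerD; last by rewrite ler_wpM2l// ltW.
  apply: ler_pM => //.
  + by rewrite !mulr_ge0 ?powR_ge0// ltW.
  + by rewrite invr_ge0 powR_ge0.
  + by rewrite ler_wpM2l ?(ltW M0)// ler_wpM2l// ltW.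
- by move=> s x _ _; rewrite mul0r normr0 ltW.
- by move=> s x /sE[s1 _] _; rewrite mulr0 !mul0r subr0 normr0 divr_ge0 ?(ltW C0)//; lra.
Qed.

Lemma explicitE (p : R) a mu h z : perturb_explicit p a mu h -> 0 < z ->
  h z = mu * (z `^ p * ln (2 + z ^+ 2) `^ (- a)).
Proof.
move=> [a0 hE] z0; rewrite hE gtr0_norm// /logpow powRN (powRS p z0).
by rewrite (mulrC z).
Qed.

Lemma ln2z_gt0 z : 0 < ln (2 + z ^+ 2).
Proof. by apply: ln_gt0; have := sqr_ge0 z; lra. Qed.

Lemma explicit_derive (p : R) (hp : 1 < p) a mu h z : perturb_explicit p a mu h -> 0 < z ->
  derive1 h z = mu * z `^ (p - 1) * (p * ln (2 + z ^+ 2) `^ (- a)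
    - 2 * a * (z ^+ 2 / (2 + z ^+ 2)) * ln (2 + z ^+ 2) `^ (- (a + 1))).
Proof.
move=> hE z0; apply: is_derive1E.
apply: (near_eq_is_derive (f := fun t => mu * (t `^ p * ln (2 + t ^+ 2) `^ (- a)))).
  apply: (@near_id _ _ _ 0 (z + 1)); first by apply/andP; split; lra.
  by move=> t /andP[t0 _]; rewrite (explicitE hE t0).
have z2 : 0 < 2 + z ^+ 2 by have := sqr_ge0 z; lra.
have := dZ (dM (dpow (did z) p z0)
  (dpow (dln (dD (dconst 2 z) (dX (did z) 2)) z2) (- a) (ln2z_gt0 z))) mu.
apply: deriv_ext => [//|] /=.
rewrite (powRS p z0) (_ : - a - 1 = - (a + 1)); last by ring.
by rewrite expr1; field; rewrite gt_eqF.
Qed.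

Lemma log_power_estimate (p : R) (hp : 1 < p) a (c0 c1 : R) : 0 < c0 -> 0 < a ->
  let B := `|ln (c0 ^+ 2)| + `|ln (2 + c1 ^+ 2)| in
  forall s x, 1 <= s -> B <= s * (al p) -> c0 <= x <= c1 ->
  `|ln (2 + (expR (s / (p - 1)) * x) ^+ 2) `^ (- a) - (2 * (s * (al p))) `^ (- a)|
    <= `|a| * B * ((al p) `^ (- (a + 1)) + (4 * (al p)) `^ (- (a + 1))) / s.
Proof.
move=> c00 a0 B s x s1 sB xc; have al0 := al_gt0 hp.
set l := ln _; set L := 2 * (s * (al p)).
have s0 : 0 <= s by lra.
have lL : `|l - L| <= B := log_estimate al0 c00 xc s0.
have sal : 0 < s * (al p) by rewrite mulr_gt0//; lra.
have [l1 l2] : s * (al p) <= l /\ l <= 4 * (s * (al p)).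
  by move: lL; rewrite ler_norml /L => /andP[? ?]; split; lra.
have := @powR_lipschitz _ l L (- a) (s * (al p)) (4 * (s * (al p))) sal
  ltac:(by rewrite l1 l2) ltac:(by rewrite /L; apply/andP; split; lra).
move=> H; apply: le_trans H _; rewrite normrN (_ : - a - 1 = - (a + 1)); last by ring.
rewrite (_ : _ / s = `|a| * ((al p) `^ (- (a + 1)) / s + (4 * (al p)) `^ (- (a + 1)) / s) * B);
  last by ring.
have a1 : 1 <= a + 1 by lra.
apply: ler_pM => //.
  by rewrite mulr_ge0 ?addr_ge0 ?powR_ge0.
rewrite ler_wpM2l//; apply: lerD; first by rewrite mulrC; exact: powRN_le_inv.
by rewrite (mulrC s) mulrA; apply: powRN_le_inv => //; lra.
Qed.

(** For small [a] the perturbation is much larger than [1/s], but its main part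
    [mu (2 al s)^(-a) x^p] has the form of the nonlinearity; the error made in
    replacing the logarithm by [2 al s] is [O(s^(-a-1))].  The same main part
    comes out of [h'], so that the two combine in the potential. *)
Lemma perturb_control_explicit (p : R) (hp : 1 < p) a mu (c0 c1 : R) : 0 < c0 -> c0 <= c1 ->
  exists2 C, 0 < C & forall h, perturb_explicit p a mu h ->
  exists2 s1 : R, 1 <= s1 &
    perturb_control p c0 c1 C s1 (fun s => mu * (2 * (s * (al p))) `^ (- a)) true h.
Proof.
move=> c00 c01; have p1 := p1_gt0 hp; have al0 := al_gt0 hp.
have c10 : 0 < c1 by lra.
pose B := `|ln (c0 ^+ 2)| + `|ln (2 + c1 ^+ 2)|.
have B0 : 0 <= B by rewrite addr_ge0.
pose A1 := (al p) `^ (- (a + 1)).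
pose D := `|a| * B * (A1 + (4 * (al p)) `^ (- (a + 1))).
pose X := c1 `^ (p - 1).
pose l2 : R := ln 2.
have A10 : 0 <= A1 by exact: powR_ge0.
have D0 : 0 <= D by rewrite !mulr_ge0// addr_ge0// powR_ge0.
have X0 : 0 <= X by exact: powR_ge0.
pose E1 := p * l2 `^ (- a) + 2 * `|a| * l2 `^ (- (a + 1)).
have na := normr_ge0 a.
have E10 : 0 <= E1 by rewrite addr_ge0 ?mulr_ge0 ?powR_ge0//; lra.
pose E2 := p * D + 2 * `|a| * A1.
have E20 : 0 <= E2.
  by apply: addr_ge0; apply: mulr_ge0 => //; first [lra|exact: mulr_ge0].
pose E3 := `|mu| * `|a| * (2 * (al p)) * (2 * (al p)) `^ (- (a + 1)).
have E30 : 0 <= E3 by rewrite !mulr_ge0 ?powR_ge0// ltW.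
have m0 := normr_ge0 mu.
pose mX := `|mu| * X; have mX0 : 0 <= mX by rewrite mulr_ge0.
have mD0 : 0 <= mX * D by rewrite mulr_ge0.
have mE1 : 0 <= mX * E1 by rewrite mulr_ge0.
have mE2 : 0 <= mX * E2 by rewrite mulr_ge0.
have [C [C0 hC1 hC2 hC3 hC4]] : exists C,
    [/\ 0 < C, E3 <= C, mX * D <= C, mX * E1 <= C & mX * E2 <= C].
  exists (E3 + mX * D + mX * E1 + mX * E2 + 1).
  by clear -E30 mD0 mE1 mE2; split; lra.
exists C => // h hE; have [a0 _] := hE.
have ga0 : `|a| = a by rewrite gtr0_norm.
exists (1 + B / (al p)); first by rewrite lerDl divr_ge0// ltW.
have sE s : 1 + B / (al p) <= s -> [/\ 1 <= s, 0 < s, 0 <= s^-1 & B <= s * (al p)].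
  move=> hs; have Bal : 0 <= B / (al p) by rewrite divr_ge0// ltW.
  have s1 : 1 <= s by clear -hs Bal; lra.
  have s0 : 0 < s by clear -s1; lra.
  by split => //; [rewrite invr_ge0 ltW|rewrite -ler_pdivrMr//; clear -hs; lra].
have xX x : 0 < x <= c1 -> 0 <= x `^ (p - 1) <= X.
  move=> /andP[x0 x1]; rewrite powR_ge0/= /X ge0_ler_powR ?nnegrE//; clear -x0 p1 c10; lra.
have xle x : c0 <= x <= c1 -> 0 < x <= c1 by move=> /andP[h1 h2]; rewrite h2 andbT; exact: lt_le_trans h1.
have rle z : 0 <= z ^+ 2 / (2 + z ^+ 2) <= 1.
  have := sqr_ge0 z => z0; rewrite divr_ge0//=; last by clear -z0; lra.
  by rewrite ler_pdivrMr; clear -z0; lra.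
have P'E s x : 0 < x -> true%:R * (expR (- s) * derive1 h (expR (s / (p - 1)) * x)) =
    mu * x `^ (p - 1) * (p * ln (2 + (expR (s / (p - 1)) * x) ^+ 2) `^ (- a)
    - 2 * a * ((expR (s / (p - 1)) * x) ^+ 2 / (2 + (expR (s / (p - 1)) * x) ^+ 2))
      * ln (2 + (expR (s / (p - 1)) * x) ^+ 2) `^ (- (a + 1))).
  move=> x0; rewrite mul1r (explicit_derive hp hE) ?mulr_gt0 ?expR_gt0//.
  by rewrite -(scaled_pow hp s x0); ring.
have logE s x : 1 + B / (al p) <= s -> c0 <= x <= c1 ->
    `|ln (2 + (expR (s / (p - 1)) * x) ^+ 2) `^ (- a) - (2 * (s * (al p))) `^ (- a)| <= D / s.
  by move=> /sE[s1 _ _ sB] xc; exact: log_power_estimate.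
split.
- apply: (@cvg_trans _ ((fun s => mu * ((2 * (al p)) `^ (- a) * s `^ (- a))) @ +oo)).
    apply: near_eq_cvg; near=> s.
    have s0 : 0 <= s by near: s; apply: nbhs_pinfty_ge; rewrite num_real.
    by rewrite -powRM// ?mulr_ge0 ?(ltW al0)//; congr (_ * _ `^ _); ring.
  rewrite -(mulr0 mu) -(mulr0 ((2 * (al p)) `^ (- a))).
  by apply: cvgMr; apply: cvgMr; exact: powRN_cvg0.
- move=> s /sE[s1 s0 si _].
  have L0 : 0 < 2 * (s * (al p)) by rewrite !mulr_gt0.
  eexists; first exact: (dZ (dpow (dZ (dM (did s) (dconst (al p) s)) 2) (- a) L0) mu).
  rewrite mul1r mulr0 addr0 !normrM normrN (_ : - a - 1 = - (a + 1)); last by ring.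
  rewrite (gtr0_norm al0) (@ger0_norm _ 2)// (@ger0_norm _ (_ `^ _)) ?powR_ge0//.
  have h1 : (2 * (s * (al p))) `^ (- (a + 1)) <= (2 * (al p)) `^ (- (a + 1)) / s.
    rewrite (_ : 2 * (s * (al p)) = (2 * (al p)) * s); last by ring.
    by apply: powRN_le_inv => //; [rewrite mulr_gt0|clear -a0; lra].
  apply: (@le_trans _ _ (E3 / s)); last by rewrite ler_wpM2r.
  rewrite (_ : E3 / s = `|mu| * (`|a| * ((2 * (al p)) `^ (- (a + 1)) / s) * (2 * (al p))));
    last by rewrite /E3; ring.
  by rewrite ler_wpM2l// ler_wpM2r ?mulr_ge0 ?(ltW al0)// ler_wpM2l.
- move=> s x hs xc; have [s1 s0 si sB] := sE s hs.
  have /andP[x0 x1] := xle _ xc; have /andP[xp0 xp1] := xX _ (xle _ xc).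
  rewrite (explicitE hE) ?mulr_gt0 ?expR_gt0//.
  set l := ln _ `^ _; rewrite (_ : _ - _ = x * (mu * (x `^ (p - 1) * (l - (2 * (s * (al p))) `^ (- a))))); last first.
    transitivity (mu * (expR (- (p * s / (p - 1))) * (expR (s / (p - 1)) * x) `^ p) * l -
      x * (mu * (2 * (s * (al p))) `^ (- a) * x `^ (p - 1))); first by ring.
    by rewrite scaled_powS// (powRS p x0); ring.
  rewrite !normrM (gtr0_norm x0) (ger0_norm xp0) mulrC ler_wpM2r ?(ltW x0)//.
  apply: (@le_trans _ _ (mX * D / s)); last by rewrite ler_wpM2r.
  rewrite -[leRHS]mulrA /mX -[leRHS]mulrA ler_wpM2l//; apply: ler_pM => //; exact: logE.
- move=> s x hs xc; have [s1 s0 si sB] := sE s hs.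
  have /andP[x0 x1] := xc; have /andP[xp0 xp1] := xX _ xc.
  rewrite P'E//; set z := expR _ * x.
  have /andP[r0 r1] := rle z; move: (z ^+ 2 / _) r0 r1 => r r0 r1.
  have l2p : 0 < l2 by apply: ln_gt0; rewrite ltr1n.
  have z2 := sqr_ge0 z.
  have ll : l2 <= ln (2 + z ^+ 2) by rewrite ler_ln ?posrE ?lerDl// ltr_wpDr.
  have dec b : 0 < b -> ln (2 + z ^+ 2) `^ (- b) <= l2 `^ (- b).
    by move=> b0; apply: powRN_antitone => //; exact: ltW.
  apply: (@le_trans _ _ (mX * E1)); last by [].
  rewrite (normrM (mu * _)) (normrM mu) (ger0_norm xp0) /mX; apply: ler_pM => //.
  + by rewrite mulr_ge0.
  + by rewrite ler_wpM2l.
  apply: le_trans (ler_normB _ _) _; rewrite /E1; apply: lerD.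
    rewrite normrM (ger0_norm (powR_ge0 _ _)) gtr0_norm; last by clear -p1; lra.
    by apply: ler_wpM2l; [clear -p1; lra|exact: dec].
  rewrite !normrM (ger0_norm (powR_ge0 _ _)) (ger0_norm r0) (@ger0_norm _ 2)//.
  apply: ler_pM => //; rewrite ?mulr_ge0 ?powR_ge0//; last by apply: dec; clear -a0; lra.
  by rewrite -[leRHS]mulr1 ler_wpM2l// mulr_ge0.
- move=> s x hs xc; have [s1 s0 si sB] := sE s hs.
  have /andP[x0 x1] := xle _ xc; have /andP[xp0 xp1] := xX _ (xle _ xc).
  have hl := logE s x hs xc.
  rewrite P'E//; set z := expR _ * x in hl *; set l := ln _ in hl *.
  have /andP[r0 r1] := rle z; move: (z ^+ 2 / _) r0 r1 => r r0 r1.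
  have ll : (al p) * s <= l by apply: (log_large hp (c0 := c0) (c1 := c1)) => //; exact: ltW.
  have als : 0 < (al p) * s by rewrite mulr_gt0.
  have hl2 : l `^ (- (a + 1)) <= A1 / s.
    have a1 : 1 <= a + 1 by clear -a0; lra.
    apply: le_trans (powRN_antitone als ll (le_trans ler01 a1)) _.
    exact: powRN_le_inv.
  apply: (@le_trans _ _ (mX * (E2 / s))); last by rewrite mulrA ler_wpM2r.
  rewrite (_ : _ - _ = mu * x `^ (p - 1) * (p * (l `^ (- a) - (2 * (s * (al p))) `^ (- a))
     - 2 * a * r * l `^ (- (a + 1)))); last by ring.
  rewrite (normrM (mu * _)) (normrM mu) (ger0_norm xp0) /mX; apply: ler_pM => //.
  + by rewrite mulr_ge0.
  + by rewrite ler_wpM2l.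
  apply: le_trans (ler_normB _ _) _; rewrite /E2 [leRHS]mulrDl; apply: lerD.
    have p0 : 0 < p by clear -hp; lra.
    by rewrite normrM gtr0_norm// -mulrA ler_wpM2l// ltW.
  rewrite !normrM (ger0_norm (powR_ge0 _ _)) (ger0_norm r0) (@ger0_norm _ 2)//.
  rewrite -[leRHS]mulrA; apply: ler_pM => //; rewrite ?mulr_ge0 ?powR_ge0//.
  by rewrite -[leRHS]mulr1 ler_wpM2l// mulr_ge0.
Unshelve. all: by end_near. Qed.

End Scaling.
End Potential.

(** * The potential is bounded, and small on bounded sets *)

Section PotentialBound.
Set Implicit Arguments. Unset Strict Implicit.
Context {R : realType}.
Implicit Types (a M mu s x z : R) (h phi : R -> R).
Local Notation al p := (p - 1)^-1.

Lemma perturb_controlE (p : R) (hp : 1 < p) iota a M mu (c0 c1 : R) : 0 < c0 -> c0 <= c1 ->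
  exists2 C, 0 < C & forall h, perturbation iota p a M mu h ->
  exists s1 m, 1 <= s1 /\ perturb_control p c0 c1 C s1 m iota h.
Proof.
move=> c00 c01; case: iota.
- have [C C0 H] := perturb_control_explicit hp a mu c00 c01.
  by exists C => // h [_ /H[s1 s11 k]]; eexists; eexists; split; [exact: s11|exact: k].
- have [C C0 H] := perturb_control_bound hp a M c00 c01.
  by exists C => // h [_ /H[s1 s11 k]]; eexists; eexists; split; [exact: s11|exact: k].
Qed.

Lemma kappa_gt0 (p : R) (hp : 1 < p) : 0 < kappa p.
Proof. by rewrite powR_gt0// (p1_gt0 hp). Qed.

Lemma kappa_pow (p : R) (hp : 1 < p) : kappa p `^ (p - 1) = (al p).
Proof.
have p1 := p1_gt0 hp.
by rewrite /kappa -powRrM mulNr mulVf ?gt_eqF// powR_inv1// ltW.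
Qed.

Lemma pinftyP (P : R -> Prop) : (\forall s \near +oo, P s) ->
  exists s0 : R, forall s, s0 < s -> P s.
Proof. by move=> [s0 [_ h]]; exists s0. Qed.

(** The factor [1 + m] is put into the unknown
    [u = phi^(p-1) (1 + m) - 1/(p-1)] because [m] may decay more slowly than
    [1/s].  Then [u' = c u + O(1/s)] with [c = (p-1) phi^(p-1) (1 + m) -> 1],
    and a solution that tends to [0] is itself [O(1/s)]. *)
Lemma phase_bound (p : R) (hp : 1 < p) (c0 c1 C s1 : R) m iota h phi :
  c0 <= kappa p / 2 -> 2 * kappa p <= c1 -> 1 <= s1 -> 0 < C ->
  perturb_control p c0 c1 C s1 m iota h -> ode_solution p h phi ->
  exists2 s2, s1 <= s2 & forall s, s2 < s ->
    kappa p / 2 <= phi s <= 2 * kappa p /\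
    `|phi s `^ (p - 1) * (1 + m s) - (al p)| <= 4 * (1 + (al p)) * C / s.
Proof.
move=> k0 k1 s11 C0 [mc md mo _ _] [[t0 ode] phic].
have p1 := p1_gt0 hp; have kp := kappa_gt0 hp; have al0 := al_gt0 hp.
pose q s := phi s `^ (p - 1).
have qc : q s @[s --> +oo] --> (al p).
  rewrite -(kappa_pow hp); apply: (@cvg_comp _ _ _ phi (fun x => x `^ (p - 1))); first exact: phic.
  exact: (derive_cont (is_derive1_powR (p - 1) kp)).
pose c s := (p - 1) * (q s * (1 + m s)).
have cc : c s @[s --> +oo] --> (1 : R).
  rewrite -(@mulfV _ (p - 1)) ?gt_eqF// -[X in _ * X](mulr1 (al p)).
  apply: cvgMr; apply: cvgM => //; rewrite -[X in _ --> X](addr0 (1 : R)).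
  by apply: cvgD => //; exact: cvg_cst.
pose u s := q s * (1 + m s) - (al p).
have uc : u s @[s --> +oo] --> (0 : R).
  rewrite -[X in _ --> X](subrr (al p)) -[X in _ --> X - _](mulr1 (al p)).
  apply: cvgB; last exact: cvg_cst.
  apply: cvgM => //; rewrite -[X in _ --> X](addr0 (1 : R)).
  by apply: cvgD => //; exact: cvg_cst.
have [s3 H3] : exists s3 : R, forall s, s3 < s ->
    [/\ kappa p / 2 <= phi s <= 2 * kappa p, 1 / 2 <= c s <= 2 & q s <= 2 * (al p)].
  apply: pinftyP; near=> s; split.
  - apply/andP; split; near: s.
      by apply: (cvgr_ge (kappa p)) phic _ _; lra.
    by apply: (cvgr_le (kappa p)) phic _ _; lra.
  - apply/andP; split; near: s.
      by apply: (cvgr_ge 1) cc _ _; lra.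
    by apply: (cvgr_le 1) cc _ _; lra.
  - by near: s; apply: (cvgr_le (al p)) qc _ _; lra.
pose s2 := Num.max s1 (Num.max s3 t0).
have s2E s : s2 < s -> [/\ s1 <= s, s3 < s & t0 < s].
  by rewrite !gt_max => /andP[? /andP[? ?]]; split => //; exact: ltW.
exists s2; first by rewrite le_max lexx.
pose w s := expR (- (p * s / (p - 1))) * h (expR (s / (p - 1)) * phi s).
pose r s := (w s - phi s * (m s * q s)) / phi s.
pose e s := c s * r s + q s * derive1 m s.
pose eps s := 2 * (1 + (al p)) * C / s.
have main : forall s, s2 < s -> `|u s| <= 2 * eps s.
  apply: (@unstable_bound _ s2 u c e eps).
  - move=> s /s2E[a1 a3 a0]; have [ps dphi] := ode s a0.
    have [dm hdm _] := md s a1.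
    have dmE := is_derive1E hdm.
    have := dB (dM (dpow dphi (p - 1) ps) (dD (dconst 1 s) hdm)) (dconst (al p) s).
    apply: deriv_ext => [//|].
    rewrite /e /c /u -/(w s) dmE /r (powRS p ps) -/(q s).
    rewrite (_ : q s = phi s * phi s `^ (p - 1 - 1)); last by rewrite /q (powRS (p - 1) ps).
    by field; rewrite !gt_eqF.
  - by move=> s /s2E[_ /H3[_ /andP[]]].
  - move=> s /s2E[a1 a3 a0]; have [ps _] := ode s a0.
    have [/andP[f1 f2] /andP[g1 g2] q2] := H3 s a3.
    have [dm hdm dmC] := md s a1.
    have q0 : 0 <= q s by exact: powR_ge0.
    have rC : `|r s| <= C / s.
      rewrite /r normrM normfV (gtr0_norm ps) ler_pdivrMr//.
      by apply: mo => //; apply/andP; split; lra.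
    rewrite /e; apply: le_trans (ler_normD _ _) _.
    rewrite (_ : eps s = 2 * (C / s) + 2 * (al p) * (C / s)); last by rewrite /eps; ring.
    rewrite (normrM (c s)) (normrM (q s)) (is_derive1E hdm); apply: lerD; apply: ler_pM => //.
      by rewrite ger0_norm//; lra.
    by rewrite ger0_norm.
  - move=> s t /s2E[a1 _ _] st; have ist : t^-1 <= s^-1 by rewrite lef_pV2 ?posrE//; lra.
    have k0' : 0 <= 2 * (1 + (al p)) * C.
      by apply: mulr_ge0 (ltW C0); apply: mulr_ge0; lra.
    exact: (ler_wpM2l k0' ist).
  - exact: uc.
move=> s hs; have [_ a3 _] := s2E s hs; have [f _ _] := H3 s a3; split => //.
apply: le_trans (main s hs) _; rewrite /eps le_eqVlt; apply/orP; left; apply/eqP; ring.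
Unshelve. all: by end_near. Qed.

Lemma varphiE (p : R) (hp : 1 < p) phi y s : 1 <= s ->
  varphi p phi y s =
  phi s * ((1 + (p - 1) / (4 * p) * (y ^+ 2 / s)) `^ (- (al p)) + (2 * p * s)^-1).
Proof.
move=> s1; have kp := kappa_gt0 hp; have p1 := p1_gt0 hp.
rewrite /varphi /profile exprMn exprVn sqr_sqrtr; last lra.
set P := _ `^ _; rewrite -/(kappa p); field.
by rewrite !gt_eqF//; lra.
Qed.

(** Write [g = varphi / phi], which is [1 + O((1 + y^2) / s)] and lies between
    two positive constants where [y^2 <= s].  There
    [V = p (g^(p-1) (phi^(p-1) (1 + m) - 1/(p-1)) + (g^(p-1) - 1) / (p-1))] up to
    [O(1/s)]: the slowly decaying part [m] of the perturbation only appears in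
    the combination that [phase_bound] controls.  Where [y^2 > s] the second
    bound follows from the first. *)
Theorem potential_bound (p : R) (hp : 1 < p) iota a M mu :
  exists2 C, 0 < C & forall h phi,
    perturbation iota p a M mu h -> ode_solution p h phi ->
  exists2 s0 : R, 1 <= s0 & forall s y, s0 <= s ->
    `|potential iota p h phi y s| <= C /\
    `|potential iota p h phi y s| <= C * ((1 + y ^+ 2) / s).
Proof.
have p1 := p1_gt0 hp; have kp := kappa_gt0 hp; have al0 := al_gt0 hp.
have p0 : 0 < p by lra.
have kE : exists2 k, k = kappa p & 0 < k by exists (kappa p).
have [k kE' k0] := kE.
have [g0 [g00 g01 fg0]] : exists g0 : R, [/\ 0 < g0, g0 <= 1 &
    forall q, 1 <= q <= 2 -> g0 <= q `^ (- (al p))].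
  exists (2 `^ (- (al p))); split; first by rewrite powR_gt0.
    rewrite powRN invf_le1 ?powR_gt0// -[leLHS](powRr0 (2 : R)).
    by apply: ler_powR; [lra|exact: ltW].
  move=> q /andP[q1 q2]; rewrite !powRN lef_pV2 ?posrE ?powR_gt0//; last lra.
  by rewrite ge0_ler_powR ?nnegrE//; lra.
have fq1 (q : R) : 1 <= q -> q `^ (- (al p)) <= 1.
  move=> q1; rewrite powRN invf_le1 ?powR_gt0//; last lra.
  by rewrite -[leLHS](powRr0 q); apply: ler_powR => //; exact: ltW.
have [c0 [c00 c0k fc0]] : exists c0, [/\ 0 < c0, c0 <= kappa p / 2 &
    forall x g, k / 2 <= x -> g0 <= g -> c0 <= x * g].
  exists (k / 2 * g0); split; first by rewrite mulr_gt0//; lra.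
    by rewrite -kE' -[leRHS]mulr1 ler_wpM2l//; lra.
  by move=> x g hx hg; apply: ler_pM => //; lra.
have [c1 [c1k fc1 c10]] : exists c1, [/\ 2 * kappa p <= c1,
    (forall x g, 0 < x -> x <= 2 * k -> 0 < g -> g <= 2 -> x * g <= c1) & 0 < c1].
  exists (4 * k); split; [by rewrite -kE'; lra| |lra].
  move=> x g x0 hx g0' hg; apply: (@le_trans _ _ (2 * k * 2)); last by lra.
  by apply: ler_pM => //; exact: ltW.
have c01 : c0 <= c1 by lra.
have [C C0 HC] := perturb_controlE hp iota a M mu c00 c01.
have [X [X0 fX]] : exists X, 0 <= X /\ forall v, 0 < v -> v <= c1 -> v `^ (p - 1) <= X.
  exists (c1 `^ (p - 1)); split; first exact: powR_ge0.
  by move=> v v0 v1; rewrite ge0_ler_powR ?nnegrE//; lra.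
have [G [G0 fG]] : exists G : R, 0 <= G /\ forall g, 0 < g -> g <= 2 -> g `^ (p - 1) <= G.
  exists (2 `^ (p - 1)); split; first exact: powR_ge0.
  by move=> v v0 v1; rewrite ge0_ler_powR ?nnegrE//; lra.
have [Lg [Lg0 fLg]] : exists Lg, 0 <= Lg /\ forall g, g0 <= g -> g <= 2 ->
    `|g `^ (p - 1) - 1| <= Lg * `|g - 1|.
  exists (`|p - 1| * (g0 `^ (p - 1 - 1) + 2 `^ (p - 1 - 1))).
  split; first by rewrite mulr_ge0// addr_ge0// powR_ge0.
  move=> g h1 h2; have := @powR_lipschitz _ g 1 (p - 1) g0 2 g00.
  by rewrite powR1; apply; [rewrite h1 h2|rewrite g01 ler1n].
have [Lq [Lq0 fLq]] : exists Lq : R, 0 <= Lq /\ forall q, 1 <= q -> q <= 2 ->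
    `|q `^ (- (al p)) - 1| <= Lq * `|q - 1|.
  exists (`|- (al p)| * (1 + 2 `^ (- (al p) - 1))).
  split; first by rewrite mulr_ge0// addr_ge0// powR_ge0.
  move=> q h1 h2; have := @powR_lipschitz _ q 1 (- (al p)) 1 2 ltr01.
  by rewrite powR1; apply; [rewrite h1 h2|rewrite lexx ler1n].
have C00 := ltW C0; have al00 := ltW al0.
have [K1 K1E K10] : exists2 K1, K1 = p * (X + (al p)) + C & 0 < K1.
  exists (p * (X + (al p)) + C) => //.
  by apply: ltr_wpDl => //; apply: mulr_ge0; [exact: ltW|exact: addr_ge0].
have [K2 K2E K20] : exists2 K2,
    K2 = p * (G * (4 * (1 + (al p)) * C) + (al p) * (Lg * (Lq + 1))) + C & 0 < K2.
  exists (p * (G * (4 * (1 + (al p)) * C) + (al p) * (Lg * (Lq + 1))) + C) => //.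
  apply: ltr_wpDl => //; apply: mulr_ge0; first exact: ltW.
  apply: addr_ge0.
    by apply: mulr_ge0 => //; apply: mulr_ge0 => //; apply: mulr_ge0 => //; exact: addr_ge0.
  by apply: mulr_ge0 => //; apply: mulr_ge0 => //; exact: addr_ge0.
exists (K1 + K2); first by rewrite addr_gt0.
move=> h phi hh hphi; have [s1 [m [s11 hc]]] := HC h hh.
have [s2 s12 H2] := phase_bound hp c0k c1k s11 C0 hc hphi.
have [_ _ _ hb hv] := hc.
exists (s2 + 1); first by clear -s12 s11; lra.
move=> s y hs; have ss2 : s2 < s by clear -hs; lra.
have s1s : s1 <= s by clear -ss2 s12; lra.
have s0 : 1 <= s by clear -s1s s11; lra.
have [/andP[f1 f2] hu] := H2 s ss2; rewrite -kE' in f1 f2.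
have [x xE x0] : exists2 x, x = y ^+ 2 / s & 0 <= x.
  by exists (y ^+ 2 / s) => //; rewrite divr_ge0 ?sqr_ge0//; clear -s0; lra.
have xs : x + s^-1 = (1 + y ^+ 2) / s by rewrite xE mulrDl mul1r addrC.
have [b bE /andP[b0 b1]] : exists2 b, b = (p - 1) / (4 * p) & 0 <= b <= 1.
  exists ((p - 1) / (4 * p)) => //.
  rewrite divr_ge0/=; [|by clear -p1 p0; lra..].
  by rewrite ler_pdivrMr; clear -p1 p0; lra.
have bx0 : 0 <= b * x by rewrite mulr_ge0.
have [q qE q1] : exists2 q, q = 1 + b * x & 1 <= q by exists (1 + b * x) => //; clear -bx0; lra.
have ps : 0 < 2 * p * s by rewrite !mulr_gt0//; clear -s0; lra.
have ips1 : (2 * p * s)^-1 <= s^-1.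
  by rewrite lef_pV2 ?posrE//; clear -s0 hp; nra.
have [ip ipE ips] : exists2 ip, ip = (2 * p * s)^-1 & 0 < ip.
  by exists (2 * p * s)^-1 => //; rewrite invr_gt0.
rewrite -ipE in ips1.
have [g gE gg0] : exists2 g, g = q `^ (- (al p)) + ip & 0 < g.
  by exists (q `^ (- (al p)) + ip) => //; rewrite ltr_wpDl// powR_ge0.
have vE : varphi p phi y s = phi s * g by rewrite (varphiE hp)// gE qE bE xE ipE.
have qa1 := fq1 q q1.
have si1 : s^-1 <= 1 by rewrite invf_le1//; clear -s0; lra.
have si0 : 0 < s^-1 by rewrite invr_gt0; clear -s0; lra.
have g2 : g <= 2 by rewrite gE; clear -qa1 ips1 si1; lra.
have ph0 : 0 < phi s by clear -k0 f1; lra.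
have v0 : 0 < phi s * g by rewrite mulr_gt0.
have v1 : phi s * g <= c1 by apply: fc1.
have vX := fX _ v0 v1.
have vX0 : 0 <= (phi s * g) `^ (p - 1) by exact: powR_ge0.
have T1 := hb s (phi s * g) s1s (introT andP (conj v0 v1)).
have T2 := hv s (phi s * g) s1s.
have YE : (phi s * g) `^ (p - 1) = phi s `^ (p - 1) * g `^ (p - 1).
  by apply: powRM; exact: ltW.
have GpG := fG g gg0 g2.
have Gp0 : 0 <= g `^ (p - 1) by exact: powR_ge0.
have fLg' := fLg g.
rewrite /potential vE.
have y2 := sqr_ge0 y.
move: (iota%:R * _) ((phi s * g) `^ (p - 1)) (g `^ (p - 1)) (phi s `^ (p - 1))
  vX vX0 T1 T2 YE GpG Gp0 fLg' hu => T Y Gp Pp vX vX0 T1 T2 YE GpG Gp0 fLg' hu.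
have B1 : `|p * (Y - (al p)) + T| <= K1.
  apply: le_trans (ler_normD _ _) _; rewrite K1E; apply: lerD => //.
  rewrite normrM (gtr0_norm p0); apply: ler_wpM2l; first exact: ltW.
  by rewrite ler_norml; clear -vX vX0 al0 X0; apply/andP; split; lra.
split; first by apply: le_trans B1 _; rewrite lerDl ltW.
rewrite -xs.
have [x1|x1] := ltP 1 x.
  apply: le_trans B1 _; rewrite -[leLHS]mulr1; clear -K10 K20 x1 si0; apply: ler_pM; lra.
have bxx : b * x <= x by rewrite ler_piMl.
have q2 : q <= 2 by rewrite qE; clear -bxx x1; lra.
have qg0 := fg0 q (introT andP (conj q1 q2)).
have g0g : g0 <= g by rewrite gE; clear -qg0 ips; lra.
have v00 := fc0 _ _ f1 g0g.
have {}T2 := T2 (introT andP (conj v00 v1)).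
have hg : `|Gp - 1| <= Lg * (Lq + 1) * (x + s^-1).
  apply: le_trans (fLg' g0g g2) _; rewrite -mulrA; apply: ler_wpM2l => //.
  have hq := fLq q q1 q2.
  have qx : `|q - 1| = b * x by rewrite qE addrAC subrr add0r ger0_norm.
  rewrite qx in hq.
  have Lqx : Lq * (b * x) <= Lq * x by apply: ler_wpM2l.
  have -> : g - 1 = (q `^ (- (al p)) - 1) + ip by rewrite gE; ring.
  apply: le_trans (ler_normD _ _) _; rewrite (gtr0_norm ips).
  have Ls : 0 <= Lq * s^-1 by apply: mulr_ge0 => //; exact: ltW.
  have -> : (Lq + 1) * (x + s^-1) = Lq * x + Lq * s^-1 + x + s^-1 by ring.
  by clear -hq Lqx Ls ips1 x0; lra.
have -> : p * (Y - (al p)) + T = p * (Gp * (Pp * (1 + m s) - (al p))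
    + (al p) * (Gp - 1)) + (T - p * m s * Y) by rewrite YE; ring.
have xs0 : 0 <= x + s^-1 by clear -x0 si0; lra.
apply: (@le_trans _ _ (K2 * (x + s^-1))); last by apply: ler_wpM2r => //; clear -K10; lra.
apply: le_trans (ler_normD _ _) _; rewrite K2E [leRHS]mulrDl; apply: lerD; last first.
  by apply: le_trans T2 _; apply: ler_wpM2l => //; clear -x0; lra.
rewrite normrM (gtr0_norm p0) -mulrA; apply: ler_wpM2l; first exact: ltW.
apply: le_trans (ler_normD _ _) _; rewrite [leRHS]mulrDl; apply: lerD.
  rewrite normrM (ger0_norm Gp0) -mulrA; apply: ler_pM => //.
  apply: le_trans hu _; apply: ler_wpM2l; last by clear -x0; lra.
  by apply: mulr_ge0 => //; apply: mulr_ge0; clear -al0; lra.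
by rewrite normrM (gtr0_norm al0) -mulrA; apply: ler_wpM2l.
Qed.

End PotentialBound.

(** * Upper barriers around the free evolution of the modes *)

Section Barrier.
Set Implicit Arguments. Unset Strict Implicit.
Context {R : realType}.
Implicit Types (f g : R -> R) (y : R).
Local Notation mu := (@lebesgue_measure R).

Lemma ae_mono (P Q : R -> Prop) : (forall x, P x -> Q x) ->
  {ae mu, forall x, P x} -> {ae mu, forall x, Q x}.
Proof. by move=> h; apply: (@filterS _ _ (ae_filter_ringOfSetsType mu)). Qed.

Lemma ae_all (P : R -> Prop) : (forall x, P x) -> {ae mu, forall x, P x}.
Proof. by move=> h; apply: (@filterE _ _ (ae_filter_ringOfSetsType mu)). Qed.

Lemma ae_and (P Q : R -> Prop) :
  {ae mu, forall x, P x} -> {ae mu, forall x, Q x} -> {ae mu, forall x, P x /\ Q x}.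
Proof. exact: (@filterI _ _ (ae_filter_ringOfSetsType mu)). Qed.

Lemma slabD a b (w ws wy wyy v vs vy vyy : R -> R -> R) :
  smooth_slab a b w ws wy wyy -> smooth_slab a b v vs vy vyy ->
  smooth_slab a b (fun s y => w s y + v s y) (fun s y => ws s y + vs s y)
    (fun s y => wy s y + vy s y) (fun s y => wyy s y + vyy s y).
Proof.
move=> [w1 w2 w3 wc] [v1 v2 v3 vc]; split=> s y sab.
- exact: (dD (w1 s y sab) (v1 s y sab)).
- exact: (dD (w2 s y sab) (v2 s y sab)).
- exact: (dD (w3 s y sab) (v3 s y sab)).
- have [? ? ? ?] := wc s y sab; have [? ? ? ?] := vc s y sab.
  by split; apply: continuousD.
Qed.

Lemma slabN a b (w ws wy wyy : R -> R -> R) : smooth_slab a b w ws wy wyy ->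
  smooth_slab a b (fun s y => - w s y) (fun s y => - ws s y)
    (fun s y => - wy s y) (fun s y => - wyy s y).
Proof.
move=> [w1 w2 w3 wc]; split=> s y sab.
- exact: (dN (w1 s y sab)).
- exact: (dN (w2 s y sab)).
- exact: (dN (w3 s y sab)).
- by have [? ? ? ?] := wc s y sab; split; apply: continuousN.
Qed.

Lemma continuous_of_fst f (q : R * R) : continuous f ->
  {for q, continuous (fun q : R * R => f q.1)}.
Proof. by move=> cf; apply: (@continuous_comp _ _ _ fst f); [exact: cvg_fst|exact: cf]. Qed.

Lemma slab_separate a b (f f' g g' g'' : R -> R) :
  (forall s : R, is_derive s 1 f (f' s)) -> continuous f' ->
  (forall y, is_derive y 1 g (g' y)) -> (forall y, is_derive y 1 g' (g'' y)) ->
  continuous g'' ->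
  smooth_slab a b (fun s y => f s * g y) (fun s y => f' s * g y)
    (fun s y => f s * g' y) (fun s y => f s * g'' y).
Proof.
move=> df cf' dg dg' cg''; split=> s y sab.
- have := dM (df s) (dconst (g y) s); apply: deriv_ext => [//|]; ring.
- exact: dZ.
- exact: dZ.
- have cf := derives_continuous df; have cg := derives_continuous dg.
  have cg' := derives_continuous dg'.
  by split; apply: continuousM; solve [exact: continuous_of_fst|exact: continuous_of_snd].
Qed.

Lemma ereal_integral_le2 (f a b : R -> R) (A B : R) :
  measurable_fun setT f -> measurable_fun setT a -> measurable_fun setT b ->
  (forall y, 0 <= f y) -> (forall y, 0 <= a y) -> (forall y, 0 <= b y) ->
  {ae mu, forall y, f y <= a y + b y} ->
  (\int[mu]_y (a y)%:E <= A%:E)%E -> (\int[mu]_y (b y)%:E <= B%:E)%E ->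
  (\int[mu]_y (f y)%:E <= (A + B)%:E)%E.
Proof.
move=> mf ma mb f0 a0 b0 fab hA hB.
apply: (@le_trans _ _ (\int[mu]_y ((a y)%:E + (b y)%:E))%E).
  apply: ae_ge0_le_integral => //.
  - by move=> y _; rewrite lee_fin.
  - exact/measurable_EFinP.
  - by move=> y _; rewrite adde_ge0// lee_fin.
  - by apply: emeasurable_funD; exact/measurable_EFinP.
  - by apply: ae_mono fab => y h _; rewrite -EFinD lee_fin.
rewrite ge0_integralD//; try (by move=> y _; rewrite lee_fin); try exact/measurable_EFinP.
by rewrite EFinD leeD.
Qed.

Lemma ereal_integral_poly k : exists2 C : R, 0 < C & forall f c,
  measurable_fun setT f -> 0 <= c -> (forall y, `|f y| <= c * (1 + y ^+ 2) ^+ k) ->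
  (\int[mu]_y (f y * rho y)%:E <= (C * c)%:E)%E.
Proof.
have [C C0 H] := @gauss_moment_poly R k; exists C => // f c mf c0 fc.
have [i h] := H f c mf c0 fc.
have := le_trans (ler_norm _) h; rewrite /Rintegral -lee_fin fineK//.
exact: (integrable_fin_num measurableT i).
Qed.

Lemma expR_sub1_le (x t : R) : 0 <= x <= t -> expR x - 1 <= x * expR t.
Proof.
move=> /andP[x0 xt]; have h := expR_ge1Dx (- x); have e0 := expR_gt0 x.
have : expR x <= expR t by rewrite ler_expR.
have : expR x * expR (- x) = 1 by rewrite -expRD subrr expR0.
by nra.
Qed.

Section Modes.
Variables (sigma c0 c1 c2 : R).

(** The evolution of the first three modes under [L] alone. *)
Definition free_flow (s y : R) : R :=
  c0 * expR (s - sigma) + c1 * expR ((s - sigma) / 2) * y + c2 * (y ^+ 2 - 2).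

Let d0 (s : R) : is_derive s 1 (fun s => c0 * expR (s - sigma)) (c0 * expR (s - sigma)).
Proof.
have := dZ (dexp (dB (did s) (dconst sigma s))) c0.
by apply: deriv_ext => [//|]; ring.
Qed.

Let d1 (s : R) : is_derive s 1 (fun s => c1 * expR ((s - sigma) / 2))
  (c1 * expR ((s - sigma) / 2) / 2).
Proof.
have := dZ (dexp (dM (dB (did s) (dconst sigma s)) (dconst (2^-1) s))) c1.
by apply: deriv_ext => [//|]; ring.
Qed.

Lemma slab_free_flow a b : smooth_slab a b free_flow
  (fun s y => c0 * expR (s - sigma) + c1 * expR ((s - sigma) / 2) / 2 * y)
  (fun s y => c1 * expR ((s - sigma) / 2) + 2 * c2 * y) (fun s y => 2 * c2).
Proof.
have c0' : continuous (fun s : R => c0 * expR (s - sigma)) by exact: derives_continuous d0.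
have c1' : continuous (fun s : R => c1 * expR ((s - sigma) / 2) / 2).
  by cont.
have s2 := slab_separate a b (fun s => dconst c2 s) (@cC _ 0)
  (fun y => dB (dX (did y) 2) (dconst 2 y))
  (fun y => dB (dM (dZ (dX (did y) 1) 2) (dconst 1 y)) (dconst 0 y)).
have {}s2 := s2 ltac:(by cont).
have := slabD (slabD
  (slab_separate a b d0 c0' (fun y => dconst 1 y) (fun y => dconst 0 y) (@cC _ 0))
  (slab_separate a b d1 c1' (fun y => did y) (fun y => dconst 1 y) (@cC _ 0))) s2.
by congr smooth_slab; apply/funext => s; apply/funext => y /=; rewrite /free_flow; ring.
Qed.

Lemma free_flow_le (T : R) : exists2 C : R, 0 <= C & forall s y, sigma <= s <= T ->
  `|free_flow s y| <= C * (1 + y ^+ 2).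
Proof.
pose e := expR (T - sigma).
exists (`|c0| * e + `|c1| * e + 2 * `|c2|).
  by rewrite !addr_ge0// !mulr_ge0// expR_ge0.
move=> s y /andP[s1 s2]; have y2 := sqr_ge0 y.
have h0 : 0 <= expR (s - sigma) <= e by rewrite expR_ge0 ler_expR; lra.
have h1 : 0 <= expR ((s - sigma) / 2) <= e by rewrite expR_ge0 ler_expR; lra.
case/andP: h0 => h0 h0'; case/andP: h1 => h1 h1'.
rewrite /free_flow [leRHS]mulrDl [X in _ <= X + _]mulrDl; apply: le_trans (ler_normD _ _) _; apply: lerD; last first.
  rewrite normrM (_ : 2 * `|c2| * _ = `|c2| * (2 * (1 + y ^+ 2))); last by ring.
  rewrite ler_wpM2l//.
  by rewrite ler_norml; apply/andP; split; nra.
apply: le_trans (ler_normD _ _) _; apply: lerD.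
  rewrite normrM (ger0_norm h0) -mulrA ler_wpM2l//; nra.
rewrite !normrM (ger0_norm h1) -!mulrA ler_wpM2l//; apply: ler_pM => //.
by rewrite ler_norml; apply/andP; split; nra.
Qed.

Lemma free_flow_sub_le (T : R) : exists2 C : R, 0 <= C & forall s y, sigma <= s <= T ->
  `|free_flow s y - free_flow sigma y| <= C * (s - sigma) * (1 + y ^+ 2).
Proof.
pose e := expR (T - sigma).
exists (`|c0| * e + `|c1| * e); first by rewrite !addr_ge0// !mulr_ge0// expR_ge0.
move=> s y /andP[s1 s2]; have y2 := sqr_ge0 y.
have e0 : 0 < e by exact: expR_gt0.
have h0 := @expR_sub1_le (s - sigma) (T - sigma) ltac:(by apply/andP; split; lra).
have h1 := @expR_sub1_le ((s - sigma) / 2) (T - sigma) ltac:(by apply/andP; split; lra).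
have g0 : 1 <= expR (s - sigma) by rewrite -[leLHS]expR0 ler_expR; lra.
have g1 : 1 <= expR ((s - sigma) / 2) by rewrite -[leLHS]expR0 ler_expR; lra.
rewrite -/e in h0 h1.
rewrite (_ : free_flow s y - free_flow sigma y = c0 * (expR (s - sigma) - 1)
  + c1 * ((expR ((s - sigma) / 2) - 1) * y)); last first.
  by rewrite /free_flow subrr mul0r expR0; ring.
rewrite [X in _ <= X * _]mulrDl [leRHS]mulrDl.
apply: le_trans (ler_normD _ _) _; apply: lerD.
  rewrite normrM -!mulrA ler_wpM2l// ger0_norm; last lra.
  by nra.
rewrite normrM -!mulrA ler_wpM2l// normrM ger0_norm; last lra.
rewrite mulrA; apply: ler_pM => //; [lra|nra|].
by rewrite ler_norml; apply/andP; split; nra.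
Qed.

End Modes.

Section Upper.
Variables (sigma T Cv cG D E N c0 c1 c2 : R) (th ths thy thyy V : R -> R -> R).
Variables (psi G G1 G2 : R -> R).
Hypothesis sT : sigma < T.
Hypothesis sm : smooth_slab sigma T th ths thy thyy.
Hypothesis eqn : forall s y, sigma < s < T ->
  ths s y = thyy s y - y / 2 * thy s y + th s y + V y s * th s y.
Hypothesis Vb : forall s y, sigma < s < T -> `|V y s| <= Cv.
Hypothesis mpsi : measurable_fun setT psi.
Hypothesis N0 : 0 <= N.
Hypothesis L2 : forall s, sigma < s < T -> (\int[mu]_y (th s y ^+ 2 * rho y)%:E <= N%:E)%E.
Hypothesis init : forall e, 0 < e -> exists2 d, 0 < d & forall t,
  sigma < t < sigma + d -> t < T ->
  (\int[mu]_y ((th t y - psi y) ^+ 2 * rho y)%:E <= e%:E)%E.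
Hypotheses (dG : forall y, is_derive y 1 G (G1 y))
  (dG1 : forall y, is_derive y 1 G1 (G2 y)) (cG2 : continuous G2).
Hypothesis G0 : forall y, 0 <= G y.
Hypothesis LG : forall y, G2 y - y / 2 * G1 y + G y <= cG * G y.
Hypotheses (cG0 : 0 <= cG) (Cv0 : 0 <= Cv) (D0 : 0 <= D) (E0 : 0 <= E).
Hypothesis psi_le : {ae mu, forall y, psi y - free_flow sigma c0 c1 c2 sigma y <= D * G y}.
Hypothesis src : forall s y, sigma < s < T ->
  `|V y s * free_flow sigma c0 c1 c2 s y| <= E * G y.

(** The amplitude of the barrier solves [amp' >= (cG + Cv) amp + E]: growth of
    the weight under [L + V] plus the source created by the potential acting on
    the free evolution. *)
Definition amp (s : R) : R := (D + E * (s - sigma)) * expR ((cG + Cv) * (s - sigma)).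

Let amp' (s : R) : R := E * expR ((cG + Cv) * (s - sigma)) + (cG + Cv) * amp s.

Let damp (s : R) : is_derive s 1 amp (amp' s).
Proof.
have := dM (dD (dconst D s) (dZ (dB (did s) (dconst sigma s)) E))
  (dexp (dZ (dB (did s) (dconst sigma s)) (cG + Cv))).
by apply: deriv_ext => [//|]; rewrite /amp' /amp; ring.
Qed.

Let k0 : 0 <= cG + Cv. Proof. exact: addr_ge0. Qed.

Let amp_ge s : sigma <= s -> D <= amp s.
Proof.
move=> h; have h' : 0 <= s - sigma by lra.
rewrite /amp -[leLHS]mulr1; apply: ler_pM => //.
  by rewrite lerDl mulr_ge0.
by rewrite -expR0 ler_expR mulr_ge0.
Qed.

Let w s y := th s y + - (free_flow sigma c0 c1 c2 s y + amp s * G y).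

(** The difference [w = th - free_flow - amp G] is a subsolution where it is
    positive, starts below zero almost everywhere, and is dominated in
    [L^2_rho] by [th] and [free_flow] because [G] enters with the favourable
    sign: no integrability of [G] is involved. *)
Lemma upper_barrier s y : sigma < s < T -> th s y <= free_flow sigma c0 c1 c2 s y + amp s * G y.
Proof.
have [sT' cG0' Cv0' D0' E0'] := And5 sT cG0 Cv0 D0 E0.
have N0' := N0.
have camp' : continuous amp'.
  have h := derives_continuous damp.
  have h' : continuous (fun s : R => expR ((cG + Cv) * (s - sigma))).
    by apply: derives_continuous => t; exact: (dexp (dZ (dB (did t) (dconst sigma t)) (cG + Cv))).
  by rewrite /amp'; cont.
have swW := slabD sm (slabN (slabD (slab_free_flow sigma c0 c1 c2 sigma T)
  (slab_separate sigma T damp camp' dG dG1 cG2))).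
suff : forall s y, sigma < s < T -> w s y <= 0 by move=> h sI; rewrite -subr_le0; exact: h.
have [CF CF0 FB] := free_flow_le sigma c0 c1 c2 T.
have [CS CS0 FS] := free_flow_sub_le sigma c0 c1 c2 T.
have [Q Q0 HQ] := ereal_integral_poly 2.
have cw t : sigma < t < T -> continuous (w t).
  by move=> tI x; apply: derive_cont; exact: (slab_dy swW x tI).
have mw t : sigma < t < T -> measurable_fun setT (fun y => pos (w t y) ^+ 2 * rho y).
  move=> tI; apply: continuous_measurable_fun.
  have cp : continuous (fun y => pos (w t y)).
    by move=> x; apply: (@continuous_comp _ _ _ (w t) pos);
      [exact: cw|exact: continuous_pos].
  have cr : continuous (@rho R) := @continuous_rho R.
  by cont.
have mth t : sigma < t < T -> measurable_fun setT (th t).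
  move=> tI; apply: continuous_measurable_fun => x.
  exact: (derive_cont (slab_dy sm x tI)).
have mfr t : measurable_fun setT (free_flow sigma c0 c1 c2 t).
  by apply: continuous_measurable_fun; rewrite /free_flow; cont.
have r0 x := rho_gt0 (R := R) x.
have pw_ge0 t x : 0 <= pos (w t x) ^+ 2 * rho x.
  by rewrite mulr_ge0 ?sqr_ge0// ltW.
have free2 (f : R -> R) c : measurable_fun setT f -> 0 <= c ->
    (forall y, `|f y| <= c * (1 + y ^+ 2)) ->
    (\int[mu]_y (2 * f y ^+ 2 * rho y)%:E <= (Q * (2 * c ^+ 2))%:E)%E.
  move=> mf c0' fc; apply: HQ.
  - by apply: measurable_funM => //; exact: measurable_funX.
  - by rewrite mulr_ge0// sqr_ge0.
  - move=> x; rewrite normrM (@ger0_norm _ 2)// -mulrA ler_wpM2l// normrX -exprMn.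
    by rewrite lerXn2r ?nnegrE ?fc// mulr_ge0// addr_ge0// sqr_ge0.
have sqr2 (f : R -> R) (A : R) : measurable_fun setT f ->
    (\int[mu]_y (f y ^+ 2 * rho y)%:E <= A%:E)%E ->
    (\int[mu]_y (2 * f y ^+ 2 * rho y)%:E <= (2 * A)%:E)%E.
  move=> mf h; under eq_integral => x _ do rewrite -mulrA EFinM.
  rewrite ge0_integralZl//; last 2 first.
  - apply/measurable_EFinP/measurable_funM; first exact: measurable_funX.
    exact: measurable_rho.
  - by move=> x _; rewrite lee_fin mulr_ge0 ?sqr_ge0// ltW.
  by rewrite EFinM lee_wpmul2l.
have msq (f : R -> R) : measurable_fun setT f ->
    measurable_fun setT (fun y => 2 * f y ^+ 2 * rho y).
  move=> mf; apply: measurable_funM; last exact: measurable_rho.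
  by apply: measurable_funM => //; exact: measurable_funX.
have sq0 (f : R -> R) x : 0 <= 2 * f x ^+ 2 * rho x.
  by apply: mulr_ge0; [apply: mulr_ge0 => //; exact: sqr_ge0|exact: ltW].
have pos_sq (a' b' : R) x : w a' x <= b' -> pos (w a' x) <= `|b'|.
  move=> h; rewrite /pos ge_max normr_ge0 andbT; apply: le_trans h (ler_norm _).
have sq_add (a' b' z : R) x : 0 <= z <= `|a' + b'| -> z ^+ 2 * rho x <=
    2 * a' ^+ 2 * rho x + 2 * b' ^+ 2 * rho x.
  move=> /andP[z0 zab]; rewrite -mulrDl ler_wpM2r ?(ltW (r0 _))//.
  have : z ^+ 2 <= (a' + b') ^+ 2.
    by rewrite -(real_normK (num_real (a' + b'))) lerXn2r ?nnegrE.
  by have := sqr_ge0 (a' - b'); nra.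
apply: (@comparison _ sigma T (1 + Cv) _ _ _ _ swW _ _ (2 * N + Q * (2 * CF ^+ 2))).
- lra.
- move=> t x tI /= w0; have /andP[t1 t2] := tI.
  have st : 0 <= t - sigma by lra.
  rewrite eqn//; set e := expR ((cG + Cv) * (t - sigma)).
  have e1 : 1 <= e by rewrite -expR0 ler_expR mulr_ge0.
  have a0 : 0 <= amp t by apply: le_trans (amp_ge (ltW t1)).
  have hV := Vb x tI; have hS := src x tI.
  set H := free_flow sigma c0 c1 c2 t x in w0 hS *.
  set g := G x; set v := V x t in hV hS *; set A := amp t in a0 *.
  have g0 : 0 <= g by exact: G0.
  have lg := LG x; rewrite -/g in lg.
  rewrite /amp' -/A -/e.
  set X := th t x in w0 *.
  have w0' : 0 < X - (H + A * g) by [].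
  have k1 : v * (X - (H + A * g)) <= Cv * (X - (H + A * g)).
    by rewrite ler_wpM2r ?(ltW w0')//; apply: le_trans (ler_norm _) hV.
  have k2 : v * H <= E * g by apply: le_trans (ler_norm _) hS.
  have k3 : v * (A * g) <= Cv * (A * g).
    by apply: ler_wpM2r; [exact: mulr_ge0|exact: le_trans (ler_norm _) hV].
  have k4 : A * (G2 x - x / 2 * G1 x + g) <= A * (cG * g) by rewrite ler_wpM2l.
  have k5 : E * g <= E * e * g by rewrite ler_wpM2r// -[leLHS]mulr1 ler_wpM2l.
  have HE : H = c0 * expR (t - sigma) + c1 * expR ((t - sigma) / 2) * x + c2 * (x ^+ 2 - 2).
    by [].
  rewrite -subr_ge0.
  apply: (@le_trans _ _ ((Cv * (X - (H + A * g)) - v * (X - (H + A * g)))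
    + (E * g - v * H) + (Cv * (A * g) - v * (A * g))
    + (A * (cG * g) - A * (G2 x - x / 2 * G1 x + g)) + (E * e * g - E * g))).
    by lra.
  rewrite le_eqVlt; apply/orP; left; apply/eqP.
  by move: HE; move: (expR _) (expR (_ / 2)) => ea eb ->; field.
- by rewrite addr_ge0 ?mulr_ge0 ?sqr_ge0// ltW.
- move=> t tI; have /andP[t1 t2] := tI.
  apply: (@ereal_integral_le2 _ (fun y => 2 * th t y ^+ 2 * rho y)
    (fun y => 2 * (free_flow sigma c0 c1 c2 t y) ^+ 2 * rho y)) => //.
  + exact: mw.
  + by apply: msq; exact: mth.
  + exact: msq.
  + by move=> x; exact: pw_ge0.
  + apply: ae_all => x; rewrite -(sqrrN (free_flow _ _ _ _ _ _)); apply: sq_add.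
    rewrite pos_ge0 /=; apply: pos_sq; rewrite /w opprD addrA gerBl.
    by rewrite mulr_ge0//; apply: le_trans (amp_ge (ltW t1)).
  + by apply: sqr2; [exact: mth|exact: L2].
  + apply: free2 => // x; apply: FB; apply/andP; split; lra.
- move=> e e0; have [d d0 hd] := init (e := e / 4) ltac:(lra).
  pose K := Q * (2 * CS ^+ 2) + 1.
  have K0 : 0 < K by rewrite ltr_wpDl// !mulr_ge0 ?sqr_ge0// ltW.
  pose d' := Num.min d (Num.min 1 (e / 2 / K)).
  have d'0 : 0 < d' by rewrite !lt_min d0 ltr01 /= divr_gt0//; lra.
  exists d' => // t /andP[t1 t2] tT.
  have tI : sigma < t < T by apply/andP.
  have [td tK t01] : [/\ t < sigma + d, (t - sigma) * K <= e / 2 & t - sigma <= 1].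
    have : t - sigma < d' by lra.
    rewrite !lt_min => /and3P[? ? ?]; split; [lra| |lra].
    by rewrite -ler_pdivlMr// ltW.
  have hi := hd t ltac:(by apply/andP) tT.
  have tt0 : 0 < t - sigma by lra.
  apply: (@le_trans _ _ ((2 * (e / 4) + Q * (2 * (CS * (t - sigma)) ^+ 2))%:E)); last first.
    rewrite lee_fin (_ : Q * _ = (Q * (2 * CS ^+ 2)) * (t - sigma) * (t - sigma)); last by ring.
    have : Q * (2 * CS ^+ 2) * (t - sigma) <= e / 2.
      apply: le_trans tK; rewrite mulrC ler_wpM2l//; [exact: ltW|rewrite /K; lra].
    have : 0 <= Q * (2 * CS ^+ 2) * (t - sigma).
      by rewrite !mulr_ge0 ?sqr_ge0// ltW.
    by nra.
  apply: (@ereal_integral_le2 _ (fun y => 2 * (th t y - psi y) ^+ 2 * rho y)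
    (fun y => 2 * (free_flow sigma c0 c1 c2 sigma y - free_flow sigma c0 c1 c2 t y) ^+ 2 * rho y)) => //.
  + exact: mw.
  + by apply: msq; apply: measurable_funB => //; exact: mth.
  + by apply: msq; exact: measurable_funB.
  + by move=> x; exact: pw_ge0.
  + by move=> x; exact: (sq0 (fun z => th t z - psi z)).
  + move=> x; exact: (sq0 (fun z => free_flow sigma c0 c1 c2 sigma z - free_flow sigma c0 c1 c2 t z)).
  + apply: ae_mono psi_le => x hx; apply: sq_add.
    rewrite pos_ge0 /=; apply: pos_sq; rewrite /w.
    have : D * G x <= amp t * G x by rewrite ler_wpM2r ?G0// amp_ge// ltW.
    by lra.
  + by apply: sqr2 => //; apply: measurable_funB => //; exact: mth.
  + apply: free2; first exact: measurable_funB.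
      by rewrite mulr_ge0// ltW.
    by move=> x; rewrite distrC; apply: FS; apply/andP; split; lra.
Qed.

End Upper.
End Barrier.

(** * Barriers for the fundamental solution *)

Section Solution.
Set Implicit Arguments. Unset Strict Implicit.
Context {R : realType}.
Implicit Types (f g : R -> R) (y : R).
Local Notation mu := (@lebesgue_measure R).

Section Flow.
Variables (V : R -> R -> R) (sigma : R) (K : R -> R -> (R -> R) -> (R -> R)).
Variable psi : R -> R.
Hypothesis hK : fundamental_solution V sigma K.
Hypothesis hpsi : in_L2rho psi.

Local Notation th := (fun s => K s sigma psi).

Lemma flow_init : K sigma sigma psi = psi.
Proof. by have [] := hK hpsi. Qed.

Lemma flow_slab T : smooth_slab sigma T th
  (fun s y => derive1 (fun t => K t sigma psi y) s)
  (fun s y => derive1 (K s sigma psi) y) (fun s y => derive1n 2 (K s sigma psi) y).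
Proof.
have [_ _ _ cl] := hK hpsi.
split=> s y /andP[ss _]; have [d1 d2 d3 [c1 c2 c3 c4] _] := cl s y ss.
- exact: deriv1_is.
- exact: deriv1_is.
- exact: (deriv1_is d3).
- exact: And4 c1 c2 c3 c4.
Qed.

Lemma flow_eqn s y : sigma < s ->
  derive1 (fun t => K t sigma psi y) s =
  derive1n 2 (K s sigma psi) y - y / 2 * derive1 (K s sigma psi) y
    + K s sigma psi y + V y s * K s sigma psi y.
Proof. by have [_ _ _ cl] := hK hpsi => ss; have [_ _ _ _ ->] := cl s y ss. Qed.

Lemma flow_continuous s (e : R) : sigma <= s -> 0 < e ->
  exists2 d, 0 < d & forall t, sigma <= t -> s - d < t < s + d ->
  (\int[mu]_y ((K t sigma psi y - K s sigma psi y) ^+ 2 * rho y)%:E <= e%:E)%E.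
Proof.
move=> ss e0; have [_ _ /(_ s ss) h _] := hK hpsi.
have /h := @nbhs_open_ereal_lt _ 0 (fun=> e) e0.
move=> /nbhs_ballP[d /= d0 hd]; exists d => // t st /andP[t1 t2].
apply: ltW; apply: hd => //=; rewrite /ball /= ltr_norml; apply/andP; split; lra.
Qed.

Lemma flow_L2 s : sigma <= s -> in_L2rho (K s sigma psi).
Proof. by have [_ h _ _] := hK hpsi; exact: h. Qed.

(** Continuity in time with values in [L^2_rho], and compactness of
    [[sigma, T]]. *)
Lemma flow_L2_bounded T : exists2 N, 0 <= N & forall s, sigma <= s <= T ->
  (\int[mu]_y (K s sigma psi y ^+ 2 * rho y)%:E <= N%:E)%E.
Proof.
pose P (N s : R) : Prop := sigma <= s <= T ->
  (\int[mu]_y (K s sigma psi y ^+ 2 * rho y)%:E <= N%:E)%E.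
have cov := (compact_near_coveringP _).1 (@segment_compact R sigma T).
have /(_ _) := cov R (pinfty_nbhs R) P _.
have loc x : `[sigma, T]%classic x ->
    \forall x' \near x & i \near (pinfty_nbhs R), P i x'.
  rewrite /= in_itv /= => /andP[x1 x2].
  have [mx ix] := flow_L2 x1.
  pose A := fine (\int[mu]_y (K x sigma psi y ^+ 2 * rho y)%:E)%E.
  have A_ge0 : (0 <= \int[mu]_y (K x sigma psi y ^+ 2 * rho y)%:E)%E.
    by apply: integral_ge0 => y _; rewrite lee_fin mulr_ge0 ?sqr_ge0// ltW// rho_gt0.
  have AE : (\int[mu]_y (K x sigma psi y ^+ 2 * rho y)%:E)%E = A%:E.
    by rewrite /A fineK// ge0_fin_numE.
  have [d d0 hd] := flow_continuous x1 ltr01.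
  exists (ball x d, [set i | 2 * 1 + 2 * A < i]) => /=.
    split; first exact: nbhsx_ballx.
    by apply: nbhs_pinfty_gt; rewrite num_real.
  move=> -[t i] /= [xt Ai] /andP[t1 t2].
  have xt' : x - d < t < x + d.
    by move: xt; rewrite /ball /= ltr_norml => /andP[? ?]; apply/andP; split; lra.
  have ht := hd t t1 xt'.
  apply: (@le_trans _ _ (2 * 1 + 2 * A)%:E); last by rewrite lee_fin ltW.
  have [mt _] := flow_L2 t1.
  have mr : measurable_fun setT (@rho R) := measurable_rho.
  have dbl (f : R -> R) (B : R) : measurable_fun setT f ->
      (\int[mu]_y (f y ^+ 2 * rho y)%:E <= B%:E)%E ->
      (\int[mu]_y (2 * (f y ^+ 2 * rho y))%:E <= (2 * B)%:E)%E.
    move=> mf h; under eq_integral => z _ do rewrite EFinM.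
    rewrite ge0_integralZl//.
    - by rewrite EFinM lee_wpmul2l.
    - by apply/measurable_EFinP/measurable_funM => //; exact: measurable_funX.
    - by move=> z _; rewrite lee_fin mulr_ge0 ?sqr_ge0// ltW// rho_gt0.
  apply: (@ereal_integral_le2 _ _
    (fun y => 2 * ((K t sigma psi y - K x sigma psi y) ^+ 2 * rho y))
    (fun y => 2 * (K x sigma psi y ^+ 2 * rho y))).
  - by apply: measurable_funM => //; exact: measurable_funX.
  - apply: measurable_funM => //; apply: measurable_funM => //.
    by apply: measurable_funX; exact: measurable_funB.
  - apply: measurable_funM => //; apply: measurable_funM => //.
    exact: measurable_funX.
  - by move=> y; rewrite mulr_ge0 ?sqr_ge0// ltW// rho_gt0.
  - by move=> y; apply: mulr_ge0 => //; rewrite mulr_ge0 ?sqr_ge0// ltW// rho_gt0.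
  - by move=> y; apply: mulr_ge0 => //; rewrite mulr_ge0 ?sqr_ge0// ltW// rho_gt0.
  - apply: ae_all => y; rewrite -mulrDr -mulrDl mulrA ler_wpM2r//.
      by rewrite ltW// rho_gt0.
    by have := sqr_ge0 (K t sigma psi y - 2 * K x sigma psi y); nra.
  - apply: dbl => //; exact: measurable_funB.
  - by apply: dbl => //; rewrite AE.
move=> /(_ loc) [N0 [_ hN]].
exists (Num.max (N0 + 1) 0); first by rewrite le_max lexx orbT.
move=> s sI; have N1 : N0 < Num.max (N0 + 1) 0 by rewrite lt_max; apply/orP; left; lra.
by apply: (hN _ N1 s) => //=; rewrite in_itv.
Qed.

(** The opposite of a solution is again a solution, so the upper barrier applies
    to both.  Each of the three estimates is an instance, with its own weight
    [G] and its own choice of the modes that are followed exactly. *)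
Lemma flow_barrier (T Cv cG D E c0 c1 c2 : R) (G G1 G2 : R -> R) :
  sigma < T ->
  (forall s y, sigma < s < T -> `|V y s| <= Cv) ->
  (forall y, is_derive y 1 G (G1 y)) -> (forall y, is_derive y 1 G1 (G2 y)) ->
  continuous G2 -> (forall y, 0 <= G y) ->
  (forall y, G2 y - y / 2 * G1 y + G y <= cG * G y) ->
  0 <= cG -> 0 <= Cv -> 0 <= D -> 0 <= E ->
  {ae mu, forall y, `|psi y - free_flow sigma c0 c1 c2 sigma y| <= D * G y} ->
  (forall s y, sigma < s < T -> `|V y s * free_flow sigma c0 c1 c2 s y| <= E * G y) ->
  forall s y, sigma < s < T ->
  `|K s sigma psi y - free_flow sigma c0 c1 c2 s y| <=
    (D + E * (T - sigma)) * expR ((cG + Cv) * (T - sigma)) * G y.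
Proof.
move=> sT Vb dG dG1 cG2 G0 LG cG0 Cv0 D0 E0 hD hE s y sI.
have [N N0 hN] := flow_L2_bounded T.
have hN' t : sigma < t < T -> (\int[mu]_y (K t sigma psi y ^+ 2 * rho y)%:E <= N%:E)%E.
  by move=> /andP[? ?]; apply: hN; apply/andP; split; lra.
have init e : 0 < e -> exists2 d, 0 < d & forall t,
  sigma < t < sigma + d -> t < T ->
  (\int[mu]_y ((K t sigma psi y - psi y) ^+ 2 * rho y)%:E <= e%:E)%E.
  move=> e0; have [d d0 hd] := flow_continuous (lexx sigma) e0; exists d => // t /andP[t1 t2] tT.
  by have := hd t (ltW t1); rewrite flow_init; apply; apply/andP; split; lra.
have [mpsi _] := hpsi.
have eqn t x : sigma < t < T -> derive1 (fun t => K t sigma psi x) t =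
  derive1n 2 (K t sigma psi) x - x / 2 * derive1 (K t sigma psi) x
    + K t sigma psi x + V x t * K t sigma psi x.
  by move=> /andP[t1 _]; exact: flow_eqn.
have freeN t x : free_flow sigma (- c0) (- c1) (- c2) t x = - free_flow sigma c0 c1 c2 t x.
  by rewrite /free_flow; ring.
have up := @upper_barrier R sigma T Cv cG D E N c0 c1 c2 _ _ _ _ V psi G G1 G2
  sT (flow_slab T) eqn Vb mpsi N0 hN' init dG dG1 cG2 G0 LG cG0 Cv0 D0 E0
  (ae_mono (fun x h => le_trans (ler_norm _) h) hD) hE s y sI.
have eqnN t x : sigma < t < T -> - derive1 (fun t => K t sigma psi x) t =
  - derive1n 2 (K t sigma psi) x - x / 2 * (- derive1 (K t sigma psi) x)
    + (- K t sigma psi x) + V x t * (- K t sigma psi x).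
  by move=> tI; rewrite eqn//; ring.
have hNN t : sigma < t < T -> (\int[mu]_y ((- K t sigma psi y) ^+ 2 * rho y)%:E <= N%:E)%E.
  by move=> tI; under eq_integral do rewrite sqrrN; exact: hN'.
have initN e : 0 < e -> exists2 d, 0 < d & forall t,
  sigma < t < sigma + d -> t < T ->
  (\int[mu]_y ((- K t sigma psi y - - psi y) ^+ 2 * rho y)%:E <= e%:E)%E.
  move=> e0; have [d d0 hd] := init e e0; exists d => // t tI tT.
  by under eq_integral do rewrite -opprD sqrrN; exact: hd.
have hDN : {ae mu, forall y, - psi y - free_flow sigma (- c0) (- c1) (- c2) sigma y <= D * G y}.
  apply: ae_mono hD => x h; rewrite freeN -opprD; apply: le_trans (ler_norm _) _.
  by rewrite normrN.
have hEN t x : sigma < t < T ->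
    `|V x t * free_flow sigma (- c0) (- c1) (- c2) t x| <= E * G x.
  by move=> tI; rewrite freeN mulrN normrN; exact: hE.
have mN : measurable_fun setT (fun y => - psi y) by exact: measurable_funN.
have lo := @upper_barrier R sigma T Cv cG D E N (- c0) (- c1) (- c2) _ _ _ _ V
  (fun y => - psi y) G G1 G2
  sT (slabN (flow_slab T)) eqnN Vb mN N0 hNN initN dG dG1 cG2 G0 LG cG0 Cv0 D0 E0
  hDN hEN s y sI.
have /andP[s1 s2] := sI.
have a1 : amp sigma Cv cG D E s <= (D + E * (T - sigma)) * expR ((cG + Cv) * (T - sigma)).
  have k : 0 <= cG + Cv by rewrite addr_ge0.
  rewrite /amp; apply: ler_pM.
  - by rewrite addr_ge0// mulr_ge0//; lra.
  - exact: expR_ge0.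
  - by rewrite lerD2l ler_wpM2l//; lra.
  - by rewrite ler_expR ler_wpM2l//; lra.
have a2 : amp sigma Cv cG D E s * G y <=
  (D + E * (T - sigma)) * expR ((cG + Cv) * (T - sigma)) * G y by rewrite ler_wpM2r.
rewrite freeN in lo.
by rewrite ler_norml; apply/andP; split; lra.
Qed.

End Flow.
End Solution.

(** * The cut-off as a smooth function on the line *)

Section Cutoff.
Set Implicit Arguments. Unset Strict Implicit.
Context {R : realType}.
Variable chi0 : R -> R.
Hypothesis hchi : cutoff_profile chi0.

(** The derivatives of the even function [z |-> chi0 |z|]. The values of
    [chi0] and of its derivatives at the origin and on the negative axis are
    not constrained, hence the case distinction. *)
Definition cut (n : nat) (z : R) : R :=
  if `|z| < 1 / 2 then (n == 0%N)%:R
  else if 0 < z then derive1n n chi0 z else (-1) ^+ n * derive1n n chi0 (- z).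

Lemma is_derive_chi0 n (x : R) : 0 < x ->
  is_derive x 1 (derive1n n chi0) (derive1n n.+1 chi0 x).
Proof. by move=> x0; have [h _ _] := hchi; rewrite derive1nS; exact: deriv1_is (h n x x0). Qed.

Lemma chi0_inner n x : 0 < x < 1 -> derive1n n chi0 x = (n == 0%N)%:R.
Proof.
have [_ _ h1] := hchi; elim: n x => [|n IH] x x01.
  by rewrite derive1n0; apply: h1; case/andP: x01 => ? ?; apply/andP; split; exact: ltW.
rewrite derive1nS /=; apply: is_derive1E.
apply: (near_eq_is_derive (f := cst ((n == 0%N)%:R : R))).
by apply: (near_id x01) => t /IH.
Qed.

Lemma chi0_outer n x : 2 < x -> derive1n n chi0 x = 0.
Proof.
have [_ h2 _] := hchi; elim: n x => [|n IH] x x2; first exact: h2.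
rewrite derive1nS; apply: is_derive1E.
apply: (near_eq_is_derive (f := cst (0 : R))).
have xI : 2 < x < x + 1 by apply/andP; split; lra.
by apply: (near_id xI) => t /andP[/IH].
Qed.

Lemma cut0E z : cut 0 z = chi0 `|z|.
Proof.
rewrite /cut; case: ltP => z1.
  have [_ _ h1] := hchi; rewrite h1//; apply/andP; split => //; lra.
case: ltP => z0; first by rewrite gtr0_norm.
by rewrite expr0 mul1r ler0_norm.
Qed.

Lemma cut_inner n z : `|z| < 1 -> cut n z = (n == 0%N)%:R.
Proof.
move=> z1; rewrite /cut; case: ltP => // z2; have [z0|z0] := ltP 0 z.
  by rewrite chi0_inner//; move: z1; rewrite gtr0_norm// => ->; rewrite z0.
have nz : - z = `|z| by rewrite ler0_norm.
rewrite nz chi0_inner//; last by apply/andP; split => //; lra.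
by case: n => [|n]; rewrite ?expr0 ?mulr1// mulr0.
Qed.

Lemma cut_outer n z : 2 < `|z| -> cut n z = 0.
Proof.
move=> z2; rewrite /cut; case: ltP => [z1|_]; first lra.
have [z0|z0] := ltP 0 z; first by rewrite chi0_outer//; move: z2; rewrite gtr0_norm.
by rewrite chi0_outer ?mulr0//; move: z2; rewrite ler0_norm.
Qed.

Lemma is_derive_cut n (z : R) : is_derive z 1 (cut n) (cut n.+1 z).
Proof.
have [z1|z1] := ltP `|z| 1.
  rewrite cut_inner// /=; apply: (near_eq_is_derive (f := cst ((n == 0%N)%:R : R))).
  have zI : -1 < z < 1 by rewrite -ltr_norml.
  by apply: (near_id zI) => t; rewrite -ltr_norml => /cut_inner ->.
have [z0|z0] := ltP 0 z.
  have z1' : 1 <= z by move: z1; rewrite gtr0_norm.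
  have -> : cut n.+1 z = derive1n n.+1 chi0 z.
    by rewrite /cut z0; case: ltP => // h; lra.
  apply: (near_eq_is_derive (f := derive1n n chi0)); last exact: is_derive_chi0.
  have zI : 1 / 2 < z < z + 1 by apply/andP; split; lra.
  apply: (near_id zI) => t /andP[t1 _]; have t0 : 0 < t by lra.
  by rewrite /cut t0 gtr0_norm//; case: ltP => // h; lra.
have z1' : z <= -1 by move: z1; rewrite ler0_norm//; lra.
have -> : cut n.+1 z = (-1) ^+ n * (derive1n n.+1 chi0 (- z) * -1).
  by rewrite /cut (ltNge 0 z) z0 /=; case: ltP => [h|_]; [lra|rewrite exprSr; ring].
apply: (near_eq_is_derive (f := fun t => (-1) ^+ n * derive1n n chi0 (- t))).
  have zI : z - 1 < z < - (1 / 2) by apply/andP; split; lra.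
  apply: (near_id zI) => t /andP[_ t1].
  rewrite /cut; case: ltP => [|_]; first by rewrite ltr0_norm; lra.
  by case: ltP => // h; lra.
apply: dZ; apply: (dchain (dN (did z))).
by apply: is_derive_chi0; lra.
Qed.

Lemma continuous_cut n : continuous (cut n).
Proof. exact: derives_continuous (is_derive_cut n). Qed.

Lemma cut_bounded n : exists2 B, 0 <= B & forall z, `|cut n z| <= B.
Proof.
have [B B0 hB] := @compact_bound R _ (cut n) _ (@segment_compact R (-2) 2)
  (fun x _ => @continuous_cut n x).
exists B => // z; have [z2|z2] := ltP 2 `|z|; first by rewrite cut_outer// normr0.
by apply: hB; rewrite /= in_itv /= -ler_norml.
Qed.

Lemma cut_derivative_le n : exists2 B, 0 <= B & forall z, `|cut n.+1 z| <= B * z ^+ 2.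
Proof.
have [B B0 hB] := cut_bounded n.+1; exists B => // z.
have [z1|z1] := ltP `|z| 1; first by rewrite cut_inner// normr0 mulr_ge0// sqr_ge0.
apply: le_trans (hB z) _; rewrite -[leLHS]mulr1 ler_wpM2l//.
by rewrite -(real_normK (num_real z)) expr_ge1.
Qed.

Lemma cutoffE Kc s y : 0 < Kc -> cutoff chi0 Kc s y = cut 0 (y / (Kc * Num.sqrt s)).
Proof.
move=> K0; rewrite cut0E /cutoff normrM normfV (@ger0_norm _ (Kc * _))//.
by rewrite mulr_ge0 ?sqrtr_ge0// ltW.
Qed.

(** The cut-off varies slowly in time, its scale being [sqrt s]. *)
Lemma cutoff_lipschitz : exists2 B, 0 <= B & forall Kc s t y, 0 < Kc ->
  0 < s -> s <= t ->
  `|cutoff chi0 Kc t y - cutoff chi0 Kc s y| <= B * (t - s) / s.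
Proof.
have [B B0 hB] := cut_bounded 1; exists B => // Kc s t y K0 s0 st.
pose f x := cut 0 (y / (Kc * Num.sqrt x)).
pose f' x := cut 1 (y / (Kc * Num.sqrt x)) * (y / (Kc * Num.sqrt x) * (- (2 * x)^-1)).
have df (x : R) : 0 < x -> is_derive x 1 f (f' x).
  move=> x0; have r0 : 0 < Num.sqrt x by rewrite sqrtr_gt0.
  have Kr : Kc * Num.sqrt x != 0 by rewrite mulf_neq0// gt_eqF.
  have := dchain (dM (dconst y x) (dV (dZ (dsqrt (did x) x0) Kc) Kr)) (is_derive_cut 0 _).
  apply: deriv_ext => [//|]; rewrite /f'; congr (_ * _).
  rewrite (_ : 2 * x = 2 * Num.sqrt x ^+ 2); last by rewrite sqr_sqrtr// ltW.
  by field; rewrite !gt_eqF.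
have [c cI E] : exists2 c, c \in `[s, t] & f t - f s = f' c * (t - s).
  apply: MVT_segment => //.
    by move=> x; rewrite in_itv /= => /andP[? ?]; apply: df; lra.
  apply: derivable_within_continuous => x; rewrite in_itv /= => /andP[? ?].
  by have [] := df x ltac:(lra).
rewrite !cutoffE// -/(f t) -/(f s) E.
move: cI; rewrite in_itv /= => /andP[sc ct]; have c0 : 0 < c by lra.
rewrite normrM (@ger0_norm _ (t - s)); last by rewrite subr_ge0.
rewrite mulrAC ler_wpM2r ?subr_ge0// /f'; set z := y / _.
have [z2|z2] := ltP 2 `|z|; first by rewrite cut_outer// mul0r normr0 divr_ge0// ltW.
rewrite normrM ler_pM// normrM normrN normfV (@gtr0_norm _ (2 * c)) ?mulr_gt0//.
rewrite ler_pdivrMr ?mulr_gt0//; apply: le_trans z2 _.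
rewrite mulrC -mulrA ler_peMr// ler_pdivlMr// mul1r //.
Qed.

End Cutoff.

(** * Weights, and the projection onto the negative part *)

Section Weights.
Set Implicit Arguments. Unset Strict Implicit.
Context {R : realType}.
Implicit Types (y : R).
Local Notation mu := (@lebesgue_measure R).

(** A smooth weight comparable with [1 + |y|^3]. *)
Definition wcub y : R := (1 + y ^+ 2) * Num.sqrt (1 + y ^+ 2).

Lemma one_sqr_gt0 y : 0 < 1 + y ^+ 2.
Proof. by have := sqr_ge0 y; lra. Qed.

Lemma sqrt_facts y : let r := Num.sqrt (1 + y ^+ 2) in
  [/\ 1 <= r, `|y| <= r & r ^+ 2 = 1 + y ^+ 2].
Proof.
move=> r; have y1 := one_sqr_gt0 y; have y2 := sqr_ge0 y.
have rE : r ^+ 2 = 1 + y ^+ 2 by rewrite /r sqr_sqrtr// ltW.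
have r0 : 0 <= r by exact: sqrtr_ge0.
split => //; first by rewrite -(@ler_pXn2r _ 2) ?nnegrE// rE expr1n lerDl.
by rewrite -(@ler_pXn2r _ 2) ?nnegrE// rE real_normK ?num_real// lerDr.
Qed.

Lemma wcub_ge y : [/\ 0 < wcub y, 1 + y ^+ 2 <= wcub y,
  (1 + y ^+ 2) * `|y| <= wcub y & 1 + `|y| ^+ 3 <= 2 * wcub y].
Proof.
have y1 := one_sqr_gt0 y; have [r1 yr rE] := sqrt_facts y; rewrite /wcub.
set r := Num.sqrt _ in r1 yr rE *.
have h1 : 1 + y ^+ 2 <= (1 + y ^+ 2) * r by rewrite ler_peMr// ltW.
have h2 : (1 + y ^+ 2) * `|y| <= (1 + y ^+ 2) * r by rewrite ler_wpM2l// ltW.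
split => //; first by rewrite mulr_gt0//; lra.
have y3 : `|y| ^+ 3 = y ^+ 2 * `|y| by rewrite exprSr real_normK ?num_real.
have := normr_ge0 y; have := sqr_ge0 y; rewrite y3; nra.
Qed.

Lemma wcub_le y : wcub y <= (1 + y ^+ 2) ^+ 2 /\ wcub y <= 4 * (1 + `|y| ^+ 3).
Proof.
have y1 := one_sqr_gt0 y; have [r1 yr rE] := sqrt_facts y; rewrite /wcub.
set r := Num.sqrt _ in r1 yr rE *; have y0 := normr_ge0 y.
split; first by rewrite expr2 ler_wpM2l ?(ltW y1)// -rE; nra.
have ra : r <= 1 + `|y|.
  rewrite -(@ler_pXn2r _ 2) ?nnegrE//; [|lra..].
  by rewrite rE -(real_normK (num_real y)); nra.
rewrite -rE; have -> : r ^+ 2 * r = r ^+ 3 by rewrite -exprSr.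
have r3 : r ^+ 3 <= (1 + `|y|) ^+ 3 by rewrite lerXn2r ?nnegrE//; lra.
apply: le_trans r3 _; rewrite -subr_ge0.
have -> : 4 * (1 + `|y| ^+ 3) - (1 + `|y|) ^+ 3 = 3 * ((`|y| - 1) ^+ 2 * (`|y| + 1)) by ring.
by apply: mulr_ge0 => //; apply: mulr_ge0; [exact: sqr_ge0|exact: addr_ge0].
Qed.

Lemma is_derive_sqrt1 (y : R) :
  is_derive y 1 (fun y => Num.sqrt (1 + y ^+ 2)) (y / Num.sqrt (1 + y ^+ 2)).
Proof.
have := dsqrt (dD (dconst 1 y) (dX (did y) 2)) (one_sqr_gt0 y).
have [r1 _ _] := sqrt_facts y.
by apply: deriv_ext => [//|] /=; field; rewrite gt_eqF//; lra.
Qed.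

Lemma is_derive_wcub y : is_derive y 1 wcub (3 * y * Num.sqrt (1 + y ^+ 2)).
Proof.
have := dM (dD (dconst 1 y) (dX (did y) 2)) (is_derive_sqrt1 y).
have [r1 _ rE] := sqrt_facts y; apply: deriv_ext => [//|] /=.
by rewrite -{2}rE; field; rewrite gt_eqF//; lra.
Qed.

Lemma is_derive_wcub' y : is_derive y 1 (fun y => 3 * y * Num.sqrt (1 + y ^+ 2))
  (3 * Num.sqrt (1 + y ^+ 2) + 3 * y ^+ 2 / Num.sqrt (1 + y ^+ 2)).
Proof.
have := dM (dZ (did y) 3) (is_derive_sqrt1 y).
have [r1 _ rE] := sqrt_facts y; apply: deriv_ext => [//|] /=.
by field; rewrite gt_eqF//; lra.
Qed.

Lemma continuous_wcub'' :
  continuous (fun y => 3 * Num.sqrt (1 + y ^+ 2) + 3 * y ^+ 2 / Num.sqrt (1 + y ^+ 2)).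
Proof.
have cs : continuous (fun y => Num.sqrt (1 + y ^+ 2)) by exact: derives_continuous is_derive_sqrt1.
have ci : continuous (fun y => (Num.sqrt (1 + y ^+ 2))^-1).
  move=> y; have [r1 _ _] := sqrt_facts y.
  by apply: derive_cont; apply: (dV (is_derive_sqrt1 y)); rewrite gt_eqF//; lra.
apply: cD; first by apply: cM => //; exact: cC.
by apply: cM => //; apply: cM; [exact: cC|exact: (cX (@cI R))].
Qed.

Lemma wcub_super y : 3 * Num.sqrt (1 + y ^+ 2) + 3 * y ^+ 2 / Num.sqrt (1 + y ^+ 2)
  - y / 2 * (3 * y * Num.sqrt (1 + y ^+ 2)) + wcub y <= 7 * wcub y.
Proof.
have [r1 yr rE] := sqrt_facts y; have y2 := sqr_ge0 y; rewrite /wcub.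
set r := Num.sqrt _ in r1 yr rE *.
have h1 : 3 * y ^+ 2 / r <= 3 * r.
  by rewrite ler_pdivrMr; [rewrite -mulrA -expr2 rE; lra|lra].
have h2 : 0 <= y / 2 * (3 * y * r).
  rewrite (_ : y / 2 * _ = 3 / 2 * (y ^+ 2 * r)); last by field.
  by apply: mulr_ge0; [lra|apply: mulr_ge0 => //; lra].
have h3 : r <= (1 + y ^+ 2) * r by nra.
by lra.
Qed.

Definition wexp y : R := expR (y ^+ 2 / 16).

Lemma is_derive_wexp y : is_derive y 1 wexp (y / 8 * wexp y).
Proof.
have := dexp (dM (dX (did y) 2) (dconst (16^-1) y)).
by apply: deriv_ext => [//|] /=; rewrite /wexp; field.
Qed.

Lemma is_derive_wexp' y : is_derive y 1 (fun y => y / 8 * wexp y)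
  ((1 / 8 + y ^+ 2 / 64) * wexp y).
Proof.
have := dM (dM (did y) (dconst (8^-1) y)) (is_derive_wexp y).
by apply: deriv_ext => [//|] /=; field.
Qed.

Lemma continuous_wexp'' : continuous (fun y => (1 / 8 + y ^+ 2 / 64) * wexp y).
Proof. have h := derives_continuous is_derive_wexp; apply: cM => //.
by apply: cD; [exact: cC|apply: cM; [exact: (cX (@cI R))|exact: cC]]. Qed.

Lemma wexp_gt0 y : 0 < wexp y.
Proof. exact: expR_gt0. Qed.

Lemma wexp_super y : (1 / 8 + y ^+ 2 / 64) * wexp y - y / 2 * (y / 8 * wexp y)
  + wexp y <= 7 * wexp y.
Proof.
rewrite -subr_ge0.
have -> : 7 * wexp y - ((1 / 8 + y ^+ 2 / 64) * wexp y - y / 2 * (y / 8 * wexp y) + wexp y)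
  = (47 / 8 + 3 / 64 * y ^+ 2) * wexp y by field.
by rewrite mulr_ge0 ?(ltW (wexp_gt0 _))//; have := sqr_ge0 y; lra.
Qed.

End Weights.

Section Projection.
Set Implicit Arguments. Unset Strict Implicit.
Context {R : realType}.
Implicit Types (y : R).
Local Notation mu := (@lebesgue_measure R).

Lemma sum3 (F : nat -> R) : \sum_(m < 3) F m = F 0%N + F 1%N + F 2%N.
Proof. by rewrite !big_ord_recr big_ord0 /= add0r. Qed.

Lemma hermite_sum3 (a : nat -> R) y :
  \sum_(m < 3) a m * hermite m y = a 0%N + a 1%N * y + a 2%N * (y ^+ 2 - 2).
Proof.
rewrite (sum3 (fun m => a m * hermite m y)).
have h0 := hermite0E y; have h1 := hermite1E y; have h2 := hermite2E y.
by rewrite h0 h1 h2 mulr1.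
Qed.

(** Subtracting the projection on the first modes is harmless for the
    [1 + |y|^3] norm and removes any combination of these modes. *)
Lemma minus_bound : exists2 C : R, 0 < C &
  forall (chi0 : R -> R) Kc s (f W : R -> R) (a : nat -> R) F,
  measurable_fun setT W -> 0 <= F ->
  (forall y, `|W y| <= F * wcub y) ->
  (forall y, part_b chi0 Kc s f y = \sum_(m < 3) a m * hermite m y + W y) ->
  forall y, `|part_minus chi0 Kc s f y| <= C * F * (1 + `|y| ^+ 3).
Proof.
have [Cd Cd0 Hd] := @hermite_dual_le R.
have [Q Q0 HQ] := @gauss_moment_poly R 3.
pose A := Q * Cd.
have A0 : 0 < A by rewrite mulr_gt0.
exists (4 * (1 + 6 * A)); first by rewrite mulr_gt0// ltr_wpDl// mulr_gt0.
move=> chi0 Kc s f W a F mW F0 hW hf y.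
have p3 (x : R) : 0 <= 1 + x ^+ 2 by exact: ltW (one_sqr_gt0 x).
have iW k : (k < 3)%N ->
    mu.-integrable setT (EFin \o (fun y => W y * hermite_dual k y * rho y)) /\
    `|\int[mu]_y (W y * hermite_dual k y * rho y)| <= A * F.
  move=> k3; have := HQ (fun y => W y * hermite_dual k y) (F * Cd)
    (measurable_funM mW (measurable_hermite_dual k3)) (mulr_ge0 F0 (ltW Cd0)).
  rewrite (_ : Q * (F * Cd) = A * F); last by rewrite /A; ring.
  apply => x; rewrite normrM.
  rewrite (_ : F * Cd * _ = (F * (1 + x ^+ 2) ^+ 2) * (Cd * (1 + x ^+ 2))); last by ring.
  apply: ler_pM => //; last exact: Hd.
  by apply: le_trans (hW x) _; rewrite ler_wpM2l//; have [] := wcub_le x.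
have ih m k : (m < 3)%N -> (k < 3)%N ->
    mu.-integrable setT (EFin \o (fun y => hermite m y * hermite_dual k y * rho y)).
  move=> m3 k3; have [] // := HQ (fun y => hermite m y * hermite_dual k y) (2 * Cd)
    (measurable_funM (measurable_hermite m3) (measurable_hermite_dual k3))
    (mulr_ge0 (ler0n _ 2) (ltW Cd0)).
  move=> x; rewrite normrM.
  apply: (@le_trans _ _ (2 * (1 + x ^+ 2) * (Cd * (1 + x ^+ 2)))).
    by apply: ler_pM => //; [exact: hermite_le|exact: Hd].
  rewrite (_ : 2 * _ * _ = 2 * Cd * (1 + x ^+ 2) ^+ 2); last by ring.
  rewrite ler_wpM2l ?mulr_ge0 ?(ltW Cd0)// ler_weXn2l// lerDl sqr_ge0 //.
have iZ m k c : (m < 3)%N -> (k < 3)%N ->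
    mu.-integrable setT (EFin \o (fun y => c * (hermite m y * hermite_dual k y * rho y))).
  move=> m3 k3; rewrite (_ : _ \o _ = (fun x => c%:E * (EFin \o
    (fun y => (hermite m y * hermite_dual k y * rho y)%R)) x)%E); last first.
    by apply/funext => x /=; rewrite EFinM.
  by apply: integrableZl => //; exact: ih.
have [I mode] : exists I : nat -> R, forall k, (k < 3)%N ->
    part_mode chi0 Kc s f k = a k + I k /\ `|I k| <= A * F.
  exists (fun k => \int[mu]_y (W y * hermite_dual k y * rho y)) => k k3.
  have [iWk hWk] := iW k k3; split => //; rewrite /part_mode.
  transitivity (\int[mu]_y (a 0%N * (hermite 0 y * hermite_dual k y * rho y) +
     a 1%N * (hermite 1 y * hermite_dual k y * rho y) +
     a 2%N * (hermite 2 y * hermite_dual k y * rho y) + W y * hermite_dual k y * rho y)).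
    by apply: eq_Rintegral => x _; rewrite hf (sum3 (fun m => a m * hermite m x)); ring.
  have i0 := iZ 0%N k (a 0%N) isT k3; have i1 := iZ 1%N k (a 1%N) isT k3.
  have i2 := iZ 2%N k (a 2%N) isT k3.
  have i01 := integrableD measurableT i0 i1.
  have i012 := integrableD measurableT i01 i2.
  rewrite RintegralD// RintegralD// RintegralD// !RintegralZl//; try exact: ih.
  rewrite !hermite_biorthogonal//; congr (_ + _).
  by move: k k3 {iWk hWk i0 i1 i2 i01 i012}; apply: lt3P; rewrite /= !(mulr1, mulr0, addr0, add0r).
rewrite /part_minus hf.
have [m0 j0] := mode 0%N isT; have [m1 j1] := mode 1%N isT; have [m2 j2] := mode 2%N isT.
rewrite (_ : _ - _ = W y - \sum_(m < 3) I m * hermite m y); last first.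
  rewrite (sum3 (fun m => part_mode chi0 Kc s f m * hermite m y)) m0 m1 m2.
  rewrite (sum3 (fun m => a m * hermite m y)) (sum3 (fun m => I m * hermite m y)).
  by ring.
rewrite (sum3 (fun m => I m * hermite m y)).
have [w0 w1 _ _] := wcub_ge y; have [_ w4] := wcub_le y.
have hI k : (k < 3)%N -> `|I k * hermite k y| <= 2 * A * F * wcub y.
  move=> k3; rewrite normrM; have [_ h] := mode k k3.
  rewrite (_ : 2 * A * F * _ = A * F * (2 * wcub y)); last by ring.
  apply: (ler_pM (normr_ge0 _) (normr_ge0 _) h).
  by apply: le_trans (hermite_le y k3) _; exact: (ler_wpM2l (ler0n _ 2) w1).
apply: (@le_trans _ _ ((1 + 6 * A) * F * wcub y)); last first.
  rewrite (_ : 4 * _ * _ * _ = (1 + 6 * A) * F * (4 * (1 + `|y| ^+ 3))); last by ring.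
  have A1 : 0 <= 1 + 6 * A by clear -A0; lra.
  exact: (ler_wpM2l (mulr_ge0 A1 F0) w4).
have e0 := hI 0%N isT; have e1 := hI 1%N isT; have e2 := hI 2%N isT; have e3 := hW y.
apply: le_trans (ler_normB _ _) _.
apply: le_trans (lerD e3 (ler_normD _ _)) _.
apply: le_trans (lerD (lexx _) (lerD (ler_normD _ _) e2)) _.
apply: le_trans (lerD (lexx _) (lerD (lerD e0 e1) (lexx _))) _.
by rewrite le_eqVlt; apply/orP; left; apply/eqP; ring.
Qed.

End Projection.

(** * The decomposed data, and the exterior estimate *)

Section Estimates.
Set Implicit Arguments. Unset Strict Implicit.
Context {R : realType}.
Implicit Types (y : R).
Local Notation mu := (@lebesgue_measure R).

(** The situation of all three estimates, with the two norms of the data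
    replaced by real numbers that bound them almost everywhere. *)
Record setup (chi0 : R -> R) (Kc Cv sigma : R) (V : R -> R -> R)
    (K : R -> R -> (R -> R) -> (R -> R)) (psi : R -> R) (nm ne : R) : Prop := Setup {
  su_sigma : 1 <= sigma;
  su_V1 : forall s y, sigma <= s -> `|V y s| <= Cv;
  su_V2 : forall s y, sigma <= s -> `|V y s| <= Cv * ((1 + y ^+ 2) / s);
  su_K : fundamental_solution V sigma K;
  su_meas : measurable_fun setT psi;
  su_nm : 0 <= nm;
  su_ne : 0 <= ne;
  su_minus : {ae mu, forall y, `|part_minus chi0 Kc sigma psi y| <= nm * (1 + `|y| ^+ 3)};
  su_ext : {ae mu, forall y, `|part_e chi0 Kc sigma psi y| <= ne} }.

(** A bound at infinity becomes smallness: a function supported far away is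
    dominated by any weight that is large there. *)
Lemma ae_weight (f w : R -> R) (r n : R) : 0 <= n ->
  {ae mu, forall y, `|f y| <= n} -> (forall y, `|y| < r -> f y = 0) ->
  (forall y, 0 <= w y) -> (forall y, r <= `|y| -> 1 <= w y) ->
  {ae mu, forall y, `|f y| <= n * w y}.
Proof.
move=> n0 fn f0 w0 w1; apply: ae_mono fn => y h.
have [yr|yr] := ltP `|y| r; first by rewrite f0// normr0 mulr_ge0.
apply: le_trans h _; rewrite -[leLHS]mulr1 ler_wpM2l//; exact: w1.
Qed.

Lemma modes_wcub (c : nat -> R) y :
  `|c 0%N + c 1%N * y + c 2%N * (y ^+ 2 - 2)| <=
    2 * (`|c 0%N| + `|c 1%N| + `|c 2%N|) * wcub y.
Proof.
have [w0 w1 w2 w3] := wcub_ge y; have y2 := sqr_ge0 y.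
have hy : `|y| <= 1 + y ^+ 2 by rewrite ler_norml; apply/andP; split; nra.
have hy2 : `|y ^+ 2 - 2| <= 2 * (1 + y ^+ 2) by rewrite ler_norml; apply/andP; split; lra.
move: (c 0%N) (c 1%N) (c 2%N) => c0 c1 c2.
have b0 := normr_ge0 c0; have b1 := normr_ge0 c1; have b2 := normr_ge0 c2.
apply: le_trans (ler_normD _ _) _; apply: le_trans (lerD (ler_normD _ _) (lexx _)) _.
rewrite (normrM c1) (normrM c2).
have k0 : `|c0| * 1 <= `|c0| * wcub y by apply: ler_wpM2l => //; lra.
have k1 : `|c1| * `|y| <= `|c1| * wcub y by apply: ler_wpM2l => //; lra.
have k2 : `|c2| * `|y ^+ 2 - 2| <= `|c2| * (2 * wcub y) by apply: ler_wpM2l => //; lra.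
have z0 : 0 <= `|c0| * wcub y by apply: mulr_ge0 => //; exact: ltW.
have z1 : 0 <= `|c1| * wcub y by apply: mulr_ge0 => //; exact: ltW.
by lra.
Qed.

Section Fixed.
Variables (chi0 : R -> R) (Kc Cv sigma : R) (V : R -> R -> R) (K : R -> R -> (R -> R) -> (R -> R)).
Variables (psi : R -> R) (nm ne : R).
Hypotheses (hchi : cutoff_profile chi0) (hKc : 3 <= Kc) (hCv : 0 < Cv).
Hypothesis su : setup chi0 Kc Cv sigma V K psi nm ne.
Local Notation b l := (part_mode chi0 Kc sigma psi l).
Local Notation q := (Num.sqrt sigma).

Lemma q_facts : [/\ 1 <= q, 0 < q & q ^+ 2 = sigma].
Proof.
have h := su_sigma su.
have qE : q ^+ 2 = sigma by rewrite sqr_sqrtr//; lra.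
have q0 : 0 <= q by exact: sqrtr_ge0.
have q1 : 1 <= q by rewrite -(@ler_pXn2r _ 2) ?nnegrE// qE expr1n.
by split => //; lra.
Qed.

Lemma part_bE y : part_b chi0 Kc sigma psi y =
  b 0%N + b 1%N * y + b 2%N * (y ^+ 2 - 2) + part_minus chi0 Kc sigma psi y.
Proof.
by rewrite /part_minus (hermite_sum3 (part_mode chi0 Kc sigma psi)) addrC subrK.
Qed.

Lemma psiE y : psi y = part_b chi0 Kc sigma psi y + part_e chi0 Kc sigma psi y.
Proof. by rewrite /part_b /part_e mulrBl mul1r addrC subrK. Qed.

Lemma part_e_inner y : `|y| < Kc * q -> part_e chi0 Kc sigma psi y = 0.
Proof.
move=> yK; have [q1 q0 _] := q_facts; have K3 := hKc.
have Kq : 0 < Kc * q by rewrite mulr_gt0//; lra.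
rewrite /part_e (cutoffE hchi); last lra.
rewrite (cut_inner hchi) ?subrr ?mul0r//.
by rewrite normrM normfV (gtr0_norm Kq) ltr_pdivrMr// mul1r.
Qed.

Lemma part_b_outer y : 2 * (Kc * q) < `|y| -> part_b chi0 Kc sigma psi y = 0.
Proof.
move=> yK; have [q1 q0 _] := q_facts; have K3 := hKc.
have Kq : 0 < Kc * q by rewrite mulr_gt0//; lra.
rewrite /part_b (cutoffE hchi); last lra.
rewrite (cut_outer hchi) ?mul0r//.
by rewrite normrM normfV (gtr0_norm Kq) ltr_pdivlMr.
Qed.

(** The data seen through its decomposition, with the components as opaque
    objects. *)
Lemma psi_split : exists (c : nat -> R) (pb pm pe : R -> R),
  [/\ forall l, b l = c l, forall y, psi y = pb y + pe y,
      forall y, pb y = c 0%N + c 1%N * y + c 2%N * (y ^+ 2 - 2) + pm y,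
      forall y, 2 * (Kc * q) < `|y| -> pb y = 0 &
      {ae mu, forall y, `|pm y| <= nm * (1 + `|y| ^+ 3)} /\
      ({ae mu, forall y, `|pe y| <= ne} /\
      forall y, `|y| < Kc * q -> pe y = 0)].
Proof.
exists (part_mode chi0 Kc sigma psi), (part_b chi0 Kc sigma psi),
  (part_minus chi0 Kc sigma psi), (part_e chi0 Kc sigma psi); split => //.
- exact: psiE.
- exact: part_bE.
- exact: part_b_outer.
- split; first exact: su_minus su.
  split; [exact: su_ext su|exact: part_e_inner].
Qed.

Lemma psi_L2 : in_L2rho psi.
Proof.
split; first exact: su_meas su.
have [c [pb [pm [pe [_ psE pbE _ [hm [he _]]]]]]] := psi_split.
have [S S0 hS] : exists2 S, 0 <= S & forall y, `|c 0%N + c 1%N * y + c 2%N * (y ^+ 2 - 2)| <= S * wcub y.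
  exists (2 * (`|c 0%N| + `|c 1%N| + `|c 2%N|)); last exact: modes_wcub.
  by apply: mulr_ge0 => //; rewrite !addr_ge0.
have nm0 := su_nm su; have ne0 := su_ne su.
have [A A0 hA] : exists2 A, 0 <= A & {ae mu, forall y, `|psi y| <= A * (1 + y ^+ 2) ^+ 2}.
  exists (S + nm * 2 + ne); first by rewrite !addr_ge0// mulr_ge0.
  apply: ae_mono (ae_and hm he) => y [h1 h2].
  have [w0 w1 w2 w3] := wcub_ge y; have [w4 _] := wcub_le y.
  apply: (@le_trans _ _ ((S + nm * 2 + ne) * wcub y)); last first.
    by apply: ler_wpM2l => //; rewrite !addr_ge0// mulr_ge0.
  rewrite psE pbE 2!mulrDl; apply: le_trans (ler_normD _ _) _; apply: lerD; last first.
    apply: le_trans h2 _; rewrite -[leLHS]mulr1; apply: ler_wpM2l => //.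
    by apply: le_trans w1; rewrite lerDl sqr_ge0.
  apply: le_trans (ler_normD _ _) _; apply: lerD; first exact: hS.
  by apply: le_trans h1 _; rewrite -mulrA; apply: ler_wpM2l.
have [Q Q0 HQ] := @ereal_integral_poly R 4.
have mr : measurable_fun setT (@rho R) := measurable_rho.
pose P (y : R) := A ^+ 2 * (1 + y ^+ 2) ^+ 4.
have mP : measurable_fun setT P.
  by apply: continuous_measurable_fun; rewrite /P; cont.
apply: (@le_lt_trans _ _ (Q * A ^+ 2)%:E); last exact: ltry.
apply: le_trans (_ : (_ <= \int[mu]_y (P y * rho y)%:E)%E) _; last first.
  apply: HQ => //; first exact: sqr_ge0.
  move=> y; rewrite /P ger0_norm// mulr_ge0 ?sqr_ge0// exprn_ge0// ltW// one_sqr_gt0 //.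
apply: ae_ge0_le_integral => //.
- by move=> y _; rewrite lee_fin mulr_ge0 ?sqr_ge0// ltW// rho_gt0.
- by apply/measurable_EFinP/measurable_funM => //; apply: measurable_funX; exact: su_meas su.
- move=> y _; rewrite lee_fin mulr_ge0 ?(ltW (rho_gt0 _))// mulr_ge0 ?sqr_ge0//.
  by rewrite exprn_ge0// ltW// one_sqr_gt0.
- by apply/measurable_EFinP/measurable_funM.
- apply: ae_mono hA => y h _; rewrite lee_fin ler_wpM2r ?(ltW (rho_gt0 _))//.
  rewrite /P -(real_normK (num_real (psi y))).
  rewrite (_ : A ^+ 2 * _ = (A * (1 + y ^+ 2) ^+ 2) ^+ 2); last by ring.
  by rewrite lerXn2r ?nnegrE// mulr_ge0// exprn_ge0// ltW// one_sqr_gt0.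
Qed.

Lemma sV1 T s y : sigma < s < T -> `|V y s| <= Cv.
Proof. by move=> /andP[h _]; apply: (su_V1 su); exact: ltW. Qed.

Lemma sV2 T s y : sigma < s < T -> `|V y s| <= Cv * ((1 + y ^+ 2) / sigma).
Proof.
move=> /andP[h _]; apply: le_trans (su_V2 su y (ltW h)) _.
have s1 := su_sigma su; rewrite ler_wpM2l ?(ltW hCv)//.
rewrite ler_wpM2l ?(ltW (one_sqr_gt0 _))//.
by rewrite lef_pV2 ?posrE//; lra.
Qed.

Lemma free_flow0 s y : free_flow sigma 0 0 0 s y = 0.
Proof. by rewrite /free_flow; ring. Qed.

End Fixed.

(** On the support of the inner part, [|y| <= 2 Kc sqrt sigma], a term [|y|^l] is
    at most [C sqrt sigma^l]; hence the data are bounded by the right-hand side,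
    and the barrier with the constant weight [G = 1] propagates this bound. *)
Lemma exterior_estimate (chi0 : R -> R) (hchi : cutoff_profile chi0)
    (Kc lambda Cv : R) (hKc : 3 <= Kc) (hlambda : 0 < lambda) (hCv : 0 < Cv) :
  exists2 C, 0 < C &
  forall sigma V K psi nm ne, setup chi0 Kc Cv sigma V K psi nm ne ->
  forall s y, sigma < s <= sigma + lambda ->
  `|part_e chi0 Kc s (K s sigma psi) y| <=
    C * (`|part_mode chi0 Kc sigma psi 0| + Num.sqrt sigma * `|part_mode chi0 Kc sigma psi 1|
      + Num.sqrt sigma ^+ 2 * `|part_mode chi0 Kc sigma psi 2|
      + Num.sqrt sigma ^+ 3 * nm + ne).
Proof.
have [B B0 hB] := cut_bounded hchi 0.
have K3 := hKc; have l0 := hlambda; have Cv0 := hCv.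
pose X := expR ((1 + Cv) * (lambda + 1)).
have X0 : 0 < X by exact: expR_gt0.
pose C1 := 1 + 2 * Kc + (4 * Kc ^+ 2 + 2) + (1 + 8 * Kc ^+ 3).
have C11 : 1 <= C1.
  have : 0 <= Kc ^+ 2 by exact: sqr_ge0.
  have : 0 <= Kc ^+ 3 by apply: exprn_ge0; lra.
  by rewrite /C1; lra.
exists ((1 + B) * (C1 * X)).
  by apply: mulr_gt0; [lra|apply: mulr_gt0 => //; lra].
move=> sigma V K psi nm ne su s y sI; have /andP[s1 s2] := sI.
have [q1 q0 qE] := q_facts su.
have nm0 := su_nm su; have ne0 := su_ne su.
have [c [pb [pm [pe [cE psE pbE pb0 [hm [he _]]]]]]] := psi_split hchi hKc su.
rewrite !cE; move: (Num.sqrt sigma) q1 q0 qE pb0 => q q1 q0 qE pb0.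
have [a0 a0E a00] : exists2 a0, a0 = `|c 0%N| & 0 <= a0 by exists `|c 0%N|.
have [a1 a1E a10] : exists2 a0, a0 = `|c 1%N| & 0 <= a0 by exists `|c 1%N|.
have [a2 a2E a20] : exists2 a0, a0 = `|c 2%N| & 0 <= a0 by exists `|c 2%N|.
rewrite -a0E -a1E -a2E.
have q2 : 1 <= q ^+ 2 by rewrite expr_ge1// ltW.
have q3 : 1 <= q ^+ 3 by rewrite expr_ge1// ltW.
have p0 : 0 <= q * a1 by apply: mulr_ge0 => //; exact: ltW.
have p1 : 0 <= q ^+ 2 * a2 by apply: mulr_ge0 => //; exact: le_trans q2.
have p2 : 0 <= q ^+ 3 * nm by apply: mulr_ge0 => //; exact: le_trans q3.
have [D' D'E D'0] : exists2 D', D' = a0 + q * a1 + q ^+ 2 * a2 + q ^+ 3 * nm & 0 <= D'.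
  by exists (a0 + q * a1 + q ^+ 2 * a2 + q ^+ 3 * nm) => //; rewrite !addr_ge0.
rewrite -D'E.
have [D DE D0] : exists2 D, D = D' + ne & 0 <= D.
  by exists (D' + ne) => //; rewrite addr_ge0.
rewrite -DE.
have C10 : 0 <= C1 by exact: le_trans C11.
have hpb x : `|pm x| <= nm * (1 + `|x| ^+ 3) -> `|pb x| <= C1 * D'.
  move=> h1; have [xK|xK] := ltP (2 * (Kc * q)) `|x|.
    by rewrite pb0// normr0; exact: mulr_ge0.
  rewrite pbE; have x0 := normr_ge0 x.
  have x2 : `|x| ^+ 2 <= 4 * Kc ^+ 2 * q ^+ 2.
    rewrite (_ : 4 * _ * _ = (2 * (Kc * q)) ^+ 2); last by ring.
    by rewrite lerXn2r ?nnegrE//; apply: le_trans xK.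
  have x3 : `|x| ^+ 3 <= 8 * Kc ^+ 3 * q ^+ 3.
    rewrite (_ : 8 * _ * _ = (2 * (Kc * q)) ^+ 3); last by ring.
    by rewrite lerXn2r ?nnegrE//; apply: le_trans xK.
  have k1 : a1 * `|x| <= 2 * Kc * (q * a1).
    by rewrite (_ : 2 * _ * _ = a1 * (2 * (Kc * q))); [exact: ler_wpM2l|ring].
  have k2 : a2 * `|x ^+ 2 - 2| <= (4 * Kc ^+ 2 + 2) * (q ^+ 2 * a2).
    rewrite (_ : (4 * _ + 2) * _ = a2 * (4 * Kc ^+ 2 * q ^+ 2 + 2 * q ^+ 2)); last by ring.
    apply: ler_wpM2l => //; apply: le_trans (ler_normB _ _) _.
    by rewrite normrX (@ger0_norm _ 2)//; clear -x2 q2; lra.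
  have k3 : `|pm x| <= (1 + 8 * Kc ^+ 3) * (q ^+ 3 * nm).
    apply: le_trans h1 _.
    rewrite (_ : (1 + _) * _ = nm * (q ^+ 3 + 8 * Kc ^+ 3 * q ^+ 3)); last by ring.
    by apply: ler_wpM2l => //; apply: lerD.
  apply: le_trans (ler_normD _ _) _; apply: le_trans (lerD (ler_normD _ _) (lexx _)) _.
  apply: le_trans (lerD (lerD (ler_normD _ _) (lexx _)) (lexx _)) _.
  rewrite (normrM (c 1%N)) (normrM (c 2%N)) -a0E -a1E -a2E.
  apply: le_trans (lerD (lerD (lerD (lexx _) k1) k2) k3) _.
  have Kc2 : 0 <= Kc ^+ 2 by exact: sqr_ge0.
  have Kc3 : 0 <= Kc ^+ 3 by apply: exprn_ge0; clear -K3; lra.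
  rewrite D'E !mulrDr -{1}(mul1r a0).
  by repeat apply: lerD; apply: ler_wpM2r => //; rewrite /C1; clear -Kc2 Kc3 K3; lra.
have hb : {ae mu, forall y, `|psi y - free_flow sigma 0 0 0 sigma y| <= C1 * D * 1}.
  apply: ae_mono (ae_and hm he) => x [h1 h2].
  rewrite free_flow0 subr0 mulr1 psE DE mulrDr.
  apply: le_trans (ler_normD _ _) _; apply: lerD; first exact: hpb.
  by apply: le_trans h2 _; rewrite ler_peMl.
pose T := sigma + lambda + 1.
have sT : sigma < T by rewrite /T; clear -l0; lra.
have C1D : 0 <= C1 * D by exact: mulr_ge0.
have sV := sV1 su (T := T).
have hth : `|K s sigma psi y| <= C1 * D * X.
  have := @flow_barrier R V sigma K psi (su_K su) (psi_L2 hchi hKc su) T Cv 1 (C1 * D) 0 0 0 0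
    (fun=> 1) (fun=> 0) (fun=> 0) sT sV (fun y => dconst 1 y) (fun y => dconst 0 y)
    (@cC _ 0) (fun=> ler01).
  have h1 (x : R) : 0 - x / 2 * 0 + 1 <= 1 * 1 :> R by rewrite mulr0 subr0 add0r mulr1.
  have h2 t x : sigma < t < T -> `|V x t * free_flow sigma 0 0 0 t x| <= 0 * 1.
    by move=> tI; rewrite free_flow0 mulr0 normr0 mul0r.
  have sT' : sigma < s < T by rewrite s1 /T /=; clear -s2; lra.
  move=> /(_ h1 ler01 (ltW Cv0) C1D (lexx 0) hb h2 s y sT').
  rewrite free_flow0 subr0 mul0r addr0 !mulr1.
  by rewrite (_ : T - sigma = lambda + 1); [|rewrite /T; ring].
rewrite /part_e normrM.
rewrite (_ : (1 + B) * _ * _ = (1 + B) * (C1 * D * X)); last by ring.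
apply: (ler_pM (normr_ge0 _) (normr_ge0 _) _ hth); rewrite (cutoffE hchi); last by clear -K3; lra.
by apply: le_trans (ler_normB _ _) _; rewrite normr1 lerD2l; exact: hB.
Qed.

End Estimates.

(** * The estimate of the negative part *)

Section MinusEstimate.
Set Implicit Arguments. Unset Strict Implicit.
Context {R : realType}.
Implicit Types (y : R).
Local Notation mu := (@lebesgue_measure R).

Lemma free_flow_bound (sigma c0 c1 c2 t x l L : R) : L = expR l ->
  sigma <= t <= sigma + l ->
  `|free_flow sigma c0 c1 c2 t x| <=
    L * `|c0| + L * (`|c1| * `|x|) + `|c2| * (2 * (1 + x ^+ 2)).
Proof.
move=> -> /andP[t1 t2]; have x2 := sqr_ge0 x.
have h0 : 0 <= expR (t - sigma) <= expR l by rewrite expR_ge0 ler_expR; lra.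
have h1 : 0 <= expR ((t - sigma) / 2) <= expR l by rewrite expR_ge0 ler_expR; lra.
case/andP: h0 => h0 h0'; case/andP: h1 => h1 h1'.
rewrite /free_flow; apply: le_trans (ler_normD _ _) _; apply: lerD; last first.
  rewrite normrM; apply: ler_wpM2l => //.
  by rewrite ler_norml; clear -x2; apply/andP; split; lra.
apply: le_trans (ler_normD _ _) _; apply: lerD.
  by rewrite normrM (ger0_norm h0) mulrC; apply: ler_wpM2r.
rewrite !normrM (ger0_norm h1) mulrAC mulrC; apply: ler_wpM2r => //.
Qed.

(** On the second mode, of size [1 + y^2], the potential must gain [1/q] against
    the cubic weight: the bound [C (1 + y^2) / q^2] does it where
    [1 + y^2 <= q^2], the bound [C] elsewhere. *)
Lemma potential_interpolation (v C q y : R) : 0 < C -> 0 < q ->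
  `|v| <= C -> `|v| <= C * ((1 + y ^+ 2) / q ^+ 2) ->
  `|v| * (1 + y ^+ 2) <= C * (wcub y / q).
Proof.
move=> C0 q0 v1 v2; have [r1 yr rE] := sqrt_facts y; rewrite /wcub.
move: v2 r1 yr rE; move: (Num.sqrt _) => r v2 r1 yr rE; rewrite -rE in v2 *.
have r0 : 0 < r by clear -r1; lra.
have [rq|rq] := leP r q.
  apply: (@le_trans _ _ (C * (r ^+ 2 / q ^+ 2) * r ^+ 2)).
    by apply: ler_wpM2r => //; exact: sqr_ge0.
  have h : r / q <= 1 by rewrite ler_pdivrMr// mul1r.
  rewrite (_ : C * _ * _ = C * (r ^+ 2 * r / q) * (r / q)); last by field; rewrite gt_eqF.
  rewrite -[leRHS]mulr1; apply: ler_wpM2l => //.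
  by rewrite mulr_ge0 ?(ltW C0)// divr_ge0 ?(ltW q0)// mulr_ge0 ?sqr_ge0// ltW.
apply: (@le_trans _ _ (C * r ^+ 2)); first by apply: ler_wpM2r => //; exact: sqr_ge0.
apply: ler_wpM2l; first exact: ltW.
rewrite -mulrA -[leLHS]mulr1; apply: ler_wpM2l; first exact: sqr_ge0.
by rewrite ler_pdivlMr// mul1r ltW.
Qed.

(** The barrier with the cubic weight, around the free evolution [H] of the three
    modes: the solution is [H] plus a small cubic error.  Truncating, the part
    of [H] below the cut-off is a combination of [h_0, h_1, h_2] and is removed
    by the projection; what remains, [(1 - chi) H], lives where
    [|y| >= sqrt sigma] and is small against the cubic weight. *)
Lemma minus_estimate (chi0 : R -> R) (hchi : cutoff_profile chi0)
    (Kc lambda Cv : R) (hKc : 3 <= Kc) (hlambda : 0 < lambda) (hCv : 0 < Cv) :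
  exists2 C, 0 < C &
  forall sigma V K psi nm ne, setup chi0 Kc Cv sigma V K psi nm ne ->
  forall s y, sigma < s <= sigma + lambda ->
  `|part_minus chi0 Kc s (K s sigma psi) y| <=
    C * ((`|part_mode chi0 Kc sigma psi 0| + `|part_mode chi0 Kc sigma psi 1|
      + Num.sqrt sigma * `|part_mode chi0 Kc sigma psi 2|) / Num.sqrt sigma ^+ 2
      + (nm + ne / Num.sqrt sigma ^+ 3)) * (1 + `|y| ^+ 3).
Proof.
have [B B0 hB] := cut_bounded hchi 0.
have [C3 C30 HC3] := @minus_bound R.
have [L LE L1] : exists2 L, L = expR (lambda + 1) & 1 <= L.
  by exists (expR (lambda + 1)) => //; rewrite -[leLHS]expR0 ler_expR; clear -hlambda; lra.
have [Y YE Y0] : exists2 Y, Y = expR ((7 + Cv) * (lambda + 1)) & 0 < Y.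
  by exists (expR ((7 + Cv) * (lambda + 1))) => //; exact: expR_gt0.
have L0 : 0 < L by clear -L1; lra.
have CvL : 0 < 2 * Cv * L by rewrite !mulr_gt0.
have [C2 C2E C20] : exists2 C2, C2 = (2 + 2 * Cv * L * (lambda + 1)) * Y & 0 < C2.
  exists ((2 + 2 * Cv * L * (lambda + 1)) * Y) => //; apply: mulr_gt0 => //.
  by apply: addr_gt0 => //; apply: mulr_gt0 => //; clear -hlambda; lra.
have B1 : 0 < 1 + B by clear -B0; lra.
exists (C3 * (B * C2 + (1 + B) * (2 * L))).
  apply: mulr_gt0 => //; apply: ltr_wpDl; first by apply: mulr_ge0 => //; exact: ltW.
  by rewrite !mulr_gt0.
move=> sigma V K psi nm ne su s y sI; have /andP[s1 s2] := sI.
have [q1 q0 qE] := q_facts su.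
have nm0 := su_nm su; have ne0 := su_ne su; have hfund := su_K su.
have sg1 := su_sigma su.
have hpsi := psi_L2 hchi hKc su.
pose T := sigma + lambda + 1.
have sV1' := sV1 su (T := T).
have sV2' t x : sigma < t < T -> `|V x t| <= Cv * ((1 + x ^+ 2) / Num.sqrt sigma ^+ 2).
  by rewrite qE; exact: sV2 hCv su _ _ _.
have [c [pb [pm [pe [cE psE pbE _ [hm [he pe0]]]]]]] := psi_split hchi hKc su.
have sq_s : Num.sqrt sigma <= Num.sqrt s by apply: ler_wsqrtr; exact: ltW.
rewrite !cE.
move: (Num.sqrt sigma) q1 q0 qE pe0 sV2' sq_s => q q1 q0 qE pe0 sV2' sq_s.
have [a0 a0E a00] : exists2 a0, a0 = `|c 0%N| & 0 <= a0 by exists `|c 0%N|.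
have [a1 a1E a10] : exists2 a0, a0 = `|c 1%N| & 0 <= a0 by exists `|c 1%N|.
have [a2 a2E a20] : exists2 a0, a0 = `|c 2%N| & 0 <= a0 by exists `|c 2%N|.
rewrite -a0E -a1E -a2E.
have q20 : 0 < q ^+ 2 by rewrite exprn_gt0.
have q30 : 0 < q ^+ 3 by rewrite exprn_gt0.
have [S SE S0] : exists2 S, S = (a0 + a1 + q * a2) / q ^+ 2 & 0 <= S.
  exists ((a0 + a1 + q * a2) / q ^+ 2) => //; apply: divr_ge0; last exact: ltW.
  by rewrite !addr_ge0// mulr_ge0// ltW.
have [N NE N0] : exists2 N, N = nm + ne / q ^+ 3 & 0 <= N.
  by exists (nm + ne / q ^+ 3) => //; rewrite addr_ge0// divr_ge0// ltW.
rewrite -SE -NE.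
(* the free evolution is small both where the potential acts and beyond the
   cut-off *)
have far t x v C : sigma <= t <= sigma + (lambda + 1) -> 0 < C ->
    v <= C * ((1 + x ^+ 2) / q ^+ 2) -> 0 <= v -> v * (1 + x ^+ 2) <= C * (wcub x / q) ->
    v * `|free_flow sigma (c 0%N) (c 1%N) (c 2%N) t x| <= 2 * C * L * S * wcub x.
  move=> tI C0 v1 v0 v2; have [w0 w1 w2 _] := wcub_ge x.
  have hf := free_flow_bound (c 0%N) (c 1%N) (c 2%N) x LE tI.
  apply: le_trans (ler_wpM2l v0 hf) _; rewrite -a0E -a1E -a2E.
  have x0 := normr_ge0 x; have x2 := ltW (one_sqr_gt0 x).
  have iq : 0 <= (q ^+ 2)^-1 by rewrite invr_ge0 ltW.
  have k0 : v * (L * a0) <= C * (wcub x / q ^+ 2) * (L * a0).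
    apply: ler_wpM2r; first by apply: mulr_ge0 => //; exact: ltW.
    apply: le_trans v1 _; apply: ler_wpM2l; first exact: ltW.
    exact: ler_wpM2r.
  have k1 : v * (L * (a1 * `|x|)) <= C * (wcub x / q ^+ 2) * (L * a1).
    rewrite (_ : v * _ = v * `|x| * (L * a1)); last by ring.
    apply: ler_wpM2r; first by apply: mulr_ge0 => //; exact: ltW.
    apply: le_trans (ler_wpM2r x0 v1) _.
    rewrite (_ : _ * `|x| = C * ((1 + x ^+ 2) * `|x| / q ^+ 2)); last by ring.
    apply: ler_wpM2l; first exact: ltW.
    exact: ler_wpM2r.
  have k2 : v * (a2 * (2 * (1 + x ^+ 2))) <= C * (wcub x / q) * (2 * a2).
    rewrite (_ : v * _ = v * (1 + x ^+ 2) * (2 * a2)); last by ring.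
    by apply: ler_wpM2r => //; exact: mulr_ge0.
  have k3 : C * (wcub x / q) * (2 * a2) <= C * (wcub x / q) * (2 * a2) * L.
    rewrite ler_peMr//; apply: mulr_ge0; last exact: mulr_ge0.
    by apply: mulr_ge0; [exact: ltW|apply: divr_ge0; exact: ltW].
  rewrite (mulrDr v) (mulrDr v (L * a0)).
  apply: le_trans (lerD (lerD k0 k1) (le_trans k2 k3)) _.
  rewrite -subr_ge0.
  have -> : 2 * C * L * S * wcub x - (C * (wcub x / q ^+ 2) * (L * a0) +
      C * (wcub x / q ^+ 2) * (L * a1) + C * (wcub x / q) * (2 * a2) * L) =
      C * (wcub x / q ^+ 2) * (L * (a0 + a1)).
    by rewrite SE; field; rewrite gt_eqF.
  apply: mulr_ge0; last by apply: mulr_ge0; [exact: ltW|exact: addr_ge0].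
  by apply: mulr_ge0; [exact: ltW|apply: divr_ge0; exact: ltW].
have hD : {ae mu, forall x, `|psi x - free_flow sigma (c 0%N) (c 1%N) (c 2%N) sigma x|
    <= 2 * N * wcub x}.
  have he' : {ae mu, forall x, `|pe x| <= ne * (2 * wcub x / q ^+ 3)}.
    apply: (ae_weight ne0 he pe0) => x; have [w0 _ _ w3] := wcub_ge x.
      by apply: divr_ge0; [apply: mulr_ge0 => //; exact: ltW|exact: ltW].
    move=> xK; rewrite ler_pdivlMr// mul1r; apply: le_trans w3.
    have qx : q <= `|x|.
      by apply: le_trans xK; rewrite ler_peMl ?(ltW q0)//; clear -hKc; lra.
    have : q ^+ 3 <= `|x| ^+ 3 by rewrite lerXn2r ?nnegrE// ltW.
    by move=> h; apply: le_trans h _; rewrite lerDr.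
  apply: ae_mono (ae_and hm he') => x [h1 h2].
  have -> : psi x - free_flow sigma (c 0%N) (c 1%N) (c 2%N) sigma x = pm x + pe x.
    by rewrite psE pbE /free_flow subrr mul0r expR0; ring.
  apply: le_trans (ler_normD _ _) _.
  have [w0 _ _ w3] := wcub_ge x.
  rewrite (_ : 2 * N * _ = nm * (2 * wcub x) + ne * (2 * wcub x / q ^+ 3)); last first.
    by rewrite NE; ring.
  by apply: lerD => //; apply: le_trans h1 _; exact: ler_wpM2l.
have hE t x : sigma < t < T ->
    `|V x t * free_flow sigma (c 0%N) (c 1%N) (c 2%N) t x| <= 2 * Cv * L * S * wcub x.
  move=> tI; rewrite normrM; apply: far => //.
  - by have /andP[t1 t2] := tI; rewrite (ltW t1) /=; clear -t2; rewrite /T in t2; lra.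
  - exact: sV2' tI.
  - by apply: potential_interpolation => //; [exact: sV1' tI|exact: sV2' tI].
have sT : sigma < T by rewrite /T; clear -hlambda; lra.
have E0 : 0 <= 2 * Cv * L * S by apply: mulr_ge0 => //; exact: ltW.
have D0 : 0 <= 2 * N by exact: mulr_ge0.
have sT' : sigma < s < T by rewrite s1 /T /=; clear -s2; lra.
have bar x := @flow_barrier R V sigma K psi hfund hpsi T Cv 7 (2 * N) (2 * Cv * L * S)
  (c 0%N) (c 1%N) (c 2%N) wcub _ _ sT sV1' (@is_derive_wcub R) (@is_derive_wcub' R)
  (@continuous_wcub'' R) (fun y => ltW (let: And4 w _ _ _ := wcub_ge y in w))
  (@wcub_super R) (ler0n _ 7) (ltW hCv) D0 E0 hD hE s x sT'.
have Tl : T - sigma = lambda + 1 by rewrite /T; ring.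
rewrite Tl -YE in bar.
have [F FE F0] : exists2 F, F = (2 * N + 2 * Cv * L * S * (lambda + 1)) * Y & 0 <= F.
  exists ((2 * N + 2 * Cv * L * S * (lambda + 1)) * Y) => //.
  apply: mulr_ge0; last exact: ltW.
  by apply: addr_ge0 => //; apply: mulr_ge0 => //; clear -hlambda; lra.
have {}bar x : `|K s sigma psi x - free_flow sigma (c 0%N) (c 1%N) (c 2%N) s x| <= F * wcub x.
  by rewrite FE; exact: bar.
have FC : F <= C2 * (S + N).
  rewrite FE C2E -subr_ge0.
  have -> : (2 + 2 * Cv * L * (lambda + 1)) * Y * (S + N) -
      (2 * N + 2 * Cv * L * S * (lambda + 1)) * Y =
      Y * (2 * S + 2 * Cv * L * (lambda + 1) * N) by ring.
  apply: mulr_ge0; first exact: ltW.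
  apply: addr_ge0; first exact: mulr_ge0.
  by apply: mulr_ge0 => //; apply: mulr_ge0; [exact: ltW|clear -hlambda; lra].
have cth : continuous (K s sigma psi).
  move=> x; have [_ hd _ _] := flow_slab hfund hpsi T.
  exact: derive_cont (hd s x sT').
move: (K s sigma psi) bar cth => th bar cth.
pose H x := free_flow sigma (c 0%N) (c 1%N) (c 2%N) s x.
pose chi x := cutoff chi0 Kc s x.
pose W x := chi x * (th x - H x) + - ((1 - chi x) * H x).
have cchi : continuous chi.
  have -> : chi = (fun x => cut chi0 0 (x / (Kc * Num.sqrt s))).
    by apply/funext => x; rewrite /chi (cutoffE hchi)//; clear -hKc; lra.
  move=> x; apply: derive_cont.
  have d1 : is_derive x 1 (fun x : R => x / (Kc * Num.sqrt s)) _ := dM (did x) (dconst _ x).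
  exact: (@dchain _ _ _ _ d1 (cut chi0 0) _ (is_derive_cut hchi 0 _)).
have cH : continuous H by rewrite /H /free_flow; cont.
have mW : measurable_fun setT W.
  by apply: continuous_measurable_fun; rewrite /W; cont.
have chiB x : `|chi x| <= B.
  by rewrite /chi (cutoffE hchi); [exact: hB|clear -hKc; lra].
have chiB' x : `|1 - chi x| <= 1 + B.
  by apply: le_trans (ler_normB _ _) _; rewrite normr1 lerD2l.
have hW x : `|W x| <= (B * F + (1 + B) * (2 * 1 * L * S)) * wcub x.
  have [w0 w1 w2 w3] := wcub_ge x.
  rewrite mulrDl; apply: le_trans (ler_normD _ _) _; rewrite normrN !normrM; apply: lerD.
    rewrite -mulrA; apply: (ler_pM (normr_ge0 _) (normr_ge0 _) (chiB x)).
    exact: bar.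
  have [xq|xq] := ltP `|x| q.
    have -> : chi x = 1.
      rewrite /chi (cutoffE hchi); last by clear -hKc; lra.
      rewrite (cut_inner hchi)// normrM normfV.
      have K0 : 0 < Kc * Num.sqrt s.
        by apply: mulr_gt0; [clear -hKc; lra|exact: lt_le_trans sq_s].
      rewrite (gtr0_norm K0) ltr_pdivrMr// mul1r; apply: lt_le_trans xq _.
      apply: le_trans sq_s _; rewrite ler_peMl ?sqrtr_ge0//.
      by clear -hKc; lra.
    rewrite subrr normr0 mul0r; apply: mulr_ge0; last exact: ltW.
    apply: mulr_ge0; first exact: ltW.
    by apply: mulr_ge0 => //; rewrite !mulr_ge0// ltW.
  have x0 := normr_ge0 x; have x1 := ltW (one_sqr_gt0 x).
  rewrite -(mulrA (1 + B)).
  apply: (ler_pM (normr_ge0 _) (normr_ge0 _) (chiB' x)).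
  rewrite -[leLHS]mul1r; apply: far => //.
  - by rewrite (ltW s1) /=; clear -s2; lra.
  - rewrite mul1r ler_pdivlMr// mul1r.
    have : q ^+ 2 <= `|x| ^+ 2 by rewrite lerXn2r ?nnegrE// ltW.
    by rewrite real_normK ?num_real// => h; apply: le_trans h _; rewrite lerDr.
  - rewrite !mul1r ler_pdivlMr//; apply: le_trans w2.
    exact: ler_wpM2l.
have F'0 : 0 <= B * F + (1 + B) * (2 * 1 * L * S).
  apply: addr_ge0; first exact: mulr_ge0.
  apply: mulr_ge0; first exact: ltW.
  by apply: mulr_ge0 => //; rewrite !mulr_ge0// ltW.
pose aa (k : nat) : R := if k is 0%N then c 0%N * expR (s - sigma)
  else if k is 1%N then c 1%N * expR ((s - sigma) / 2) else c 2%N.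
have split_b x : part_b chi0 Kc s th x = \sum_(m < 3) aa m * hermite m x + W x.
  rewrite (hermite_sum3 aa) /part_b -/(chi x) /W /aa /=.
  rewrite -/(free_flow sigma (c 0%N) (c 1%N) (c 2%N) s x) -/(H x).
  by move: (H x) (chi x) => h k; ring.
apply: le_trans (HC3 chi0 Kc s th W aa _ mW F'0 hW split_b y) _.
apply: ler_wpM2r; first by rewrite addr_ge0.
rewrite -(mulrA C3); apply: ler_wpM2l; first exact: ltW.
rewrite (mulrDl (B * C2)); apply: lerD.
  by rewrite -(mulrA B); apply: ler_wpM2l.
rewrite mulr1 -(mulrA (1 + B)); apply: ler_wpM2l; first exact: ltW.
apply: ler_wpM2l; first by apply: mulr_ge0 => //; exact: ltW.
by rewrite lerDl.
Qed.

End MinusEstimate.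

(** * Pairing a solution with a test function *)

Section WeakForm.
Set Implicit Arguments. Unset Strict Implicit.
Context {R : realType}.
Implicit Types (y : R).
Local Notation mu := (@lebesgue_measure R).

Lemma gauss_moment_segment k : exists2 C : R, 0 < C &
  forall (f : R -> R) c a b, continuous f -> 0 <= c ->
  (forall y, `|f y| <= c * ((1 + y ^+ 2) ^+ k * expR (y ^+ 2 / 16))) ->
  `|\int[mu]_(y in `[a, b]) (f y * rho y)| <= C * c.
Proof.
have [C C0 HC] := @poly_rho_le R k.
pose I := \int[mu]_y (@gauss8 R y).
have I0 : 0 < I by exact: integral_gauss8_gt0.
have cg : continuous (@gauss8 R) by rewrite /gauss8; cont.
exists (C * I); first exact: mulr_gt0.
move=> f c a b cf c0 hf; have cr := @continuous_rho R.
have up (g : R -> R) : continuous g ->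
    (forall y, `|g y| <= c * ((1 + y ^+ 2) ^+ k * expR (y ^+ 2 / 16))) ->
    \int[mu]_(y in `[a, b]) (g y * rho y) <= C * I * c.
  move=> cg' hg.
  have h1 : \int[mu]_(y in `[a, b]) (g y * rho y) <= \int[mu]_(y in `[a, b]) (c * C * gauss8 y).
    apply: le_integral_segment; [by cont|by cont|] => y _.
    have r0 := ltW (rho_gt0 y).
    apply: le_trans (ler_wpM2r r0 (le_trans (ler_norm _) (hg y))) _.
    by rewrite -mulrA -mulrA; apply: ler_wpM2l => //; exact: HC.
  apply: le_trans h1 _; rewrite integral_segmentZ//.
  rewrite (_ : C * I * c = c * C * I); last by ring.
  apply: ler_wpM2l; first by apply: mulr_ge0 => //; exact: ltW.
  apply: integral_segment_le => //; first by move=> y; exact: ltW (gauss8_gt0 y).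
  rewrite /I /Rintegral fineK//; apply: (@integrable_fin_num _ _ _ mu) => //.
  exact: integrable_gauss8.
rewrite ler_norml; apply/andP; split; last exact: up.
have -> : \int[mu]_(y in `[a, b]) (f y * rho y) = - \int[mu]_(y in `[a, b]) (- f y * rho y).
  rewrite -mulN1r -integral_segmentZ; last by cont.
  by apply: eq_Rintegral => y _; ring.
rewrite lerN2; apply: up; first by cont.
by move=> y; rewrite normrN.
Qed.

Lemma integral_supported (f : R -> R) a b : (forall y, ~~ (a <= y <= b) -> f y = 0) ->
  \int[mu]_y f y = \int[mu]_(y in `[a, b]) f y.
Proof.
move=> h; rewrite [RHS]Rintegral_mkcond; congr (Rintegral _ _ _).
apply/funext => y; rewrite patchE; case: ifPn => //; rewrite notin_setE /= in_itv /=.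
by move=> /negP/h.
Qed.

Section Pairing.
Variables (T : R -> R) (c : R).
Hypotheses (cT : continuous T) (hT : forall y, `|T y| <= c * (1 + y ^+ 2)).

Let iT : mu.-integrable setT (EFin \o (fun y => T y ^+ 2 * rho y)).
Proof.
have [C C0 HC] := @gauss_moment_poly R 2.
have [] := HC (fun y => T y ^+ 2) (c ^+ 2) _ (sqr_ge0 _) _ => //.
  by apply: continuous_measurable_fun; cont.
move=> y; rewrite -exprMn normrX lerXn2r ?nnegrE//.
by apply: le_trans (hT y).
Qed.

Lemma integrable_L2rho (g : R -> R) : in_L2rho g ->
  mu.-integrable setT (EFin \o (fun y => g y ^+ 2 * rho y)).
Proof.
move=> [mg ig]; have mr : measurable_fun setT (@rho R) := measurable_rho.
have m : measurable_fun setT (EFin \o (fun y => g y ^+ 2 * rho y)).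
  by apply/measurable_EFinP/measurable_funM => //; exact: measurable_funX.
apply/integrableP; split => //.
apply: le_lt_trans ig; apply: ge0_le_integral => //.
- exact: measurableT_comp.
- by move=> y _ /=; rewrite lee_fin ger0_norm// mulr_ge0 ?sqr_ge0// ltW// rho_gt0.
Qed.

(** Pairing with a fixed function of polynomial growth is continuous on
    [L^2_rho]; Young's inequality makes this quantitative without square
    roots. *)
Lemma pairing_le (g : R -> R) : in_L2rho g ->
  mu.-integrable setT (EFin \o (fun y => g y * T y * rho y)) /\
  forall eta, 0 < eta -> `|\int[mu]_y (g y * T y * rho y)| <=
    eta * \int[mu]_y (T y ^+ 2 * rho y) + eta^-1 * \int[mu]_y (g y ^+ 2 * rho y).
Proof.
move=> hg; have ig := integrable_L2rho hg; have [mg _] := hg.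
have young (eta : R) y : 0 < eta ->
    `|g y * T y * rho y| <= eta * (T y ^+ 2 * rho y) + eta^-1 * (g y ^+ 2 * rho y).
  move=> e0; have r0 := ltW (rho_gt0 y).
  rewrite normrM (ger0_norm r0).
  have -> : eta * (T y ^+ 2 * rho y) + eta^-1 * (g y ^+ 2 * rho y) =
      (eta * T y ^+ 2 + eta^-1 * g y ^+ 2) * rho y by ring.
  apply: ler_wpM2r => //.
  have h : forall t : R, t ^+ 2 = (g y * T y) ^+ 2 -> t <= eta * T y ^+ 2 + eta^-1 * g y ^+ 2.
    move=> t tE; have [t0|t0] := ltP t 0.
      apply: le_trans (ltW t0) _; apply: addr_ge0; apply: mulr_ge0; rewrite ?sqr_ge0 ?invr_ge0//; exact: ltW.
    rewrite -(@ler_pXn2r _ 2) ?nnegrE//; last first.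
      by apply: addr_ge0; apply: mulr_ge0; rewrite ?sqr_ge0 ?invr_ge0//; exact: ltW.
    rewrite tE -subr_ge0.
    have -> : (eta * T y ^+ 2 + eta^-1 * g y ^+ 2) ^+ 2 - (g y * T y) ^+ 2 =
        (eta * T y ^+ 2) ^+ 2 + (g y * T y) ^+ 2 + (eta^-1 * g y ^+ 2) ^+ 2.
      by field; rewrite gt_eqF.
    by apply: addr_ge0; [apply: addr_ge0|]; exact: sqr_ge0.
  by apply: h; rewrite real_normK ?num_real.
have scaled (eta : R) (f : R -> R) : mu.-integrable setT (EFin \o f) ->
    mu.-integrable setT (EFin \o (fun y => eta * f y)).
  move=> if_; rewrite (_ : EFin \o _ = (fun x => eta%:E * (EFin \o f) x)%E); last first.
    by apply/funext => x /=; rewrite EFinM.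
  exact: integrableZl.
have dom (eta : R) : mu.-integrable setT (EFin \o
    (fun y => eta * (T y ^+ 2 * rho y) + eta^-1 * (g y ^+ 2 * rho y))).
  have h := integrableD measurableT (scaled eta _ iT) (scaled eta^-1 _ ig).
  by apply: eq_integrable h => // y _ /=; rewrite EFinD.
have im : mu.-integrable setT (EFin \o (fun y => g y * T y * rho y)).
  apply: le_integrable (dom 1) => //.
    have mr : measurable_fun setT (@rho R) := measurable_rho.
    have mT := continuous_measurable_fun cT.
    by apply/measurable_EFinP/measurable_funM => //; exact: measurable_funM.
  move=> y _ /=; rewrite lee_fin; apply: le_trans (young 1 y ltr01) (ler_norm _).
split=> // eta e0; apply: le_trans (le_normr_Rintegral measurableT im) _.
have h : \int[mu]_y `|g y * T y * rho y| <=
    \int[mu]_y (eta * (T y ^+ 2 * rho y) + eta^-1 * (g y ^+ 2 * rho y)).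
  apply: le_Rintegral => //; first exact: (integrable_norm im).
  by move=> y _; exact: young.
apply: le_trans h _.
by rewrite (RintegralD measurableT (scaled eta _ iT) (scaled eta^-1 _ ig)) !RintegralZl.
Qed.

End Pairing.

(** The weak form of the equation: the operator is moved to the test function,
    the boundary terms [rho (w_y T - w T')] being zero. *)
Lemma weak_derivative (a b N s : R) (w ws wy wyy : R -> R -> R) (T T1 T2 : R -> R) :
  smooth_slab a b w ws wy wyy ->
  (forall y, is_derive y 1 T (T1 y)) -> (forall y, is_derive y 1 T1 (T2 y)) ->
  continuous T2 -> 0 < N -> T N = 0 -> T (- N) = 0 -> T1 N = 0 -> T1 (- N) = 0 ->
  a < s < b ->
  is_derive s 1 (fun t => \int[mu]_(y in `[- N, N]) (w t y * T y * rho y))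
    (\int[mu]_(y in `[- N, N]) ((w s y * (T2 y - y / 2 * T1 y + T y)
      + (ws s y - (wyy s y - y / 2 * wy s y + w s y)) * T y) * rho y)).
Proof.
move=> sm dT dT1 cT2 N0 TN TN' T1N T1N' sab.
have cT := derives_continuous dT; have cT1 := derives_continuous dT1.
have cr := @continuous_rho R.
have h := @derive_integral_segment R a b s (- N) N (fun t y => w t y * T y * rho y)
  (fun t y => ws t y * T y * rho y) sab.
have {}h : is_derive s 1 (fun t => \int[mu]_(y in `[- N, N]) (w t y * T y * rho y))
    (\int[mu]_(y in `[- N, N]) (ws s y * T y * rho y)).
  apply: h.
  - move=> t y tab; have := dM (dM (slab_ds sm y tab) (dconst (T y) t)) (dconst (rho y) t).
    by apply: deriv_ext => [//|] /=; ring.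
  - move=> t tab; have cw : continuous (w t) by move=> y; exact: derive_cont (slab_dy sm y tab).
    by cont.
  - move=> t y tab; have [_ h2 _ _] := slab_c sm y tab.
    apply: continuousM; last exact: continuous_of_snd.
    by apply: continuousM => //; exact: continuous_of_snd.
suff -> : \int[mu]_(y in `[- N, N]) ((w s y * (T2 y - y / 2 * T1 y + T y)
      + (ws s y - (wyy s y - y / 2 * wy s y + w s y)) * T y) * rho y) =
    \int[mu]_(y in `[- N, N]) (ws s y * T y * rho y) by [].
have cw : continuous (w s) by move=> y; exact: derive_cont (slab_dy sm y sab).
have cws : continuous (ws s) by move=> y; have [_ k _ _] := slab_c sm y sab; exact: slice_continuous k.
have cwy : continuous (wy s) by move=> y; have [_ _ k _] := slab_c sm y sab; exact: slice_continuous k.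
have cwyy : continuous (wyy s) by move=> y; have [_ _ _ k] := slab_c sm y sab; exact: slice_continuous k.
pose f y := (wyy s y * T y - w s y * T2 y - y / 2 * (wy s y * T y - w s y * T1 y)) * rho y.
have cf : continuous f by rewrite /f; cont.
have df y : is_derive y 1 (fun x => (wy s x * T x - w s x * T1 x) * rho x) (f y).
  have := dM (dB (dM (slab_dyy sm y sab) (dT y)) (dM (slab_dy sm y sab) (dT1 y))) (is_derive_rho y).
  by apply: deriv_ext => [//|] /=; rewrite /f; field.
have flux := FTC_segment (_ : - N < N) df cf.
have f0 : \int[mu]_(y in `[- N, N]) f y = 0.
  by rewrite flux; [rewrite TN TN' T1N T1N'; ring|clear -N0; lra].
transitivity (\int[mu]_(y in `[- N, N]) (ws s y * T y * rho y + -1 * f y)).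
  by apply: eq_Rintegral => y _; rewrite /f; ring.
rewrite integral_segmentD; [|by cont..].
by rewrite integral_segmentZ// f0 mulr0 addr0.
Qed.

End WeakForm.

(** * The estimate of the second mode *)

Section TestFunction.
Set Implicit Arguments. Unset Strict Implicit.
Context {R : realType}.
Implicit Types (y : R).
Local Notation mu := (@lebesgue_measure R).

(** Since [k_2'' - y/2 k_2' + k_2 = 0], applying [L] to the truncated [k_2]
    only leaves terms carrying a derivative of the cut-off, and these are
    supported where [y^2 >= r^2]. *)
Lemma test_function (chi0 : R -> R) (hchi : cutoff_profile chi0) :
  exists2 C, 0 < C & forall r, 1 <= r -> exists T1 T2 : R -> R,
  let T y := cut chi0 0 (y / r) * hermite_dual 2 y in
  [/\ forall y, is_derive y 1 T (T1 y), forall y, is_derive y 1 T1 (T2 y), continuous T2,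
      forall y, 2 * r < `|y| -> T y = 0 /\ T1 y = 0 &
      forall y, `|T y| <= C * (1 + y ^+ 2) /\
        `|T2 y - y / 2 * T1 y + T y| <= C * ((1 + y ^+ 2) ^+ 3 / r ^+ 2)].
Proof.
have [n nE n0] : exists2 n, n = (\int[mu]_x (hermite 2 x ^+ 2 * rho x))^-1 & 0 < n.
  exists (\int[mu]_x (hermite 2 x ^+ 2 * rho x))^-1 => //.
  by rewrite invr_gt0; exact: hermite_norm_gt0.
have kE y : hermite_dual 2 y = n * (y ^+ 2 - 2) by rewrite /hermite_dual -nE hermite2E mulrC.
have [B0 B0p h0] := cut_bounded hchi 0.
have [B1 B1p h1] := cut_derivative_le hchi 0.
have [B2 B2p h2] := cut_bounded hchi 2.
exists (n * (2 * B0 + 5 * B1 + 2 * B2 + 1)).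
  by apply: mulr_gt0 => //; clear -B0p B1p B2p; lra.
move=> r r1; have r0 : 0 < r by clear -r1; lra.
have rn : r != 0 by rewrite gt_eqF.
pose c m y := cut chi0 m (y / r).
have dc m y : is_derive y 1 (c m) (c m.+1 y / r).
  have d1 : is_derive y 1 (fun x : R => x / r) _ := dM (did y) (dconst _ y).
  have := @dchain _ _ _ _ d1 (cut chi0 m) _ (is_derive_cut hchi m _).
  by apply: deriv_ext => [//|]; rewrite /c; ring.
have cc m : continuous (c m) by exact: derives_continuous (dc m).
pose T1 y := c 1%N y / r * (n * (y ^+ 2 - 2)) + c 0%N y * (n * (2 * y)).
pose T2 y := c 2%N y / r / r * (n * (y ^+ 2 - 2)) + 2 * (c 1%N y / r) * (n * (2 * y))
  + c 0%N y * (n * 2).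
have dk y : is_derive y 1 (fun y => n * (y ^+ 2 - 2)) (n * (2 * y)).
  have := dZ (dB (dX (did y) 2) (dconst 2 y)) n.
  by apply: deriv_ext => [//|] /=; ring.
have TE : (fun y => cut chi0 0 (y / r) * hermite_dual 2 y) = (fun y => c 0%N y * (n * (y ^+ 2 - 2))).
  by apply/funext => y; rewrite kE.
have TE' y : cut chi0 0 (y / r) * hermite_dual 2 y = c 0%N y * (n * (y ^+ 2 - 2)) by rewrite kE.
have ck : continuous (c 0%N) := cc 0%N.
have ck1 : continuous (c 1%N) := cc 1%N.
have ck2 : continuous (c 2%N) := cc 2%N.
exists T1, T2; rewrite TE /=; split.
- move=> y; have := dM (dc 0%N y) (dk y).
  by apply: deriv_ext => [//|]; rewrite /T1; ring.
- move=> y; have := dD (dM (dM (dc 1%N y) (dconst r^-1 y)) (dk y))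
    (dM (dc 0%N y) (dZ (dZ (did y) 2) n)).
  by apply: deriv_ext => [//|]; rewrite /T2; ring.
- by rewrite /T2; cont.
- move=> y yr; have z2 : 2 < `|y / r| by rewrite normrM normfV (gtr0_norm r0) ltr_pdivlMr.
  by rewrite /T1 /c !(cut_outer hchi) ?mul0r ?addr0.
move=> y; have y2 := sqr_ge0 y.
have s1 : 1 <= 1 + y ^+ 2 by clear -y2; lra.
have s0 : 0 <= 1 + y ^+ 2 by clear -y2; lra.
have k2 : `|y ^+ 2 - 2| <= 2 * (1 + y ^+ 2) by rewrite ler_norml; clear -y2; apply/andP; split; lra.
have k1 : `|y| <= 1 + y ^+ 2.
  by rewrite ler_norml; have := sqr_ge0 (y - 1); have := sqr_ge0 (y + 1); clear -y2;
    rewrite sqrrD1 sqrrB1 => a b; apply/andP; split; lra.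
have c0B : `|c 0%N y| <= B0 by exact: h0.
have c2B : `|c 2%N y| <= B2 by exact: h2.
have c1B : `|c 1%N y / r| <= B1 * ((1 + y ^+ 2) / r ^+ 2).
  rewrite normrM normfV (gtr0_norm r0) ler_pdivrMr//.
  apply: le_trans (h1 (y / r)) _; rewrite -mulrA; apply: ler_wpM2l => //.
  rewrite expr_div_n (mulrAC (1 + y ^+ 2)); apply: ler_wpM2r; first by rewrite invr_ge0 sqr_ge0.
  apply: (@le_trans _ _ (1 + y ^+ 2)); first by clear; lra.
  by rewrite ler_peMr.
have E : T2 y - y / 2 * T1 y + c 0%N y * (n * (y ^+ 2 - 2)) =
    n * (c 2%N y / r ^+ 2 * (y ^+ 2 - 2) + (c 1%N y / r) * (4 * y)
      - (c 1%N y / r) * (y * (y ^+ 2 - 2) / 2)).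
  by rewrite /T1 /T2; field.
rewrite E {E}; move: (c 0%N y) (c 2%N y) (c 1%N y / r) c0B c2B c1B => c0 c2 c1 c0B c2B c1B.
have BB : 0 <= 2 * B0 + 5 * B1 + 2 * B2 + 1 by clear -B0p B1p B2p; lra.
split.
  rewrite normrM (normrM n) (gtr0_norm n0) mulrCA -(mulrA n); apply: ler_wpM2l; first exact: ltW.
  apply: le_trans (ler_pM (normr_ge0 _) (normr_ge0 _) c0B k2) _.
  rewrite mulrCA mulrA; apply: ler_wpM2r => //; clear -B0p B1p B2p; lra.
rewrite normrM (gtr0_norm n0) -(mulrA n); apply: ler_wpM2l; first exact: ltW.
have [u uE u0] : exists2 u, u = (1 + y ^+ 2) / r ^+ 2 & 0 <= u.
  by exists ((1 + y ^+ 2) / r ^+ 2) => //; apply: divr_ge0 => //; exact: sqr_ge0.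
have -> : (1 + y ^+ 2) ^+ 3 / r ^+ 2 = u * (1 + y ^+ 2) ^+ 2 by rewrite uE; field.
rewrite -uE in c1B.
have ss : 1 + y ^+ 2 <= (1 + y ^+ 2) ^+ 2 by rewrite expr2 ler_peMr.
have t2 : `|c2 / r ^+ 2 * (y ^+ 2 - 2)| <= 2 * B2 * u.
  rewrite !normrM normfV (ger0_norm (sqr_ge0 r)) uE.
  have -> : `|c2| / r ^+ 2 * `|y ^+ 2 - 2| = `|c2| * (`|y ^+ 2 - 2| / r ^+ 2) by field.
  have -> : 2 * B2 * ((1 + y ^+ 2) / r ^+ 2) = B2 * (2 * (1 + y ^+ 2) / r ^+ 2) by field.
  apply: ler_pM => //; first by apply: divr_ge0 => //; exact: sqr_ge0.
  by apply: ler_wpM2r => //; rewrite invr_ge0 sqr_ge0.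
have t1 : `|c1 * (4 * y)| <= B1 * u * (4 * (1 + y ^+ 2) ^+ 2).
  rewrite normrM; apply: ler_pM => //; rewrite normrM ger0_norm//.
  by apply: ler_wpM2l => //; exact: le_trans ss.
have t3 : `|c1 * (y * (y ^+ 2 - 2) / 2)| <= B1 * u * (1 + y ^+ 2) ^+ 2.
  rewrite normrM; apply: ler_pM => //; rewrite !normrM normfV (@ger0_norm _ 2)//.
  rewrite ler_pdivrMr// (expr2 (1 + _)) -mulrA; apply: ler_pM => //.
  by rewrite (mulrC _ 2).
apply: le_trans (ler_normB _ _) _; apply: le_trans (lerD (ler_normD _ _) (lexx _)) _.
apply: le_trans (lerD (lerD t2 t1) t3) _.
have s2 : 1 <= (1 + y ^+ 2) ^+ 2 by apply: le_trans ss.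
have t2' : 2 * B2 * u <= 2 * B2 * (u * (1 + y ^+ 2) ^+ 2).
  by apply: ler_wpM2l; [exact: mulr_ge0|rewrite ler_peMr].
have p : 0 <= (2 * B0 + 1) * (u * (1 + y ^+ 2) ^+ 2).
  by apply: mulr_ge0; [clear -B0p; lra|apply: mulr_ge0 => //; exact: sqr_ge0].
by move: t2' p; move: ((1 + y ^+ 2) ^+ 2) => w; clear; lra.
Qed.

(** The exterior part of the data lives where [y^2 >= 9 sigma], so against the
    weight [exp (y^2 / 16)], which [rho] still absorbs, it is exponentially
    small. *)
Lemma flow_growth chi0 Kc Cv sigma V K psi nm ne lambda (hchi : cutoff_profile chi0)
    (K3 : 3 <= Kc) (Cv0 : 0 < Cv) (l0 : 0 < lambda)
    (su : setup chi0 Kc Cv sigma V K psi nm ne) (s y : R) : sigma < s <= sigma + lambda ->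
  `|K s sigma psi y| <= 4 * expR ((7 + Cv) * (lambda + 1)) *
    (`|part_mode chi0 Kc sigma psi 0| + `|part_mode chi0 Kc sigma psi 1|
      + `|part_mode chi0 Kc sigma psi 2| + nm + ne * expR (- (sigma / 2))) *
    ((1 + y ^+ 2) ^+ 2 * expR (y ^+ 2 / 16)).
Proof.
move=> sI; have /andP[s1 s2] := sI.
have [q1 q0 qE] := q_facts su.
have nm0 := su_nm su; have ne0 := su_ne su; have hfund := su_K su.
have hpsi := psi_L2 hchi K3 su.
have [T TE] : exists T, T = sigma + lambda + 1 by exists (sigma + lambda + 1).
have sV1' := sV1 su (T := T).
have [c [pb [pm [pe [cE psE pbE _ [hm [he pe0]]]]]]] := psi_split hchi K3 su.
rewrite !cE.
have [S SE S0] : exists2 S, S = `|c 0%N| + `|c 1%N| + `|c 2%N| & 0 <= S.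
  by exists (`|c 0%N| + `|c 1%N| + `|c 2%N|) => //; rewrite !addr_ge0.
have [e eE e0] : exists2 e, e = ne * expR (- (sigma / 2)) & 0 <= e.
  by exists (ne * expR (- (sigma / 2))) => //; rewrite mulr_ge0// expR_ge0.
rewrite -SE -eE.
pose A := 2 * (S + nm).
have A0 : 0 <= A by apply: mulr_ge0 => //; exact: addr_ge0.
pose G y := A * wcub y + e * wexp y.
have G0 x : 0 <= G x.
  by apply: addr_ge0; apply: mulr_ge0 => //; apply: ltW; [have [] := wcub_ge x|exact: wexp_gt0].
have dG (x : R) : is_derive x 1 G _ := dD (dZ (is_derive_wcub x) A) (dZ (is_derive_wexp x) e).
have dG1 (x : R) := dD (dZ (is_derive_wcub' x) A) (dZ (is_derive_wexp' x) e).
have cG2 := cD (cM (@cC R A) (@continuous_wcub'' R)) (cM (@cC R e) (@continuous_wexp'' R)).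
have hD : {ae mu, forall x, `|psi x - free_flow sigma 0 0 0 sigma x| <= 1 * G x}.
  have he' : {ae mu, forall x, `|pe x| <= ne * (wexp x * expR (- (sigma / 2)))}.
    apply: (ae_weight ne0 he pe0) => x.
      by apply: mulr_ge0; [exact: ltW (wexp_gt0 _)|exact: expR_ge0].
    move=> xK; rewrite /wexp -expRD -[leLHS]expR0 ler_expR.
    have : (Kc * Num.sqrt sigma) ^+ 2 <= `|x| ^+ 2.
      by rewrite lerXn2r ?nnegrE//; apply: mulr_ge0; [clear -K3; lra|exact: ltW].
    rewrite real_normK ?num_real// exprMn qE => h1.
    have h2 : 9 * sigma <= Kc ^+ 2 * sigma.
      apply: ler_wpM2r; first by rewrite -qE sqr_ge0.
      by rewrite (_ : 9 = 3 ^+ 2 :> R); [rewrite lerXn2r ?nnegrE//; clear -K3; lra|ring].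
    have sg := su_sigma su; clear -h1 h2 sg; lra.
  apply: ae_mono (ae_and hm he') => x [h1 h2]; have [w0 _ _ w3] := wcub_ge x.
  rewrite free_flow0 subr0 mul1r psE pbE.
  have -> : G x = 2 * S * wcub x + nm * (2 * wcub x) + ne * (wexp x * expR (- (sigma / 2))).
    by rewrite /G /A eE; ring.
  apply: le_trans (ler_normD _ _) _; apply: (lerD _ h2).
  apply: le_trans (ler_normD _ _) _; apply: lerD; first by rewrite SE; exact: modes_wcub.
  by apply: le_trans h1 _; exact: ler_wpM2l.
have sT : sigma < T by rewrite TE; clear -l0; lra.
have sT' : sigma < s < T by rewrite s1 TE /=; clear -s2; lra.
have hsup x : A * (3 * Num.sqrt (1 + x ^+ 2) + 3 * x ^+ 2 / Num.sqrt (1 + x ^+ 2))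
    + e * ((1 / 8 + x ^+ 2 / 64) * wexp x) -
    x / 2 * (A * (3 * x * Num.sqrt (1 + x ^+ 2)) + e * (x / 8 * wexp x)) + G x <= 7 * G x.
  have h1 := ler_wpM2l A0 (wcub_super x); have h2 := ler_wpM2l e0 (wexp_super x).
  rewrite /G; apply: le_trans (_ : _ <= A * (7 * wcub x) + e * (7 * wexp x)) _; last first.
    by rewrite mulrDr !(mulrCA 7).
  apply: le_trans (lerD h1 h2); rewrite le_eqVlt; apply/orP; left; apply/eqP.
  by move: (Num.sqrt _)^-1 => i; ring.
have hE t x : sigma < t < T -> `|V x t * free_flow sigma 0 0 0 t x| <= 0 * G x.
  by move=> _; rewrite free_flow0 mulr0 normr0 mul0r.
have := @flow_barrier R V sigma K psi hfund hpsi T Cv 7 1 0 0 0 0 G _ _ sT sV1' dG dG1 cG2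
  G0 hsup (ler0n _ 7) (ltW Cv0) ler01 (lexx 0) hD hE s y sT'.
have Tl : T - sigma = lambda + 1 by rewrite TE; ring.
rewrite Tl free_flow0 subr0 mul0r addr0 mul1r => h; apply: le_trans h _.
have [w4 _] := wcub_le y; have [w0 _ _ _] := wcub_ge y.
have e1 : 1 <= expR (y ^+ 2 / 16) := weight_ge1 y.
have y2 : 1 <= (1 + y ^+ 2) ^+ 2 by rewrite expr_ge1//; have := sqr_ge0 y; clear; lra.
have g1 : wcub y <= (1 + y ^+ 2) ^+ 2 * expR (y ^+ 2 / 16).
  by apply: le_trans w4 _; rewrite ler_peMr// (le_trans _ y2).
have g2 : wexp y <= (1 + y ^+ 2) ^+ 2 * expR (y ^+ 2 / 16).
  by rewrite /wexp ler_peMl// expR_ge0.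
rewrite /G /A; move: (wcub y) (wexp y) ((1 + y ^+ 2) ^+ 2 * expR (y ^+ 2 / 16)) w0 g1 g2.
move=> u v w u0 g1 g2.
rewrite (mulrC 4) -!mulrA; apply: ler_wpM2l; first exact: expR_ge0.
have SN : 0 <= S + nm by exact: addr_ge0.
have k1 := ler_wpM2l SN g1; have k2 := ler_wpM2l e0 g2.
have p1 : 0 <= (S + nm) * w by apply: mulr_ge0 => //; exact: le_trans (ltW u0) g1.
have p2 : 0 <= e * w by apply: mulr_ge0 => //; exact: le_trans (ltW u0) g1.
by clear -k1 k2 p1 p2; lra.
Qed.


End TestFunction.

Section ModeEstimate.
Set Implicit Arguments. Unset Strict Implicit.
Context {R : realType}.
Implicit Types (y : R).
Local Notation mu := (@lebesgue_measure R).

Lemma flow_pairing_continuous V sigma K psi (T : R -> R) c (e : R) :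
  fundamental_solution V sigma K -> in_L2rho psi ->
  continuous T -> (forall y, `|T y| <= c * (1 + y ^+ 2)) -> 0 < e ->
  exists2 d, 0 < d & forall t, sigma <= t -> t < sigma + d ->
  `|\int[mu]_y (K t sigma psi y * T y * rho y) -
    \int[mu]_y (K sigma sigma psi y * T y * rho y)| <= e.
Proof.
move=> hK hpsi cT hT e0.
pose Q := \int[mu]_y (T y ^+ 2 * rho y).
have Q0 : 0 <= Q.
  by apply: Rintegral_ge0 => y _; rewrite mulr_ge0 ?sqr_ge0// ltW// rho_gt0.
have Q1 : 0 < Q + 1 by clear -Q0; lra.
pose h := e / (Q + 1); have h0 : 0 < h by exact: divr_gt0.
have [d d0 hd] := flow_continuous hK hpsi (lexx sigma) (exprn_gt0 2 h0).
exists d => // t t1 t2.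
have td : sigma - d < t < sigma + d by apply/andP; split => //; clear -d0 t1; lra.
have {}hd := hd t t1 td.
have Lt := flow_L2 hK hpsi t1; have Ls := flow_L2 hK hpsi (lexx sigma).
have [it _] := pairing_le cT hT Lt; have [is_ _] := pairing_le cT hT Ls.
have Ld : in_L2rho (fun y => K t sigma psi y - K sigma sigma psi y).
  split; last exact: le_lt_trans hd (ltry _).
  by apply: measurable_funB; [exact: (proj1 Lt)|exact: (proj1 Ls)].
have [id hl] := pairing_le cT hT Ld.
rewrite -RintegralB//.
have -> : \int[mu]_y (K t sigma psi y * T y * rho y - K sigma sigma psi y * T y * rho y) =
    \int[mu]_y ((K t sigma psi y - K sigma sigma psi y) * T y * rho y).
  by apply: eq_Rintegral => y _; rewrite -!mulrBl.
apply: le_trans (hl h h0) _.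
have hQ : \int[mu]_y ((K t sigma psi y - K sigma sigma psi y) ^+ 2 * rho y) <= h ^+ 2.
  rewrite /Rintegral -lee_fin fineK//; apply: (@integrable_fin_num _ _ _ mu) => //.
  exact: integrable_L2rho.
have k : h^-1 * \int[mu]_y ((K t sigma psi y - K sigma sigma psi y) ^+ 2 * rho y) <= h.
  rewrite -[leRHS](_ : h^-1 * h ^+ 2 = h); last by field; rewrite gt_eqF.
  by apply: ler_wpM2l => //; rewrite invr_ge0 ltW.
apply: le_trans (lerD (lexx _) k) _.
rewrite -/Q (_ : h * Q + h = h * (Q + 1)); last by ring.
by rewrite /h divfK// gt_eqF.
Qed.

(** Two things change between [sigma] and [s]: the cut-off, by
    [O((s - sigma) / sigma)], and the solution, whose pairing [J] with the fixed
    test function [chi(sigma) k_2] moves at speed [O(1 / sigma)] by the weak form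
    of the equation.  This speed is bounded only at positive distance from
    [sigma], where the solution is smooth, so the initial time is reached by
    the continuity of [J]. *)
Lemma mode_estimate (chi0 : R -> R) (hchi : cutoff_profile chi0)
    (Kc lambda Cv : R) (hKc : 3 <= Kc) (hlambda : 0 < lambda) (hCv : 0 < Cv) :
  exists2 C, 0 < C &
  forall sigma V K psi nm ne, setup chi0 Kc Cv sigma V K psi nm ne ->
  forall s, sigma < s <= sigma + lambda ->
  `|part_mode chi0 Kc s (K s sigma psi) 2 - part_mode chi0 Kc sigma psi 2| <=
    C * ((s - sigma) / sigma * (`|part_mode chi0 Kc sigma psi 0|
      + `|part_mode chi0 Kc sigma psi 1| + `|part_mode chi0 Kc sigma psi 2|
      + nm + ne * expR (- (sigma / 2)))).
Proof.
have [B B0 hB] := cutoff_lipschitz hchi.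
have [Ck Ck0 hk] := @hermite_dual_le R.
have [Cg Cg0 hg] := @gauss_moment R 3.
have [C5 C50 h5] := @gauss_moment_segment R 5.
have [Ct Ct0 htest] := test_function hchi.
have [E EE E0] : exists2 E, E = 4 * expR ((7 + Cv) * (lambda + 1)) & 0 < E.
  by exists (4 * expR ((7 + Cv) * (lambda + 1))) => //; rewrite mulr_gt0// expR_gt0.
have Cv1 : 0 < 1 + Cv by clear -hCv; lra.
have B1 : 0 < B + 1 by clear -B0; lra.
have K0 : 0 < Kc by clear -hKc; lra.
exists (E * (Cg * ((B + 1) * Ck) + C5 * (Ct * (1 + Cv)))).
  by apply: mulr_gt0 => //; apply: addr_gt0; rewrite !mulr_gt0.
move=> sigma V K psi nm ne su s sI; have /andP[s1 s2] := sI.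
have [q1 q0 qE] := q_facts su; have hK := su_K su; have hpsi := psi_L2 hchi hKc su.
have sg1 := su_sigma su; have sg0 : 0 < sigma by clear -sg1; lra.
have grow t y : sigma < t <= sigma + lambda -> _ := flow_growth hchi hKc hCv hlambda su y.
rewrite -EE in grow; have nm0 := su_nm su; have ne0 := su_ne su.
have [M ME M0] : exists2 M, M = `|part_mode chi0 Kc sigma psi 0|
      + `|part_mode chi0 Kc sigma psi 1| + `|part_mode chi0 Kc sigma psi 2|
      + nm + ne * expR (- (sigma / 2)) & 0 <= M.
  exists (`|part_mode chi0 Kc sigma psi 0|
      + `|part_mode chi0 Kc sigma psi 1| + `|part_mode chi0 Kc sigma psi 2|
      + nm + ne * expR (- (sigma / 2))) => //.
  by rewrite !addr_ge0// mulr_ge0// expR_ge0.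
rewrite -ME; rewrite -ME in grow.
pose r := Kc * Num.sqrt sigma.
have r1 : 1 <= r.
  by rewrite /r; apply: le_trans q1 _; rewrite ler_peMl ?(ltW q0)//; clear -hKc; lra.
have rs : (r ^+ 2)^-1 <= sigma^-1.
  rewrite lef_pV2 ?posrE//; last by rewrite exprn_gt0//; clear -r1; lra.
  rewrite /r exprMn qE ler_peMl ?(ltW sg0)// expr_ge1//; last exact: ltW.
  by clear -hKc; lra.
have [T1 [T2 [dT dT1 cT2 Tout TB]]] := htest r r1.
pose T y := cut chi0 0 (y / r) * hermite_dual 2 y.
have cT : continuous T := derives_continuous dT.
have cT1 := derives_continuous dT1.
have hT y : `|T y| <= Ct * (1 + y ^+ 2) by have [h _] := TB y.
have hLT y : `|T2 y - y / 2 * T1 y + T y| <= Ct * ((1 + y ^+ 2) ^+ 3 / r ^+ 2) by have [_ h] := TB y.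
have {TB}cutE y : cutoff chi0 Kc sigma y = cut chi0 0 (y / r) by exact: cutoffE.
pose J t := \int[mu]_y (K t sigma psi y * T y * rho y).
have F0 : 0 <= E * M by apply: mulr_ge0 => //; exact: ltW.
have p1 y : 1 <= 1 + y ^+ 2 by rewrite lerDl sqr_ge0.
have p0 y : 0 <= 1 + y ^+ 2 := le_trans ler01 (p1 y).
have sm := flow_slab hK hpsi (sigma + lambda + 1).
have slabI t : sigma < t <= sigma + lambda -> sigma < t < sigma + lambda + 1.
  by move=> /andP[t1 t2]; apply/andP; split => //; clear -t2; lra.
have csl t : sigma < t <= sigma + lambda -> continuous (K t sigma psi).
  by move=> tI y; exact: derive_cont (slab_dy sm y (slabI t tI)).
have cut_part : `|part_mode chi0 Kc s (K s sigma psi) 2 - J s| <=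
    Cg * (E * M * (B * (s - sigma) / sigma) * Ck).
  pose f y := K s sigma psi y * (cutoff chi0 Kc s y - cutoff chi0 Kc sigma y) * hermite_dual 2 y.
  have fB y : `|f y| <= E * M * (B * (s - sigma) / sigma) * Ck * ((1 + y ^+ 2) ^+ 3 * expR (y ^+ 2 / 16)).
    have h1 := grow s y sI; have h2 := hB Kc sigma s y K0 sg0 (ltW s1).
    have h3 := hk 2%N y isT.
    have h12 := ler_pM (normr_ge0 _) (normr_ge0 _) h1 h2.
    have := ler_pM (mulr_ge0 (normr_ge0 _) (normr_ge0 _)) (normr_ge0 _) h12 h3.
    rewrite -!normrM => h; apply: le_trans h _; rewrite le_eqVlt; apply/orP; left; apply/eqP.
    by move: (expR _) => x; ring.
  have cf : continuous f.
    have cs := csl s sI; have ck := @continuous_hermite_dual R 2 isT.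
    have cc (Kr : R) : continuous (fun x : R => cut chi0 0 (x / Kr)).
      move=> x; apply: derive_cont.
      have d1 : is_derive x 1 (fun x : R => x / Kr) _ := dM (did x) (dconst _ x).
      exact: (@dchain _ _ _ _ d1 (cut chi0 0) _ (is_derive_cut hchi 0 _)).
    have c1 : continuous (fun y => cutoff chi0 Kc s y).
      have -> : (fun y => cutoff chi0 Kc s y) = (fun y => cut chi0 0 (y / (Kc * Num.sqrt s))).
        by apply/funext => y; exact: cutoffE.
      exact: cc.
    have c2 : continuous (fun y => cutoff chi0 Kc sigma y).
      have -> : (fun y => cutoff chi0 Kc sigma y) = (fun y => cut chi0 0 (y / r)).
        by apply/funext => y; exact: cutE.
      exact: cc.
    exact: cM (cM cs (cD c1 (cN c2))) ck.
  have cst0 : 0 <= E * M * (B * (s - sigma) / sigma) * Ck.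
    apply: mulr_ge0; last exact: ltW.
    apply: mulr_ge0 => //; apply: divr_ge0; last exact: ltW.
    by apply: mulr_ge0 => //; clear -s1; lra.
  have [if_ bf] := hg f _ (continuous_measurable_fun cf) cst0 fB.
  have [iJ _] := pairing_le cT hT (flow_L2 hK hpsi (ltW s1)).
  suff -> : part_mode chi0 Kc s (K s sigma psi) 2 - J s = \int[mu]_y (f y * rho y) by [].
  apply/eqP; rewrite subr_eq addrC; apply/eqP; rewrite /J -RintegralD//.
  apply: eq_Rintegral => y _; rewrite /part_b /f /T cutE.
  by move: (K s sigma psi y) (hermite_dual 2 y) (rho y) (cutoff _ _ _ _) (cut _ _ _) => *; ring.
pose N := 2 * r + 1.
have N0 : 0 < N by rewrite /N; clear -r1; lra.
have Nout y : N <= `|y| -> T y = 0 /\ T1 y = 0.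
  by move=> h; apply: Tout; apply: lt_le_trans h; rewrite /N; clear; lra.
have NN : N <= `|N| by exact: ler_norm.
have NN' : N <= `|- N| by rewrite normrN ler_norm.
have JN t : J t = \int[mu]_(y in `[- N, N]) (K t sigma psi y * T y * rho y).
  apply: integral_supported => y; rewrite -ler_norml -ltNge => yN.
  by have [-> _] := Nout y (ltW yN); rewrite mulr0 mul0r.
pose D t := \int[mu]_(y in `[- N, N])
  ((K t sigma psi y * (T2 y - y / 2 * T1 y + T y)
    + (derive1 (fun t => K t sigma psi y) t - (derive1n 2 (K t sigma psi) y
       - y / 2 * derive1 (K t sigma psi) y + K t sigma psi y)) * T y) * rho y).
have dJ t : sigma < t <= sigma + lambda -> is_derive t 1 J (D t).
  move=> tI; rewrite (_ : J = fun t => \int[mu]_(y in `[- N, N]) (K t sigma psi y * T y * rho y)).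
    exact: (weak_derivative sm dT dT1 cT2 N0 (Nout _ NN).1 (Nout _ NN').1
      (Nout _ NN).2 (Nout _ NN').2 (slabI t tI)).
  by apply/funext => u; exact: JN.
have S0 : 0 <= E * M * (Ct * (1 + Cv)) / sigma.
  apply: divr_ge0; last exact: ltW.
  by apply: mulr_ge0 => //; apply: mulr_ge0; exact: ltW.
have D_le t : sigma < t <= sigma + lambda -> `|D t| <= C5 * (E * M * (Ct * (1 + Cv)) / sigma).
  move=> tI; have tS := slabI t tI; apply: h5 => //.
    have cs := csl t tI.
    have cws : continuous (fun y => derive1 (fun t => K t sigma psi y) t).
      by move=> y; have [_ k _ _] := slab_c sm y tS; exact: slice_continuous k.
    have cwy : continuous (fun y => derive1 (K t sigma psi) y).
      by move=> y; have [_ _ k _] := slab_c sm y tS; exact: slice_continuous k.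
    have cwyy : continuous (fun y => derive1n 2 (K t sigma psi) y).
      by move=> y; have [_ _ _ k] := slab_c sm y tS; exact: slice_continuous k.
    apply: cD; first by apply: cM => //; cont.
    apply: cM => //; apply: cD => //; apply: cN; apply: cD => //; apply: cD => //; apply: cN.
    by apply: cM => //; cont.
  move=> y; have /andP[t1 _] := tI.
  have -> : derive1 (fun t => K t sigma psi y) t - (derive1n 2 (K t sigma psi) y
      - y / 2 * derive1 (K t sigma psi) y + K t sigma psi y) = V y t * K t sigma psi y.
    by rewrite (flow_eqn hK hpsi y t1) addrC addKr.
  have h1 := grow t y tI; have h2 := hLT y; have h3 := hT y; have h4 := su_V2 su y (ltW t1).
  have ti : t^-1 <= sigma^-1 by rewrite lef_pV2 ?posrE//; [exact: ltW|exact: lt_trans t1].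
  move: (K t sigma psi y) (V y t) (T y) (T2 y - y / 2 * T1 y + T y) h1 h2 h3 h4 => k v T0 LT h1 h2 h3 h4.
  have pp m : 0 <= (1 + y ^+ 2) ^+ m by exact: exprn_ge0.
  have {}h2 : `|LT| <= Ct * (1 + y ^+ 2) ^+ 3 / sigma.
    by apply: le_trans h2 _; rewrite mulrA; apply: ler_wpM2l => //; apply: mulr_ge0 => //; exact: ltW.
  have {}h3 : `|v * T0| <= Cv * Ct * (1 + y ^+ 2) ^+ 3 / sigma.
    rewrite normrM; apply: le_trans (ler_pM (normr_ge0 _) (normr_ge0 _) h4 h3) _.
    have -> : Cv * ((1 + y ^+ 2) / t) * (Ct * (1 + y ^+ 2)) = Cv * Ct * (1 + y ^+ 2) ^+ 2 * t^-1 by ring.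
    have c0 : 0 <= Cv * Ct by apply: mulr_ge0; exact: ltW.
    apply: ler_pM => //.
    - by apply: mulr_ge0.
    - by rewrite invr_ge0; apply: ltW; exact: lt_trans t1.
    - by apply: ler_wpM2l => //; rewrite (exprSr _ 2) ler_peMr.
  have -> : k * LT + v * k * T0 = k * (LT + v * T0) by ring.
  rewrite normrM.
  have h5' := le_trans (ler_normD LT (v * T0)) (lerD h2 h3).
  apply: le_trans (ler_pM (normr_ge0 _) (normr_ge0 _) h1 h5') _.
  rewrite le_eqVlt; apply/orP; left; apply/eqP.
  by move: (expR _) => e; field; rewrite gt_eqF.
have J_lip t1 : sigma < t1 < s -> `|J s - J t1| <= C5 * (E * M * (Ct * (1 + Cv)) / sigma) * (s - t1).
  move=> /andP[t1s t1s'].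
  have [c cI ->] : exists2 c, c \in `[t1, s] & J s - J t1 = D c * (s - t1).
    apply: MVT_segment; first exact: ltW.
      move=> x; rewrite in_itv /= => /andP[x1 x2]; apply: dJ.
      by rewrite (lt_trans t1s x1) (le_trans (ltW x2) s2).
    apply: derivable_within_continuous => x; rewrite in_itv /= => /andP[x1 x2].
    have xI : sigma < x <= sigma + lambda by rewrite (lt_le_trans t1s x1) (le_trans x2 s2).
    by have [] := dJ x xI.
  move: cI; rewrite in_itv /= => /andP[c1 c2].
  have st : 0 <= s - t1 by clear -t1s'; lra.
  rewrite normrM (ger0_norm st); apply: ler_wpM2r => //; apply: D_le.
  by rewrite (lt_le_trans t1s c1) (le_trans c2 s2).
have J_sigma : `|J s - J sigma| <= C5 * (E * M * (Ct * (1 + Cv)) / sigma) * (s - sigma).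
  apply/ler_addgt0Pr => e e0.
  have [d d0 hd] := flow_pairing_continuous hK hpsi cT hT e0.
  have [t1 [t1a t1b t1c]] : exists t1, [/\ sigma < t1, t1 < s & t1 < sigma + d].
    have [ds|ds] := leP d (s - sigma).
      by exists (sigma + d / 2); split; clear -ds d0; lra.
    by exists (sigma + (s - sigma) / 2); split; clear -ds s1; lra.
  have k1 := J_lip t1 ltac:(by rewrite t1a t1b).
  have k2 := hd t1 (ltW t1a) t1c; rewrite -!/(J _) in k2.
  rewrite -(subrKA (J t1)); apply: le_trans (ler_normD _ _) _; apply: lerD => //.
  apply: le_trans k1 _; apply: ler_wpM2l; first by apply: mulr_ge0 => //; exact: ltW.
  by clear -t1a; lra.
have Jpsi : part_mode chi0 Kc sigma psi 2 = J sigma.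
  rewrite /J (flow_init hK hpsi); apply: eq_Rintegral => y _.
  by rewrite /part_b cutE /T; ring.
rewrite Jpsi.
move: (part_mode _ _ _ _ _) cut_part J_sigma => m cut_part J_sigma.
rewrite -(subrKA (J s)); apply: le_trans (ler_normD _ _) _.
apply: le_trans (lerD cut_part J_sigma) _.
have -> : E * (Cg * ((B + 1) * Ck) + C5 * (Ct * (1 + Cv))) * ((s - sigma) / sigma * M) =
  Cg * (E * M * (B * (s - sigma) / sigma) * Ck) + C5 * (E * M * (Ct * (1 + Cv)) / sigma) * (s - sigma)
  + Cg * (E * M * ((s - sigma) / sigma) * Ck) by ring.
rewrite lerDl; apply: mulr_ge0; first exact: ltW.
apply: mulr_ge0; last exact: ltW.
apply: mulr_ge0 => //; apply: divr_ge0; last exact: ltW.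
by clear -s1; lra.
Qed.

End ModeEstimate.

(** * Reading the norms, and absorbing the time factors *)

Section Norms.
Set Implicit Arguments. Unset Strict Implicit.
Context {R : realType}.
Implicit Types (y : R).
Local Notation mu := (@lebesgue_measure R).

Let mu_gt0 : (0 < mu [set: R])%E.
Proof.
apply: (@lt_le_trans _ _ (mu `[0, 1]%classic)).
  by rewrite lebesgue_measure_itv /= lte_fin ltr01 sube0 lte_fin ltr01.
by apply: le_measure; rewrite ?inE//; exact: measurable_itv.
Qed.

Lemma norm_oo_leP (g : R -> R) (n : R) :
  (norm_oo g <= n%:E)%E <-> {ae mu, forall y, `|g y| <= n}.
Proof.
rewrite /norm_oo unlock /= mu_gt0; split.
  by move=> /ess_supP; apply: ae_mono => y /=; rewrite lee_fin.
by move=> h; apply/ess_supP; apply: ae_mono h => y /=; rewrite lee_fin.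
Qed.

Lemma norm_oo_ge0 (g : R -> R) : (0 <= norm_oo g)%E.
Proof. exact: Lnorm_ge0. Qed.

Lemma norm_minus_leP (chi0 : R -> R) Kc s (g : R -> R) (n : R) :
  (norm_minus chi0 Kc s g <= n%:E)%E <->
  {ae mu, forall y, `|part_minus chi0 Kc s g y| <= n * (1 + `|y| ^+ 3)}.
Proof.
have w0 y : 0 < 1 + `|y| ^+ 3 by rewrite ltr_wpDr.
rewrite /norm_minus norm_oo_leP; split; apply: ae_mono => y;
  by rewrite normrM normfV (gtr0_norm (w0 y)) ler_pdivrMr.
Qed.

Lemma finite_norms (S : R) (A B : \bar R) : (0 <= A)%E -> (0 <= B)%E ->
  (S%:E + A + B < +oo)%E -> exists u v : R, [/\ 0 <= u, 0 <= v, A = u%:E & B = v%:E].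
Proof.
case: A => [u| |]//; case: B => [v| |]//; rewrite !lee_fin => u0 v0 _.
by exists u, v.
Qed.

End Norms.

Section RealBounds.
Set Implicit Arguments. Unset Strict Implicit.
Context {R : realType}.

Lemma powR_half (s : R) : 0 <= s -> [/\ s `^ (0%:R / 2) = 1, s `^ (1%:R / 2) = Num.sqrt s,
  s `^ (2%:R / 2) = Num.sqrt s ^+ 2 & s `^ (3 / 2) = Num.sqrt s ^+ 3].
Proof.
move=> s0; split.
- by rewrite mul0r powRr0.
- by rewrite mul1r powR12_sqrt.
- by rewrite divff// powRr1// sqr_sqrtr.
- by rewrite mulrC powRrM powR12_sqrt// powR_mulrn// sqrtr_ge0.
Qed.

(** Over a time [s - sigma <= lambda] every time factor of the estimates stays
    between two positive constants, and so does [s / sigma]; one constant [P]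
    absorbs them all. *)
Record window (P sigma s : R) : Prop := Window {
  win_s : sigma <= s;
  win_P1 : 1 <= P;
  win_inv : sigma^-1 <= P / s;
  win_exp : expR (- (sigma / 2)) <= P * expR (- (s / 2));
  win_decay : forall k, 0 <= k <= 1 -> 1 <= P * expR (- ((s - sigma) * k));
  win_cube : (Num.sqrt sigma ^+ 3)^-1 <= P * expR (- (s - sigma) ^+ 2) / Num.sqrt s ^+ 3 }.

Lemma windowP lambda : 0 < lambda -> exists2 P, 0 < P &
  forall sigma s : R, 1 <= sigma -> sigma <= s <= sigma + lambda -> window P sigma s.
Proof.
move=> l0; have l1 : 1 <= 1 + lambda by clear -l0; lra.
(* the cube is needed for [(s / sigma)^(3/2)], with [s <= (1 + lambda) sigma] *)
pose L := (1 + lambda) ^+ 3; pose e1 := expR lambda; pose e2 := expR (lambda ^+ 2).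
have L1 : 1 + lambda <= L by rewrite /L exprS ler_peMr ?expr_ge1//; clear -l0; lra.
have e11 : 1 <= e1 by rewrite -[leLHS]expR0 ler_expR ltW.
have e21 : 1 <= e2 by rewrite -[leLHS]expR0 ler_expR sqr_ge0.
have L0 : 0 < L by clear -l0 L1; lra.
have [e10 e20] : 0 < e1 /\ 0 < e2 by split; exact: expR_gt0.
have PL : L <= L * (e1 * e2) by rewrite ler_peMr ?(ltW L0)// mulr_ege1.
have Pe1 : e1 <= L * (e1 * e2).
  by rewrite mulrCA ler_peMr ?(ltW e10)// mulr_ege1//; clear -l0 L1; lra.
have Pe2 : L * e2 <= L * (e1 * e2).
  by rewrite ler_pM2l// ler_peMl// ltW.
exists (L * (e1 * e2)); first by apply: mulr_gt0 => //; exact: mulr_gt0.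
move=> sigma s sg1 /andP[s1 s2]; move: (L * (e1 * e2)) PL Pe1 Pe2 => P PL Pe1 Pe2.
have sg0 : 0 < sigma by clear -sg1; lra.
have s0 : 0 < s by clear -sg1 s1; lra.
have sS : s <= (1 + lambda) * sigma.
  have : lambda * 1 <= lambda * sigma by apply: ler_wpM2l => //; exact: ltW.
  by clear -s2; lra.
split => //.
- by clear -L1 PL l0; lra.
- rewrite ler_pdivlMr// mulrC ler_pdivrMr//; apply: le_trans sS _.
  by apply: ler_wpM2r; [exact: ltW|exact: le_trans PL].
- apply: le_trans (_ : _ <= e1 * expR (- (s / 2))) _.
    by rewrite /e1 -expRD ler_expR; clear -s1 s2 l0; lra.
  by apply: ler_wpM2r => //; exact: expR_ge0.
- move=> k /andP[k0 k1]; apply: le_trans (_ : _ <= e1 * expR (- ((s - sigma) * k))) _.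
    rewrite /e1 -expRD -[leLHS]expR0 ler_expR subr_ge0.
    apply: le_trans (_ : _ <= (s - sigma) * 1) _; last by clear -s2; lra.
    by apply: ler_wpM2l => //; clear -s1; lra.
  by apply: ler_wpM2r => //; exact: expR_ge0.
have q0 : 0 < Num.sqrt sigma by rewrite sqrtr_gt0.
have r0 : 0 < Num.sqrt s by rewrite sqrtr_gt0.
have rq : Num.sqrt s <= (1 + lambda) * Num.sqrt sigma.
  rewrite -(@ler_pXn2r _ 2) ?nnegrE ?sqrtr_ge0//; last first.
    by apply: mulr_ge0; [clear -l0; lra|exact: ltW].
  rewrite exprMn !sqr_sqrtr ?(ltW s0)// ?(ltW sg0)//; apply: le_trans sS _.
  by apply: ler_wpM2r; [exact: ltW|rewrite expr2 ler_peMr//; clear -l0; lra].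
rewrite ler_pdivlMr ?exprn_gt0// mulrC ler_pdivrMr ?exprn_gt0//.
apply: le_trans (_ : _ <= L * Num.sqrt sigma ^+ 3) _.
  by rewrite /L -exprMn lerXn2r ?nnegrE ?sqrtr_ge0//; apply: mulr_ge0; [clear -l0; lra|exact: ltW].
apply: ler_wpM2r; first by rewrite exprn_ge0// ltW.
apply: le_trans (_ : _ <= L * e2 * expR (- (s - sigma) ^+ 2)) _; last first.
  by apply: ler_wpM2r => //; exact: expR_ge0.
rewrite -mulrA ler_peMr ?(ltW L0)// /e2 -expRD -[leLHS]expR0 ler_expR subr_ge0.
by rewrite lerXn2r ?nnegrE ?(ltW l0)//; clear -s1 s2; lra.
Qed.

(** The coefficient [(sigma / s)^2] costs nothing here:
    [1 - (sigma / s)^2 <= 2 (s - sigma) / s]. *)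
Lemma mode_window (P sigma s D b0 b1 b2 nm ne t : R) :
  window P sigma s -> 1 <= sigma -> 0 <= D ->
  0 <= b0 -> 0 <= b1 -> 0 <= b2 -> 0 <= nm -> 0 <= ne ->
  t <= b2 + D * ((s - sigma) / sigma * (b0 + b1 + b2 + nm + ne * expR (- (sigma / 2)))) ->
  t <= (sigma / s) ^+ 2 * b2 + (D * P + 2) * (s - sigma) / s * (b0 + b1 + b2 + nm)
    + (D * P + 2) * (s - sigma) * expR (- (s / 2)) * ne.
Proof.
move=> [ss P1 inv ex _ _] sg1 D0 b00 b10 b20 nm0 ne0 h; apply: le_trans h _.
have sg0 : 0 < sigma by clear -sg1; lra.
have s0 : 0 < s by clear -sg0 ss; lra.
have [x xE x0] : exists2 x, x = s - sigma & 0 <= x by exists (s - sigma) => //; clear -ss; lra.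
rewrite -xE.
have [A AE A0] : exists2 A, A = b0 + b1 + b2 + nm & 0 <= A.
  by exists (b0 + b1 + b2 + nm) => //; rewrite !addr_ge0.
have bA : b2 <= A by rewrite AE; clear -b00 b10 nm0; lra.
rewrite -AE.
have k0 : b2 <= (sigma / s) ^+ 2 * b2 + 2 * x / s * A.
  apply: (@le_trans _ _ ((sigma / s) ^+ 2 * b2 + 2 * x / s * b2)); last first.
    rewrite lerD2l; apply: ler_wpM2l => //; apply: divr_ge0; last exact: ltW.
    exact: mulr_ge0.
  rewrite -subr_ge0.
  have -> : (sigma / s) ^+ 2 * b2 + 2 * x / s * b2 - b2 = (x / s) ^+ 2 * b2.
    by rewrite xE; field; rewrite gt_eqF.
  by apply: mulr_ge0 => //; exact: sqr_ge0.
have k1 : D * (x / sigma * A) <= D * P * (x / s * A).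
  rewrite -(mulrA D); apply: ler_wpM2l => //.
  rewrite (_ : P * _ = x * (P / s) * A); last by ring.
  by apply: ler_wpM2r => //; exact: ler_wpM2l.
have k2 : D * (x / sigma * (ne * expR (- (sigma / 2)))) <= D * P * x * expR (- (s / 2)) * ne.
  rewrite (_ : D * P * _ * _ * ne = D * (x / 1 * (ne * (P * expR (- (s / 2)))))); last by field.
  apply: ler_wpM2l => //; apply: ler_pM.
  - by apply: divr_ge0 => //; exact: ltW.
  - by apply: mulr_ge0 => //; exact: expR_ge0.
  - by apply: ler_wpM2l => //; rewrite lef_pV2 ?posrE.
  - exact: ler_wpM2l.
have k3 : 0 <= 2 * x * expR (- (s / 2)) * ne.
  by apply: mulr_ge0 => //; apply: mulr_ge0; [exact: mulr_ge0|exact: expR_ge0].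
rewrite mulrDr mulrDr; apply: le_trans (lerD k0 (lerD k1 k2)) _.
rewrite -subr_ge0; move: k3; congr (_ <= _); ring.
Qed.

Lemma minus_window (P sigma s D b0 b1 b2 nm ne : R) :
  window P sigma s -> 1 <= sigma -> 0 <= D ->
  0 <= b0 -> 0 <= b1 -> 0 <= b2 -> 0 <= nm -> 0 <= ne ->
  D * ((b0 + b1 + Num.sqrt sigma * b2) / Num.sqrt sigma ^+ 2
     + (nm + ne / Num.sqrt sigma ^+ 3)) <=
  (D * P + 2) * expR (s - sigma) * ((s - sigma) ^+ 2 + 1) / s * (b0 + b1 + Num.sqrt s * b2)
    + (D * P + 2) * expR (- ((s - sigma) / 2)) * nm
    + (D * P + 2) * expR (- (s - sigma) ^+ 2) / Num.sqrt s ^+ 3 * ne.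
Proof.
move=> [ss P1 inv _ dec cub] sg1 D0 b00 b10 b20 nm0 ne0.
have sg0 : 0 < sigma by clear -sg1; lra.
have s0 : 0 < s by clear -sg0 ss; lra.
have C0 : D * P <= D * P + 2 by rewrite lerDl.
have DP : 0 <= D * P by apply: mulr_ge0 => //; clear -P1; lra.
have CC : 0 <= D * P + 2 := le_trans DP C0.
have qr : Num.sqrt sigma <= Num.sqrt s by exact: ler_wsqrtr.
rewrite sqr_sqrtr ?(ltW sg0)//.
have q0 : 0 <= Num.sqrt sigma := sqrtr_ge0 _.
have r0 : 0 <= Num.sqrt s := sqrtr_ge0 _.
rewrite [X in X <= _]mulrDr (mulrDr D nm) addrA; apply: lerD; first apply: lerD.
- have k : b0 + b1 + Num.sqrt sigma * b2 <= b0 + b1 + Num.sqrt s * b2.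
    by rewrite lerD2l; exact: ler_wpM2r.
  have k0 : 0 <= b0 + b1 + Num.sqrt sigma * b2 by rewrite !addr_ge0// mulr_ge0.
  have ee : 1 <= expR (s - sigma) * ((s - sigma) ^+ 2 + 1).
    rewrite -[leLHS]mulr1; apply: ler_pM => //; last by rewrite lerDr sqr_ge0.
    by rewrite -[leLHS]expR0 ler_expR; clear -ss; lra.
  apply: (@le_trans _ _ (D * P / s * (b0 + b1 + Num.sqrt s * b2))).
    rewrite -(mulrA D P) -(mulrA D); apply: ler_wpM2l => //.
    rewrite mulrC; apply: ler_pM => //; by rewrite invr_ge0 ltW.
  apply: ler_wpM2r; first exact: le_trans k.
  apply: ler_wpM2r; first by rewrite invr_ge0 ltW.
  by rewrite -mulrA -[leLHS]mulr1; apply: ler_pM.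
- have k := dec (2^-1) ltac:(by apply/andP; split; lra).
  apply: ler_wpM2r => //; apply: (@le_trans _ _ (D * P * expR (- ((s - sigma) / 2)))).
    by rewrite -mulrA ler_peMr.
  by apply: ler_wpM2r => //; exact: expR_ge0.
rewrite mulrA mulrAC; apply: ler_wpM2r => //.
apply: (@le_trans _ _ (D * P * expR (- (s - sigma) ^+ 2) / Num.sqrt s ^+ 3)).
  rewrite -(mulrA D) -(mulrA D); apply: ler_wpM2l => //.
apply: ler_wpM2r; first by rewrite invr_ge0 exprn_ge0.
by apply: ler_wpM2r => //; exact: expR_ge0.
Qed.

Lemma exterior_window (P sigma s k D b0 b1 b2 nm ne : R) :
  window P sigma s -> 1 <= sigma -> 0 <= D -> 0 <= k <= 1 ->
  0 <= b0 -> 0 <= b1 -> 0 <= b2 -> 0 <= nm -> 0 <= ne ->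
  D * (b0 + Num.sqrt sigma * b1 + Num.sqrt sigma ^+ 2 * b2 + Num.sqrt sigma ^+ 3 * nm + ne) <=
  (D * P + 2) * expR (s - sigma) * (b0 + Num.sqrt s * b1 + Num.sqrt s ^+ 2 * b2
     + Num.sqrt s ^+ 3 * nm) + (D * P + 2) * expR (- ((s - sigma) * k)) * ne.
Proof.
move=> [ss P1 inv _ dec cub] sg1 D0 kI b00 b10 b20 nm0 ne0.
have C0 : D * P <= D * P + 2 by rewrite lerDl.
have DP : D <= D * P by rewrite ler_peMr.
have CC : 0 <= D * P + 2 := le_trans D0 (le_trans DP C0).
have qr : Num.sqrt sigma <= Num.sqrt s by exact: ler_wsqrtr.
have q0 : 0 <= Num.sqrt sigma := sqrtr_ge0 _.
have r0 : 0 <= Num.sqrt s := sqrtr_ge0 _.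
rewrite (mulrDr D); apply: lerD.
  apply: ler_pM => //.
  - by rewrite !addr_ge0// mulr_ge0// exprn_ge0.
  - apply: le_trans (le_trans DP C0) _; rewrite ler_peMr//.
    by rewrite -[leLHS]expR0 ler_expR; clear -ss; lra.
  - by apply: lerD; [apply: lerD; [apply: lerD => //|]|];
      apply: ler_wpM2r => //; rewrite lerXn2r.
apply: ler_wpM2r => //; apply: (@le_trans _ _ (D * P * expR (- ((s - sigma) * k)))).
  by rewrite -mulrA ler_peMr// dec.
by apply: ler_wpM2r => //; exact: expR_ge0.
Qed.

End RealBounds.

(** * The theorem *)

Theorem lemma7 (R : realType) (p : R) (hp : 1 < p)
    (chi0 : R -> R) (hchi0 : cutoff_profile chi0)
    (iota : bool) (a M mu : R) :
  exists2 K0 : R, 0 < K0 & forall Kc : R, K0 <= Kc ->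
  forall lambda : R, 0 < lambda ->
  exists2 C : R, 0 < C &
  forall h phi : R -> R,
    perturbation iota p a M mu h -> ode_solution p h phi ->
  exists2 sigma0 : R, 1 <= sigma0 &
  forall (K : R -> R -> (R -> R) -> (R -> R)) (sigma : R), sigma0 <= sigma ->
    fundamental_solution (potential iota p h phi) sigma K ->
  forall psi : R -> R, measurable_fun setT psi ->
    (\sum_(m < 3) `|part_mode chi0 Kc sigma psi m|%:E
     + norm_minus chi0 Kc sigma psi + norm_ext chi0 Kc sigma psi < +oo)%E ->
  forall s : R, sigma <= s <= sigma + lambda ->
  let theta := K s sigma psi in
  let psi_ (m : nat) := `|part_mode chi0 Kc sigma psi m| in
  [/\ (`|part_mode chi0 Kc s theta 2|%:E <=
        ((sigma / s) ^+ 2 * psi_ 2%N)%:E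
        + (C * (s - sigma) / s)%:E
          * ((\sum_(l < 3) psi_ l)%:E + norm_minus chi0 Kc sigma psi)
        + (C * (s - sigma) * expR (- (s / 2)))%:E
          * norm_ext chi0 Kc sigma psi)%E,
      (norm_minus chi0 Kc s theta <=
        (C * expR (s - sigma) * ((s - sigma) ^+ 2 + 1) / s
          * (psi_ 0%N + psi_ 1%N + Num.sqrt s * psi_ 2%N))%:E
        + (C * expR (- ((s - sigma) / 2)))%:E * norm_minus chi0 Kc sigma psi
        + (C * expR (- (s - sigma) ^+ 2) / s `^ (3 / 2))%:E
          * norm_ext chi0 Kc sigma psi)%E &
      (norm_ext chi0 Kc s theta <=
        (C * expR (s - sigma))%:E
          * ((\sum_(l < 3) s `^ (l%:R / 2) * psi_ l)%:E
             + (s `^ (3 / 2))%:E * norm_minus chi0 Kc sigma psi)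
        + (C * expR (- ((s - sigma) / p)))%:E
          * norm_ext chi0 Kc sigma psi)%E].
Proof.
have [Cv Cv0 hV] := potential_bound hp iota a M mu.
(* at the distance [3 sqrt sigma] the weight [exp (y^2 / 16)] exceeds
   [exp (sigma / 2)] *)
exists 3 => // Kc hKc lambda hl.
have [C1 C10 est1] := mode_estimate hchi0 hKc hl Cv0.
have [C2 C20 est2] := minus_estimate hchi0 hKc hl Cv0.
have [C3 C30 est3] := exterior_estimate hchi0 hKc hl Cv0.
have [P P0 hw] := windowP hl.
have [D DE [D0 D1]] : exists2 D, D = C1 + C2 + C3 + 1 & 0 < D /\ [/\ C1 <= D, C2 <= D, C3 <= D & 1 <= D].
  by exists (C1 + C2 + C3 + 1) => //; split; [|split]; clear -C10 C20 C30; lra.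
case: D1 => D1 D2 D3 D4.
(* the summand [2] pays for the coefficient [(sigma / s)^2] *)
exists (D * P + 2); first by apply: addr_gt0 => //; exact: mulr_gt0.
move=> h phi hper hode; have [s0 s01 hV0] := hV h phi hper hode.
exists s0 => // K sigma sg hK psi mpsi.
have sg1 : 1 <= sigma := le_trans s01 sg.
rewrite sumEFin => /(finite_norms (norm_oo_ge0 _) (norm_oo_ge0 _)) [nm [ne [nm0 ne0 nmE neE]]].
rewrite -/(norm_minus chi0 Kc sigma psi) in nmE; rewrite -/(norm_ext chi0 Kc sigma psi) in neE.
move=> s sI theta psi_.
have hm : {ae @lebesgue_measure R, forall y,
    `|part_minus chi0 Kc sigma psi y| <= nm * (1 + `|y| ^+ 3)}.
  by apply/norm_minus_leP; rewrite nmE.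
have he : {ae @lebesgue_measure R, forall y, `|part_e chi0 Kc sigma psi y| <= ne}.
  by apply/norm_oo_leP; rewrite -/(norm_ext chi0 Kc sigma psi) neE.
have su : setup chi0 Kc Cv sigma (potential iota p h phi) K psi nm ne.
  by split => // t y ts; have [] := hV0 t y (le_trans sg ts).
have {}hw := hw sigma s sg1 sI; have /andP[s1 s2] := sI.
rewrite nmE neE.
have th0 : s = sigma -> theta = psi.
  by move=> sE; rewrite /theta sE; exact: flow_init hK (psi_L2 hchi0 hKc su).
have sc : sigma < s <= sigma + lambda \/ s = sigma.
  by move: s1; rewrite le_eqVlt => /orP[/eqP->|s1]; [right|left; rewrite s1].
(* at [s = sigma] the solution is the datum itself, known only almost
   everywhere *)
have e1 : `|part_mode chi0 Kc s theta 2| <= psi_ 2%N + D * ((s - sigma) / sigma *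
    (psi_ 0%N + psi_ 1%N + psi_ 2%N + nm + ne * expR (- (sigma / 2)))).
  case: sc => [sc|sE]; last first.
    by rewrite th0// sE subrr !mul0r mulr0 addr0.
  have h1 := est1 _ _ _ _ _ _ su s sc.
  have X0 : 0 <= (s - sigma) / sigma * (psi_ 0%N + psi_ 1%N + psi_ 2%N + nm + ne * expR (- (sigma / 2))).
    apply: mulr_ge0; first by apply: divr_ge0; [rewrite subr_ge0|exact: le_trans sg1].
    by rewrite !addr_ge0 ?mulr_ge0 ?expR_ge0// /psi_ normr_ge0.
  have h2 := le_trans h1 (ler_wpM2r X0 D1).
  have tri (u v X : R) : `|u - v| <= X -> `|u| <= `|v| + X.
    by move=> uv; rewrite -lerBlDl; apply: le_trans (lerB_dist _ _) uv.
  exact: tri h2.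
have e2 : {ae @lebesgue_measure R, forall y, `|part_minus chi0 Kc s theta y| <=
    D * ((psi_ 0%N + psi_ 1%N + Num.sqrt sigma * psi_ 2%N) / Num.sqrt sigma ^+ 2
     + (nm + ne / Num.sqrt sigma ^+ 3)) * (1 + `|y| ^+ 3)}.
  have [q1 q0 _] := q_facts su.
  have iq k : 0 <= (Num.sqrt sigma ^+ k)^-1 by rewrite invr_ge0 exprn_ge0// ltW.
  have Y0 : 0 <= (psi_ 0%N + psi_ 1%N + Num.sqrt sigma * psi_ 2%N) / Num.sqrt sigma ^+ 2.
    apply: mulr_ge0 => //; apply: addr_ge0; first by apply: addr_ge0; exact: normr_ge0.
    by apply: mulr_ge0; [exact: ltW|exact: normr_ge0].
  have Z0 : 0 <= ne / Num.sqrt sigma ^+ 3 by exact: mulr_ge0.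
  have W0 (y : R) : 0 <= 1 + `|y| ^+ 3 by rewrite addr_ge0.
  case: sc => [sc|sE].
    apply: ae_all => y; apply: le_trans (est2 _ _ _ _ _ _ su s y sc) _.
    apply: ler_wpM2r => //; apply: ler_wpM2r => //.
    by apply: addr_ge0 => //; exact: addr_ge0.
  rewrite th0// sE; apply: ae_mono hm => y hy; apply: le_trans hy _.
  apply: ler_wpM2r => //; move: Y0 Z0; move: (_ / _) (ne / _) => Y Z Y0 Z0.
  apply: (@le_trans _ _ (1 * (Y + (nm + Z)))); first by clear -Y0 Z0; lra.
  by apply: ler_wpM2r => //; apply: addr_ge0 => //; exact: addr_ge0.
have e3 : {ae @lebesgue_measure R, forall y, `|part_e chi0 Kc s theta y| <=
    D * (psi_ 0%N + Num.sqrt sigma * psi_ 1%N + Num.sqrt sigma ^+ 2 * psi_ 2%N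
     + Num.sqrt sigma ^+ 3 * nm + ne)}.
  have [q1 q0 _] := q_facts su.
  have Y0 : 0 <= psi_ 0%N + Num.sqrt sigma * psi_ 1%N + Num.sqrt sigma ^+ 2 * psi_ 2%N
      + Num.sqrt sigma ^+ 3 * nm.
    have qk k (x : R) : 0 <= x -> 0 <= Num.sqrt sigma ^+ k * x.
      by move=> x0; apply: mulr_ge0 => //; apply: exprn_ge0; exact: ltW.
    apply: addr_ge0; last exact: qk.
    apply: addr_ge0; last by apply: qk; exact: normr_ge0.
    by apply: addr_ge0; [exact: normr_ge0|apply: (qk 1%N); exact: normr_ge0].
  move: Y0; set Y := (psi_ 0%N + _ + _ + _) => Y0.
  have Y1 : 0 <= Y + ne by exact: addr_ge0.
  case: sc => [sc|sE].
    apply: ae_all => y; apply: le_trans (est3 _ _ _ _ _ _ su s y sc) _.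
    exact: ler_wpM2r.
  rewrite th0// sE; apply: ae_mono he => y hy; apply: le_trans hy _.
  apply: (@le_trans _ _ (1 * (Y + ne))); last exact: ler_wpM2r.
  by rewrite mul1r lerDr.
have sp : 0 <= s by apply: le_trans s1; exact: le_trans sg1.
have [w0 w1 w2 w3] := powR_half sp.
rewrite w3.
have -> : \sum_(l < 3) s `^ (l%:R / 2) * psi_ l =
    psi_ 0%N + Num.sqrt s * psi_ 1%N + Num.sqrt s ^+ 2 * psi_ 2%N.
  rewrite (sum3 (fun l => s `^ (l%:R / 2) * psi_ l)) w0 w1 w2 mul1r //.
rewrite (sum3 psi_).
have b0 l : 0 <= psi_ l by exact: normr_ge0.
move: (psi_ 0%N) (psi_ 1%N) (psi_ 2%N) (b0 0%N) (b0 1%N) (b0 2%N) e1 e2 e3.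
move=> a0 a1 a2 a00 a10 a20 e1 e2 e3.
split.
- rewrite -!EFinD lee_fin.
  exact: mode_window hw sg1 (ltW D0) a00 a10 a20 nm0 ne0 e1.
- rewrite -!EFinD; apply/norm_minus_leP; apply: ae_mono e2 => y e2.
  apply: le_trans e2 _; apply: ler_wpM2r; first by rewrite addr_ge0.
  exact: minus_window hw sg1 (ltW D0) a00 a10 a20 nm0 ne0.
- rewrite -!EFinD; apply/norm_oo_leP; apply: ae_mono e3 => y e3.
  apply: le_trans e3 _.
  apply: (exterior_window (k := p^-1) hw sg1 (ltW D0) _ a00 a10 a20 nm0 ne0).
  by rewrite invr_ge0 invf_le1; lra.
Qed.
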